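(* Suppose that $\Omega=B_{\varrho_\Omega}^{\mathbb{C}}(0)$. The basic Bicomplex radial formal powers $\{\mathcal{Z}_f^{(n)}(1;z),\mathcal{Z}_f^{(n)}(\mathbf{j};z)\}_{n=0}^\infty$ satisfy the following orthogonality relations for all $m,n\in\mathbb{N}=\{1,2,\dots\}$ and $\Lambda\in\{1,\mathbf{j}\}$: $$\left\langle\mathcal{Z}_f^{(n)}(1;\cdot),\mathcal{Z}_f^{(m)}(\mathbf{j};\cdot)\right\rangle_{L_2(\Omega;\mathbb{B})}=0,$$ $$\left\langle\mathcal{Z}_f^{(n)}(\Lambda;\cdot),\mathcal{Z}_f^{(m)}(\Lambda;\cdot)\right\rangle_{L_2(\Omega;\mathbb{B})}=\pi\left(\left\|\phi_f^{(n)}\right\|^2_{L_2(0,\varrho_\Omega;r^{2n+1}dr)}+\left\|\phi_{\frac1f}^{(n)}\right\|^2_{L_2(0,\varrho_\Omega;r^{2n+1}dr)}\right)\delta_{n,m},$$ $$\left\langle\mathcal{Z}_f^{(0)}(1;\cdot),\mathcal{Z}_f^{(m)}(\Lambda;\cdot)\right\rangle_{L_2(\Omega;\mathbb{B})}=\left\langle\mathcal{Z}_f^{(0)}(\mathbf{j};\cdot),\mathcal{Z}_f^{(m)}(\Lambda;\cdot)\right\rangle_{L_2(\Omega;\mathbb{B})}=0.$$ Furthermore, the basic Bicomplex radial formal powers are an orthogonal basis for the complex Hilbert space $\mathcal{A}_f^2(\Omega;\mathbb{B})$.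
   Context: $\mathbb{B}$ is the algebra of bicomplex numbers $W=u+\mathbf{j}v$, $u,v\in\mathbb{C}$, $\mathbf{j}^2=-1$, $\mathbf{j}i=i\mathbf{j}$; $\operatorname{Sc}W=u$, $\operatorname{Vec}W=v$, $\overline{W}=u-\mathbf{j}v$. With $^*$ complex conjugation, $\langle W,V\rangle_{\mathbb{B}}=\operatorname{Sc}W(\operatorname{Sc}V)^*+\operatorname{Vec}W(\operatorname{Vec}V)^*$ and $\langle F,G\rangle_{L_2(\Omega;\mathbb{B})}=\iint_\Omega\langle F(z),G(z)\rangle_{\mathbb{B}}\,dA_z$. $C^k(\Omega;\mathbb{B})$ and $L_2(\Omega;\mathbb{B})$ are defined componentwise. For $z=x+iy$, $\widehat z=x+\mathbf{j}y\in\mathbb{B}$, and $\overline{\boldsymbol{\partial}}=\frac12\left(\frac{\partial}{\partial x}+\mathbf{j}\frac{\partial}{\partial y}\right)$. $B_R^{\mathbb{C}}(0)$ is the open disk of radius $R$ centred at $0$. Setting. $\varrho_\Omega=\sup_{z\in\Omega}|z|\in(0,\infty)$. The function $q_f\in C^1[0,\varrho_\Omega]$ is complex-valued, and $f\in C^2[0,\varrho_\Omega]$ is complex-valued, nowhere zero on $[0,\varrho_\Omega]$, satisfies $f''(r)+\frac1rf'(r)-q_f(r)f(r)=0$ on $(0,\varrho_\Omega)$, and is normalized by $f(0)=1$, $\lim_{r\to0^+}rf'(r)=0$; $f$ is identified with the radial function $z\mapsto f(|z|)$, assumed to be in $C^2(\overline\Omega)$. Put $q_{\frac1f}=2\left(\frac{f'}{f}\right)^2-q_f$,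 the potential associated in the same way to $\frac1f$. For $g\in\{f,\frac1f\}$ let $G^g\in C^2([0,\varrho_\Omega]\times[0,1])$ be the kernel (known to exist) satisfying $$r\left(G^g_{rr}(r,t)-q_g(r)G^g(r,t)\right)-G^g_r(r,t)+2(1-t)G^g_{rt}(r,t)=0,$$ $$G^g(r,0)=\int_0^r\tau q_g(\tau)\,d\tau,\qquad G^g(0,t)=0,$$ and define, for complex-valued $h\in C(\Omega)$, $\mathbf{T}_gh(z)=h(z)+\int_0^1\sigma\,G^g(|z|,1-\sigma^2)\,h(\sigma^2z)\,d\sigma$. Put $\mathcal{T}_fW=\mathbf{T}_f\operatorname{Sc}W+\mathbf{j}\,\mathbf{T}_{\frac1f}\operatorname{Vec}W$ for $W\in C(\Omega;\mathbb{B})$. The basic Bicomplex radial formal powers are $\mathcal{Z}_f^{(n)}(1;z)=\mathcal{T}_f[\widehat z^n]$ and $\mathcal{Z}_f^{(n)}(\mathbf{j};z)=\mathcal{T}_f[\mathbf{j}\widehat z^n]$, $n\geqslant0$. For $g\in\{f,\frac1f\}$ and $n\geqslant0$, $\phi_g^{(n)}(r)=\frac{y_n^g(r)}{r^{n+\frac12}}$, where $y_n^g$ is the unique solution of $-y''+\frac{(n-\frac12)(n+\frac12)}{r^2}y+q_g(r)y=0$ on $(0,\varrho_\Omega]$ with $y(r)\sim r^{n+\frac12}$ and $y'(r)\sim(n+\frac12)r^{n-\frac12}$ as $r\to0^+$. (Known fact: $\mathbf{T}_g[r^ne^{in\theta}]=\phi_g^{(n)}(r)r^ne^{in\theta}$.)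 The notation $\|\phi\|^2_{L_2(0,\varrho_\Omega;w(r)dr)}$ means $\int_0^{\varrho_\Omega}|\phi(r)|^2w(r)\,dr$. $\mathcal{A}_f^2(\Omega;\mathbb{B})$ is the space of $W\in C^1(\Omega;\mathbb{B})\cap L_2(\Omega;\mathbb{B})$ with $\overline{\boldsymbol{\partial}}W=\frac{\overline{\boldsymbol{\partial}}f}{f}\overline{W}$ in $\Omega$, with the inner product of $L_2(\Omega;\mathbb{B})$ (a complex Hilbert space). *)

(* Defs.v *)
From mathcomp Require Import all_boot all_order all_algebra.
From mathcomp Require Import all_classical all_reals all_analysis.
From mathcomp Require Import complex.

Set Implicit Arguments.
Unset Strict Implicit.
Unset Printing Implicit Defensive.

Import Order.TTheory GRing.Theory Num.Theory.
Import numFieldNormedType.Exports.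

Local Open Scope classical_set_scope.
Local Open Scope ring_scope.
Local Open Scope complex_scope.

(* Num.Theory shadows the projections of R[i] with those of numClosedField. *)
Local Notation Re := (@complex.Re _).
Local Notation Im := (@complex.Im _).

(* The complex plane, as the domain of functions of z = x + iy, is represented
   by R * R, so that partial derivatives and area measure are those of the
   library. Beware that the library norm on R * R is the max norm: |z| is
   [cmod z] below. *)

Section ComplexValued.
Context {R : realType}.

Definition cmod (z : R * R) : R := Normc.normc (z.1 +i* z.2).

Definition disk (rho : R) : set (R * R) := [set z | cmod z < rho].

(* C^k regularity on A for real functions, all partial derivatives being taken
   along the directions [dirs]: the derivatives of order at most k exist in the
   interior of A and extend continuously to A. For A open this is the usual
   C^k(A); it also covers C^k[a, b], C^k of a closed rectangle and of a closed
   disk, without giving a meaning to two-sided derivatives on the boundary. *)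
Fixpoint partials_extend (V : normedModType R) (dirs : seq V) (k : nat)
    (A : set V) (F : V -> R) : Prop :=
  (exists2 Fbar : V -> R, {within A, continuous Fbar} &
     forall p, A° p -> Fbar p = F p) /\
  (if k is k'.+1 then
     forall v, v \in dirs ->
       (forall p, A° p -> derivable F p v) /\
       partials_extend dirs k' A (fun p => 'D_v F p)
   else True).

Definition realCk (V : normedModType R) (dirs : seq V) (k : nat)
    (A : set V) (F : V -> R) : Prop :=
  {within A, continuous F} /\ partials_extend dirs k A F.

Definition Ck1 (k : nat) (A : set R) (F : R -> R[i]) : Prop :=
  realCk [:: (1 : R)] k A (fun x => Re (F x)) /\
  realCk [:: (1 : R)] k A (fun x => Im (F x)).

Definition dirx : R * R := (1, 0).
Definition diry : R * R := (0, 1).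

Definition Ck2 (k : nat) (A : set (R * R)) (F : R * R -> R[i]) : Prop :=
  realCk [:: dirx; diry] k A (fun z => Re (F z)) /\
  realCk [:: dirx; diry] k A (fun z => Im (F z)).

Definition cderive (F : R -> R[i]) (x : R) : R[i] :=
  derive1 (fun t => Re (F t)) x +i* derive1 (fun t => Im (F t)) x.

Definition cpartial (v : R * R) (F : R * R -> R[i]) (z : R * R) : R[i] :=
  'D_v (fun w => Re (F w)) z +i* 'D_v (fun w => Im (F w)) z.

Definition cintegral d (T : measurableType d)
    (mu : {measure set T -> \bar R}) (A : set T) (F : T -> R[i]) : R[i] :=
  (\int[mu]_(x in A) Re (F x)) +i* (\int[mu]_(x in A) Im (F x)).

Definition leb : {measure set (measurableTypeR R) -> \bar R} :=
  @lebesgue_measure R.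

Definition area : {measure set (measurableTypeR R * measurableTypeR R)%type -> \bar R} :=
  (@lebesgue_measure R \x @lebesgue_measure R)%E.

End ComplexValued.

(* Bicomplex numbers u + j v are the complexification of R[i]; the alias
   Rcomplex carries both the ring structure and the R[i]-module structure. *)
Notation bicomplex R := (Rcomplex R[i]).

Section Bicomplex.
Context {R : realType}.
Implicit Types (W V : bicomplex R) (F G : R * R -> bicomplex R).

Definition Sc W : R[i] := Re W.
Definition Vec W : R[i] := Im W.
Definition mkB (u v : R[i]) : bicomplex R := Complex u v.
Definition jB : bicomplex R := mkB 0 1.
Definition bconj W : bicomplex R := mkB (Sc W) (- Vec W).

Definition bdot W V : R[i] := Sc W * (Sc V)^* + Vec W * (Vec V)^*.

Definition hat (z : R * R) : bicomplex R := mkB z.1%:C z.2%:C.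

Definition BCk (k : nat) (A : set (R * R)) F : Prop :=
  Ck2 k A (fun z => Sc (F z)) /\ Ck2 k A (fun z => Vec (F z)).

Definition L2 (A : set (R * R)) (F : R * R -> R) : Prop :=
  F \_ A \in Lfun (@area R) 2%:E.

Definition BL2 (A : set (R * R)) F : Prop :=
  [/\ L2 A (fun z => Re (Sc (F z))), L2 A (fun z => Im (Sc (F z))),
      L2 A (fun z => Re (Vec (F z))) & L2 A (fun z => Im (Vec (F z)))].

Definition inner (A : set (R * R)) F G : R[i] :=
  cintegral area A (fun z => bdot (F z) (G z)).

Definition bpartial (v : R * R) F (z : R * R) : bicomplex R :=
  mkB (cpartial v (fun w => Sc (F w)) z) (cpartial v (fun w => Vec (F w)) z).

Definition dbar F (z : R * R) : bicomplex R :=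
  (2^-1 : R[i]) *: (bpartial dirx F z + jB * bpartial diry F z).

Definition radial (f : R -> R[i]) (z : R * R) : R[i] := f (cmod z).

Definition bergman (A : set (R * R)) (f : R -> R[i]) :
    set (R * R -> bicomplex R) :=
  [set F | [/\ BCk 1 A F, BL2 A F &
     forall z, A z ->
       dbar F z = ((radial f z)^-1 *: dbar (fun w => mkB (radial f w) 0) z)
                    * bconj (F z)]].

(* Density of the complex linear span is the completeness part: for orthogonal
   nonzero e it is equivalent to norm convergence of the Fourier series. Values
   outside A play no role, functions on A being represented by total ones. *)
Definition orthogonal_basis (I : eqType) (A : set (R * R))
    (H : set (R * R -> bicomplex R)) (e : I -> R * R -> bicomplex R) : Prop :=
  [/\ forall i, H (e i),
      forall i, inner A (e i) (e i) != 0,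
      forall i k, i != k -> inner A (e i) (e k) = 0 &
      forall F, H F -> forall eps : R, 0 < eps ->
        exists (s : seq I) (c : I -> R[i]),
          let D z := F z - \sum_(i <- s) c i *: e i z in
          Re (inner A D D) < eps].

End Bicomplex.

Section RadialFormalPowers.
Context {R : realType}.
Implicit Types (q f y phi : R -> R[i]) (G : R * R -> R[i]) (rho : R).

(* q_{1/f}; as the derivative is two-sided, only the values on the open
   interval ]0, rho[ are meaningful, and only those are used. *)
Definition darboux q f (r : R) : R[i] :=
  2 * (cderive f r / f r) ^+ 2 - q r.

Definition radial_schrodinger rho q f : Prop :=
  forall r : R, 0 < r < rho ->
    cderive (cderive f) r + (r^-1)%:C * cderive f r - q r * f r = 0.

Definition transmutation_kernel rho q G : Prop :=
  [/\ Ck2 2 (`[0, rho] `*` `[0, 1]) G,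
      forall r t : R, 0 < r < rho -> 0 < t < 1 ->
        r%:C * (cpartial dirx (cpartial dirx G) (r, t) - q r * G (r, t))
        - cpartial dirx G (r, t)
        + (2 * (1 - t))%:C * cpartial diry (cpartial dirx G) (r, t) = 0,
      forall r : R, 0 <= r <= rho ->
        G (r, 0) = cintegral leb `[0, r] (fun tau => tau%:C * q tau) &
      forall t : R, 0 <= t <= 1 -> G (0, t) = 0].

Definition Top G (h : R * R -> R[i]) (z : R * R) : R[i] :=
  h z + cintegral leb `[0, 1]
    (fun s => s%:C * G (cmod z, 1 - s ^+ 2)
              * h (s ^+ 2 * z.1, s ^+ 2 * z.2)).

(* [Gf] and [Ginv] are the kernels associated with f and 1/f. *)
Definition TTop (Gf Ginv : R * R -> R[i]) (W : R * R -> bicomplex R)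
    (z : R * R) : bicomplex R :=
  mkB (Top Gf (fun w => Sc (W w)) z) (Top Ginv (fun w => Vec (W w)) z).

(* Used for Lam = 1 and Lam = jB only. *)
Definition formal_power (Gf Ginv : R * R -> R[i]) (n : nat)
    (Lam : bicomplex R) : R * R -> bicomplex R :=
  TTop Gf Ginv (fun w => Lam * hat w ^+ n).

(* The equation is stated in the open interval; it holds at rho, with one-sided
   derivatives, by the C^2 regularity on ]0, rho]. *)
Definition regular_solution rho q (n : nat) y : Prop :=
  [/\ Ck1 2 `]0, rho] y,
      forall r : R, 0 < r < rho ->
        - cderive (cderive y) r
        + ((n%:R - 2^-1) * (n%:R + 2^-1) / r ^+ 2)%:C * y r + q r * y r = 0,
      Normc.normc (y r / (r `^ (n%:R + 2^-1))%:C - 1) @[r --> 0^'+] --> (0 : R) &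
      Normc.normc (cderive y r
          / ((n%:R + 2^-1) * r `^ (n%:R - 2^-1))%:C - 1)
        @[r --> 0^'+] --> (0 : R)].

Definition phi_of (n : nat) y (r : R) : R[i] := y r / (r `^ (n%:R + 2^-1))%:C.

Definition weighted_norm2 rho (n : nat) phi : R :=
  \int[leb]_(r in `]0, rho[) (Normc.normc (phi r) ^+ 2 * r ^+ (2 * n + 1)).

End RadialFormalPowers.

(* Main.v *)
(* On z^n = r^n e^(in t) the transmutation operators act as multiplication by
   the radial factors phi_f^(n)(|z|) and phi_{1/f}^(n)(|z|): the kernel moment
   1 + int_0^1 s^(2n+1) G(r, 1 - s^2) ds solves, by the equation of G and an
   integration by parts, the radial equation whose regular solution is unique.
   The two families are exchanged by the Darboux transformation
     r P' + n P - r (f'/f) P = n Q,   r Q' + n Q + r (f'/f) Q = n P,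
   which is the Vekua equation for (P r^n cos n t, Q r^n sin n t).
   Orthogonality follows from the rotation invariance of area, obtained by
   writing rotations as products of shears.

   Completeness: the angular modes of a solution W satisfy the same first
   order system in r, and near r = 0 its bounded solutions are the multiples of
   (P r^n, Q r^n). Averaging W over rotations against the trigonometric
   polynomial c_N (1 + cos a)^N therefore gives a combination of formal powers,
   and it tends to W in L_2 because c_N int (1 - cos a) (1 + cos a)^N da is
   1 / (N + 1) while int |W(e^(ia) z) - W(z)|^2 <= eta + C (1 - cos a). *)

(* The origin shapes most steps. The radial equation and the mode system are singular at r = 0 and
   are known only on an open interval, so no initial value can be imposed there. Uniqueness is drawn
   from limits at 0+, and the energy estimate survives because the singular term -(2n+1)/r |D'|^2
   has the favourable sign. In the plane, the bounds F' = O(r) carry the radial factors across the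
   origin, where z/|z| has no limit. The summand 1 of the kernel moment is what makes the radial
   equation homogeneous: it contributes r q(r), which the edge value of G_r at t = 0 cancels. Polar
   integration is not a change of variables here: the integral over a disk is differentiated in its
   radius, starting from the area of disks. The averaging kernel is nonnegative of mass one, which
   gives Jensen's inequality, and has finitely many frequencies, which makes the average a finite
   sum. In the rotation estimate a radius s < rho separates a disk where the gradient of W is
   bounded from a tail of small mass, which rotations preserve. *)
Require Import Defs.
From HB Require Import structures.
From mathcomp Require Import all_boot all_order all_algebra.
From mathcomp Require Import all_classical all_reals all_analysis.
From mathcomp Require Import measurable_realfun.
From mathcomp Require Import complex ring lra.

Set Implicit Arguments.
Unset Strict Implicit.
Unset Printing Implicit Defensive.

Import Order.TTheory GRing.Theory Num.Theory.
Import numFieldNormedType.Exports.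

Local Open Scope classical_set_scope.
Local Open Scope ring_scope.
Local Open Scope complex_scope.

Local Notation Re := (@complex.Re _).
Local Notation Im := (@complex.Im _).
Local Notation normc := Normc.normc.

(** * Differentiation and ordinary differential equations *)

(* Unlike [is_derive] this is not a type class, so that [apply] does not start
   instance resolution. *)
Definition has_derive {R : realType} {V : normedModType R} (x v : V) (f : V -> R)
    (a : R) : Prop := is_derive x v f a.

Section PointwiseDerivatives.
Context {R : realType} {V : normedModType R}.
Implicit Types (f g : V -> R) (x v : V) (a b : R).

Lemma has_derive_val f x v a b : has_derive x v f a -> a = b -> has_derive x v f b.
Proof. by move=> + <-. Qed.

Lemma has_derive_add f g x v a b : has_derive x v f a -> has_derive x v g b ->
  has_derive x v (fun t => f t + g t) (a + b).
Proof. by move=> fa gb; exact: is_deriveD. Qed.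

Lemma has_derive_sub f g x v a b : has_derive x v f a -> has_derive x v g b ->
  has_derive x v (fun t => f t - g t) (a - b).
Proof. by move=> fa gb; exact: is_deriveB. Qed.

Lemma has_derive_opp f x v a : has_derive x v f a ->
  has_derive x v (fun t => - f t) (- a).
Proof. by move=> fa; exact: is_deriveN. Qed.

Lemma has_derive_mul f g x v a b : has_derive x v f a -> has_derive x v g b ->
  has_derive x v (fun t => f t * g t) (a * g x + f x * b).
Proof.
move=> fa gb; have [fgd fgE] := is_deriveM fa gb; split; first exact: fgd.
by rewrite [LHS]fgE /GRing.scale /= addrC mulrC.
Qed.

Lemma has_derive_const (c : R) x v : has_derive x v (fun=> c) 0.
Proof. exact: is_derive_cst. Qed.

(** Restricted to the line s -> s v + x, the directional derivative is an ordinary derivative at 0,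
    so the one-variable chain rule applies to [h] and this restriction. *)
Lemma has_derive_chain (h : R -> R) f x v a b :
  has_derive x v f a -> has_derive (f x) 1 h b ->
  has_derive x v (fun t => h (f t)) (b * a).
Proof.
move=> [fd fa] [hd hb].
have fl : has_derive (0 : R) 1 (fun s => f (s *: v + x)) a.
  have fd1 := (derivable1P f x v).1 fd; split => //.
  rewrite -fa /derive; apply: (congr1 (fun u : R -> R => lim (u @ 0^'))); apply/funext => s /=.
  by rewrite scale0r add0r addr0 [_%:A]mulr1.
have hf : has_derive (f (0 *: v + x)) 1 h b by rewrite scale0r add0r.
have [cd ca] := @is_derive1_comp _ h (fun s => f (s *: v + x)) 0 b a hf fl.
split; first by apply/(derivable1P (fun t => h (f t)) x v); exact: cd.
rewrite -ca /derive; apply: (congr1 (fun u : R -> R => lim (u @ 0^'))); apply/funext => s /=.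
by rewrite scale0r add0r addr0 [_%:A]mulr1.
Qed.

Lemma has_derive_near f g x v a : (\forall t \near x, f t = g t) ->
  has_derive x v f a -> has_derive x v g a.
Proof. exact: near_eq_is_derive. Qed.

End PointwiseDerivatives.

Section RealVariable.
Context {R : realType}.
Implicit Types (f g : R -> R) (x a b : R).

Lemma has_derive_ident x : has_derive x 1 (fun t : R => t) 1.
Proof. exact: is_derive_id. Qed.

Lemma has_derive_linear (k x : R) : has_derive x 1 (fun t : R => k * t) k.
Proof.
apply: has_derive_val.
  exact: (has_derive_mul (has_derive_const k x 1) (has_derive_ident x)).
by rewrite mul0r add0r mulr1.
Qed.

Lemma has_derive_pow (n : nat) x :
  has_derive x 1 (fun t => t ^+ n) (n%:R * x ^+ n.-1).
Proof.
have -> : (fun t : R => t ^+ n) = (@GRing.exp R ^~ n) by [].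
apply: DeriveDef; first exact: exprn_derivable.
by rewrite exp_derive /GRing.scale /= mulr1.
Qed.

Lemma has_derive_cont f x a : has_derive x 1 f a -> {for x, continuous f}.
Proof. by case=> fd _; apply: differentiable_continuous; apply/derivable1_diffP. Qed.

Lemma in_oo_near (a b x : R) : a < x < b -> \forall t \near x, a < t < b.
Proof.
move=> /andP[ax xb]; near=> t; apply/andP; split; near: t.
- exact: lt_nbhsr.
- exact: lt_nbhsl.
Unshelve. all: by end_near. Qed.

Lemma derive_cc_cont f (df : R -> R) a b :
  (forall x, a <= x <= b -> has_derive x 1 f (df x)) ->
  {within `[a, b], continuous f}.
Proof.
move=> fd; apply: derivable_within_continuous => x; rewrite in_itv /= => xab.
by have [] := fd x xab.
Qed.

Lemma derive_le0_nincr f (df : R -> R) a b : a <= b ->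
  (forall x, a <= x <= b -> has_derive x 1 f (df x)) ->
  (forall x, a <= x <= b -> df x <= 0) -> f b <= f a.
Proof.
move=> ab fd df0; have fc := derive_cc_cont fd.
have oo_cc x : x \in `]a, b[ -> a <= x <= b.
  by rewrite in_itv /= => /andP[ax xb]; rewrite !ltW.
have h := @ler0_derive1_le_cc _ f a b _ _ fc.
apply: h => [x /oo_cc/fd[]//|x /oo_cc xab|||//]; rewrite ?in_itv /= ?ab ?lexx //.
by have [_ fx] := fd x xab; rewrite derive1E fx df0.
Qed.

Lemma derive_eq0_cst f a b : a <= b ->
  (forall x, a <= x <= b -> has_derive x 1 f 0) -> f b = f a.
Proof.
move=> ab fd; apply/eqP; rewrite eq_le; apply/andP; split.
  exact: (derive_le0_nincr ab fd).
rewrite -lerN2; apply: (@derive_le0_nincr (fun x => - f x) (fun=> 0)) => // x xab.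
by rewrite -oppr0; apply: has_derive_opp; exact: fd.
Qed.

Lemma at_right0P f : f x @[x --> 0^'+] --> 0 <->
  forall e, 0 < e -> exists2 d, 0 < d & forall x, 0 < x < d -> `|f x| < e.
Proof.
split=> [f0 e e0|H].
  have : \forall x \near 0^'+, `|f x| < e.
    by have /cvgr0Pnorm_lt/(_ _ e0) := f0.
  move=> -[d /= d0 H]; exists d => // x /andP[x0 xd]; apply: H => //.
  by rewrite /ball_ /= sub0r normrN gtr0_norm.
apply/cvgr0Pnorm_lt => e /H[d d0 Hd]; exists d => //= x.
rewrite /ball_ /= sub0r normrN => xd x0; apply: Hd.
by rewrite x0 (le_lt_trans (ler_norm _)).
Qed.

(** Replaces an initial condition at the excluded endpoint: if f x were positive, the limit would
    give some y <= x near 0 with f y < f x, against monotonicity on [y, x]. *)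
Lemma derive_le0_lim0 rho f (df : R -> R) :
  (forall x, 0 < x < rho -> has_derive x 1 f (df x)) ->
  (forall x, 0 < x < rho -> df x <= 0) ->
  f x @[x --> 0^'+] --> 0 -> forall x, 0 < x < rho -> f x <= 0.
Proof.
move=> fd df0 /at_right0P f0 x /andP[x0 xr]; rewrite leNgt; apply/negP => fx.
have [d d0 fd0] := f0 _ fx.
pose y := Num.min (d / 2) x.
have y0 : 0 < y by rewrite /y lt_min x0 divr_gt0.
have yx : y <= x by rewrite /y ge_min lexx orbT.
have yd : y < d by rewrite /y gt_min; apply/orP; left; lra.
have sub z : y <= z <= x -> 0 < z < rho.
  by move=> /andP[yz zx]; rewrite (lt_le_trans y0 yz) (le_lt_trans zx xr).
have := @derive_le0_nincr f df y x yx (fun z h => fd z (sub z h))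
  (fun z h => df0 z (sub z h)).
have := fd0 y; rewrite y0 yd => /(_ isT) fyx fxy.
have := le_lt_trans (ler_norm _) fyx; lra.
Qed.

Lemma gronwall_lim0 rho (E dE : R -> R) (C : R) :
  (forall x, 0 < x < rho -> has_derive x 1 E (dE x)) ->
  (forall x, 0 < x < rho -> 0 <= E x) ->
  (forall x, 0 < x < rho -> dE x <= C * E x) ->
  E x @[x --> 0^'+] --> 0 -> forall x, 0 < x < rho -> E x = 0.
Proof.
move=> Ed E0 dEC El x xr; apply/eqP; rewrite eq_le (E0 x xr) andbT.
have ed (y : R) : has_derive y 1 (fun t => expR (- (C * t))) (expR (- (C * y)) * - C).
  apply: (@has_derive_chain _ _ expR (fun t => - (C * t))).
    exact: has_derive_opp (has_derive_linear C y).
  apply: is_derive_expR.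
have := @derive_le0_lim0 rho (fun t => E t * expR (- (C * t)))
  (fun t => dE t * expR (- (C * t)) + E t * (expR (- (C * t)) * - C)).
move=> /(_ (fun y h => has_derive_mul (Ed y h) (ed y))) H.
have : E x * expR (- (C * x)) <= 0.
  apply: H => // [y yr|].
    have := dEC y yr; have := expR_gt0 (- (C * y)); nra.
  rewrite -[X in _ --> X](mul0r (expR (- (C * 0)))); apply: cvgM => //.
  by have /cvg_at_right_filter := has_derive_cont (ed 0).
by rewrite pmulr_lle0 // expR_gt0.
Qed.

(** The zero may lie anywhere in [a, b], so it is propagated both ways: the factor [expR (- C * t)]
    serves to the right of [r0] and [expR (C * t)] to its left. This is why the bound on [dE] is
    two-sided. *)
Lemma gronwall_point a b r0 (E dE : R -> R) (C : R) :
  (forall x, a <= x <= b -> has_derive x 1 E (dE x)) ->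
  (forall x, a <= x <= b -> 0 <= E x) ->
  (forall x, a <= x <= b -> `|dE x| <= C * E x) ->
  a <= r0 <= b -> E r0 = 0 -> forall x, a <= x <= b -> E x = 0.
Proof.
move=> Ed E0 dEC /andP[ar rb] Er x /andP[ax xb]; apply/eqP.
rewrite eq_le E0 ?ax ?xb // andbT.
have ed (k y : R) : has_derive y 1 (fun t => expR (k * t)) (expR (k * y) * k).
  apply: (@has_derive_chain _ _ expR (fun t => k * t)); last apply: is_derive_expR.
  exact: has_derive_linear.
have key (k : R) y : a <= y <= b ->
    has_derive y 1 (fun t => E t * expR (k * t))
       (dE y * expR (k * y) + E y * (expR (k * y) * k)).
  by move=> yab; apply: has_derive_mul; [exact: Ed|exact: ed].
have bd y : a <= y <= b -> dE y <= C * E y /\ - (C * E y) <= dE y.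
  by move=> yab; have := dEC y yab; rewrite ler_norml => /andP[].
have [rx|xr] := leP r0 x.
  have := @derive_le0_nincr (fun t => E t * expR (- C * t))
    (fun y => dE y * expR (- C * y) + E y * (expR (- C * y) * - C)) r0 x rx.
  rewrite Er mul0r pmulr_lle0 ?expR_gt0 //; apply => y /andP[ry yx].
    by apply: key; rewrite (le_trans ar ry) (le_trans yx xb).
  have [] := bd y; first by rewrite (le_trans ar ry) (le_trans yx xb).
  have := expR_gt0 (- C * y); nra.
have := @derive_le0_nincr (fun t => - (E t * expR (C * t)))
  (fun y => - (dE y * expR (C * y) + E y * (expR (C * y) * C))) x r0 (ltW xr).
rewrite Er mul0r oppr0 oppr_ge0 pmulr_lle0 ?expR_gt0 //; apply => y /andP[ry yx].
  by apply: has_derive_opp; apply: key; rewrite (le_trans ax ry) (le_trans yx rb).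
have [] := bd y; first by rewrite (le_trans ax ry) (le_trans yx rb).
have := expR_gt0 (C * y); nra.
Qed.

End RealVariable.

(** Componentwise, in agreement with [cderive] and [cpartial], so that complex rules of calculus
    reduce to the real ones. *)
Definition has_cderive {R : realType} {V : normedModType R} (x v : V)
    (F : V -> R[i]) (a : R[i]) : Prop :=
  has_derive x v (fun t => Re (F t)) (Re a) /\
  has_derive x v (fun t => Im (F t)) (Im a).

Section ComplexValuedDerivative.
Context {R : realType} {V : normedModType R}.
Implicit Types (F G : V -> R[i]) (x v : V) (a b : R[i]).

Lemma has_cderive_eq F x v a b : has_cderive x v F a -> a = b -> has_cderive x v F b.
Proof. by move=> + <-. Qed.

Lemma has_cderive_near F G x v a : (\forall t \near x, F t = G t) ->
  has_cderive x v F a -> has_cderive x v G a.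
Proof.
by move=> FG [Fr Fi]; split;
  [move: Fr|move: Fi]; apply: has_derive_near; apply: filterS FG => t ->.
Qed.

Lemma has_cderive_add F G x v a b : has_cderive x v F a -> has_cderive x v G b ->
  has_cderive x v (fun t => F t + G t) (a + b).
Proof.
move=> [Fr Fi] [Gr Gi]; split; rewrite raddfD.
- by under eq_fun do rewrite raddfD; exact: has_derive_add.
- by under eq_fun do rewrite raddfD; exact: has_derive_add.
Qed.

Lemma has_cderive_opp F x v a : has_cderive x v F a ->
  has_cderive x v (fun t => - F t) (- a).
Proof.
move=> [Fr Fi]; split; rewrite raddfN /=.
- by under eq_fun do rewrite raddfN; exact: has_derive_opp.
- by under eq_fun do rewrite raddfN; exact: has_derive_opp.
Qed.

Lemma has_cderive_sub F G x v a b : has_cderive x v F a -> has_cderive x v G b ->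
  has_cderive x v (fun t => F t - G t) (a - b).
Proof. by move=> Fa Gb; apply: has_cderive_add => //; exact: has_cderive_opp. Qed.

Lemma Re_add (a b : R[i]) : Re (a + b) = Re a + Re b.
Proof. by case: a b => [? ?] [? ?]. Qed.

Lemma Im_add (a b : R[i]) : Im (a + b) = Im a + Im b.
Proof. by case: a b => [? ?] [? ?]. Qed.

Lemma Re_mul (a b : R[i]) : Re (a * b) = Re a * Re b - Im a * Im b.
Proof. by case: a b => [? ?] [? ?]. Qed.

Lemma Im_mul (a b : R[i]) : Im (a * b) = Re a * Im b + Im a * Re b.
Proof. by case: a b => [? ?] [? ?]. Qed.

Lemma Re_opp (a : R[i]) : Re (- a) = - Re a.
Proof. by case: a. Qed.

Lemma Im_opp (a : R[i]) : Im (- a) = - Im a.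
Proof. by case: a. Qed.

Definition ReImE := (Re_add, Im_add, Re_mul, Im_mul, Re_opp, Im_opp).

Lemma has_cderive_mul F G x v a b : has_cderive x v F a -> has_cderive x v G b ->
  has_cderive x v (fun t => F t * G t) (a * G x + F x * b).
Proof.
move=> [Fr Fi] [Gr Gi]; split.
- have -> : (fun t => Re (F t * G t)) =
    (fun t => Re (F t) * Re (G t) - Im (F t) * Im (G t)).
    by apply/funext => t; rewrite Re_mul.
  apply: has_derive_val.
    by apply: has_derive_sub; apply: has_derive_mul; eassumption.
  by rewrite Re_add !Re_mul; ring.
- have -> : (fun t => Im (F t * G t)) =
    (fun t => Re (F t) * Im (G t) + Im (F t) * Re (G t)).
    by apply/funext => t; rewrite Im_mul.
  apply: has_derive_val.
    by apply: has_derive_add; apply: has_derive_mul; eassumption.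
  by rewrite Im_add !Im_mul; ring.
Qed.

Lemma has_cderive_const (c : R[i]) x v : has_cderive x v (fun=> c) 0.
Proof. by split; exact: has_derive_const. Qed.

Lemma has_cderive_real (f : V -> R) x v (l : R) : has_derive x v f l ->
  has_cderive x v (fun t => (f t)%:C) l%:C.
Proof. by move=> fl; split; [exact: fl|exact: has_derive_const]. Qed.

Lemma invcE (a : R[i]) :
  a^-1 = (Re a / (Re a ^+ 2 + Im a ^+ 2)) +i* (- Im a / (Re a ^+ 2 + Im a ^+ 2)).
Proof. by case: a => p q /=; rewrite mulNr. Qed.

Lemma sqr_normc_gt0 (a : R[i]) : a != 0 -> 0 < Re a ^+ 2 + Im a ^+ 2.
Proof.
move=> a0; rewrite lt_def addr_ge0 ?sqr_ge0 // andbT paddr_eq0 ?sqr_ge0 //.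
rewrite !sqrf_eq0; apply: contra a0.
by case: a => p q /= /andP[/eqP-> /eqP->].
Qed.

Lemma has_derive_inv (h : V -> R) x v (l : R) : h x != 0 -> has_derive x v h l ->
  has_derive x v (fun t => (h t)^-1) (- (h x) ^- 2 * l).
Proof.
move=> h0 hl; apply: (@has_derive_chain _ _ (fun t => t^-1) h) => //.
apply: has_derive_val; first exact: (@is_deriveV _ id (h x) 1 1).
by rewrite /GRing.scale /= mulr1.
Qed.

Lemma has_cderive_inv F x v a : F x != 0 -> has_cderive x v F a ->
  has_cderive x v (fun t => (F t)^-1) (- a / F x ^+ 2).
Proof.
move=> F0 [Fr Fi]; have n0 := sqr_normc_gt0 F0.
pose N t := Re (F t) * Re (F t) + Im (F t) * Im (F t).
have N0 : N x != 0 by rewrite /N -!expr2 gt_eqF.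
have Nd : has_derive x v N (Re a * Re (F x) + Re (F x) * Re a +
                           (Im a * Im (F x) + Im (F x) * Im a)).
  by apply: has_derive_add; exact: has_derive_mul.
have Nid := has_derive_inv N0 Nd.
have NE t : Re (F t) ^+ 2 + Im (F t) ^+ 2 = N t by rewrite !expr2.
(* Over the real denominator [N x ^+ 2] both components of the quotient rule become identities
   between real fractions. *)
have E : - a / F x ^+ 2 =
  ((- (Re a * (Re (F x) ^+ 2 - Im (F x) ^+ 2) + Im a * (2 * Re (F x) * Im (F x))))
    / N x ^+ 2) +i*
  ((- (Im a * (Re (F x) ^+ 2 - Im (F x) ^+ 2) - Re a * (2 * Re (F x) * Im (F x))))
    / N x ^+ 2).
  apply: (mulIf (x := F x ^+ 2)); first by rewrite expf_neq0.
  rewrite mulfVK ?expf_neq0 //.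
  move: N0; rewrite /N; case: (F x) => p q; case: a {Fr Fi Nd Nid} => s t /= N0.
  by rewrite expr2; apply/eqP; rewrite eq_complex /=; apply/andP; split; apply/eqP;
    field.
rewrite E; split.
- under eq_fun do rewrite invcE NE /=; apply: has_derive_val.
    exact: has_derive_mul Fr Nid.
  by move: N0; rewrite /= /N => N0; field.
- under eq_fun do rewrite invcE NE /=; apply: has_derive_val.
    exact: has_derive_mul (has_derive_opp Fi) Nid.
  by move: N0; rewrite /= /N => N0; field.
Qed.

Lemma has_cderive_chain (H : R -> R[i]) (f : V -> R) x v (l : R) (b : R[i]) :
  has_derive x v f l -> has_cderive (f x) 1 H b ->
  has_cderive x v (fun t => H (f t)) (b * l%:C).
Proof.
move=> fl [Hr Hi]; split.
- apply: has_derive_val; first exact: (has_derive_chain fl Hr).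
  by rewrite Re_mul /= mulr0 subr0.
- apply: has_derive_val; first exact: (has_derive_chain fl Hi).
  by rewrite Im_mul /= mulr0 add0r.
Qed.

End ComplexValuedDerivative.

Section NormcBounds.
Context {R : realType}.
Implicit Types (z w : R[i]).

Lemma normc_sqrt z : normc z = Num.sqrt (Re z ^+ 2 + Im z ^+ 2).
Proof. by case: z. Qed.

Lemma normc_ge0 z : 0 <= normc z.
Proof. by rewrite normc_sqrt sqrtr_ge0. Qed.

Lemma normc_sqr z : normc z ^+ 2 = Re z ^+ 2 + Im z ^+ 2.
Proof. by rewrite normc_sqrt sqr_sqrtr // addr_ge0 ?sqr_ge0. Qed.

Lemma ler_Re_normc z : `|Re z| <= normc z.
Proof. by rewrite normc_sqrt -sqrtr_sqr ler_wsqrtr // lerDl sqr_ge0. Qed.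

Lemma ler_Im_normc z : `|Im z| <= normc z.
Proof. by rewrite normc_sqrt -sqrtr_sqr ler_wsqrtr // lerDr sqr_ge0. Qed.

Lemma ler_normc_ReIm z : normc z <= `|Re z| + `|Im z|.
Proof.
rewrite -(@ler_pXn2r _ 2) ?nnegrE ?addr_ge0 ?normc_ge0 // normc_sqr.
rewrite -[Re z ^+ 2]real_normK ?num_real // -[Im z ^+ 2]real_normK ?num_real //.
rewrite sqrrD lerD2r lerDl; apply: mulrn_wge0; exact: mulr_ge0.
Qed.

Lemma ler_normcD z w : normc (z + w) <= normc z + normc w.
Proof. exact: le_normcD. Qed.

Lemma normcR (r : R) : normc r%:C = `|r|.
Proof. by rewrite normc_sqrt /= expr0n /= addr0 sqrtr_sqr. Qed.

Lemma normcN z : normc (- z) = normc z.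
Proof. by rewrite !normc_sqrt !raddfN /= !sqrrN. Qed.

Lemma normc_eq0 z : (normc z == 0) = (z == 0).
Proof.
apply/eqP/eqP => [/Normc.eq0_normc //|->].
by rewrite normc_sqrt /= expr0n /= addr0 sqrtr0.
Qed.

End NormcBounds.

Section LimitZero.
Context {R : realType}.
Implicit Types (F G : R -> R[i]) (f g : R -> R).

(** Complex limits at the singular endpoint are stated through the modulus, the form that they have
    in [regular_solution]. *)
Definition lim0 F := normc (F r) @[r --> 0^'+] --> (0 : R).

Lemma squeeze_right0 f g (d : R) : 0 < d ->
  (forall r : R, 0 < r < d -> `|f r| <= g r) ->
  g r @[r --> 0^'+] --> 0 -> f r @[r --> 0^'+] --> 0.
Proof.
move=> d0 fg /at_right0P g0; apply/at_right0P => e /g0[d' d'0 H].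
exists (Num.min d d') => [|r /andP[r0]]; first by rewrite lt_min d0.
rewrite lt_min => /andP[rd rd']; apply: le_lt_trans (fg r _) _; first by rewrite r0.
by apply: le_lt_trans (ler_norm _) _; apply: H; rewrite r0.
Qed.

Lemma lim0_Re F : lim0 F -> Re (F r) @[r --> 0^'+] --> 0.
Proof. by apply: (squeeze_right0 ltr01) => r _; exact: ler_Re_normc. Qed.

Lemma lim0_Im F : lim0 F -> Im (F r) @[r --> 0^'+] --> 0.
Proof. by apply: (squeeze_right0 ltr01) => r _; exact: ler_Im_normc. Qed.

Lemma lim0_add F G : lim0 F -> lim0 G -> lim0 (fun r => F r + G r).
Proof.
move=> F0 G0; apply: (@squeeze_right0 _ (fun r => normc (F r) + normc (G r)) _ ltr01).
  by move=> r _; rewrite ger0_norm ?normc_ge0 ?ler_normcD.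
by rewrite -[X in _ --> X](addr0 0); exact: cvgD.
Qed.

Lemma lim0_bound F G (d C : R) : 0 < d ->
  (forall r : R, 0 < r < d -> normc (F r) <= C * normc (G r)) -> lim0 G -> lim0 F.
Proof.
move=> d0 FG G0; apply: (@squeeze_right0 _ (fun r => C * normc (G r)) _ d0).
  by move=> r rd; rewrite ger0_norm ?normc_ge0 ?FG.
by rewrite -[X in _ --> X](mulr0 C); exact: cvgMr.
Qed.

Lemma lim0_opp F : lim0 F -> lim0 (fun r => - F r).
Proof.
by apply: (@lim0_bound _ _ 1 1) => // r _; rewrite mul1r normcN.
Qed.

Lemma cvg_right0_id : (r : R) @[r --> 0^'+] --> (0 : R).
Proof. by apply: cvg_at_right_filter; exact: cvg_id. Qed.

Lemma lim0_Or F (d C : R) : 0 < d ->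
  (forall r : R, 0 < r < d -> normc (F r) <= C * r) -> lim0 F.
Proof.
move=> d0 FC; apply: (@squeeze_right0 _ (fun r => C * r) _ d0).
  by move=> r rd; rewrite ger0_norm ?normc_ge0 ?FC.
by rewrite -[X in _ --> X](mulr0 C); apply: cvgMr; exact: cvg_right0_id.
Qed.

End LimitZero.

(** * Uniqueness for the singular radial equation and for the first-order system *)

Section SecondOrderUniqueness.
Context {R : realType}.

(** For s = 1 and s = -1 the function s f - c t^(k+1) is nonincreasing with limit 0 at 0. The gain
    1/(k+1) of integration is at most 1 and is given away. *)
Lemma integrate_power_bound (f df : R -> R) (d c : R) (k : nat) : 0 <= c ->
  (forall r : R, 0 < r < d -> has_derive r 1 f (df r)) ->
  (forall r : R, 0 < r < d -> `|df r| <= c * r ^+ k) ->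
  f r @[r --> 0^'+] --> 0 -> forall r, 0 < r < d -> `|f r| <= c * r ^+ k.+1.
Proof.
move=> c0 fd dfc f0 r rd.
have pl : c * r ^+ k.+1 @[r --> 0^'+] --> 0.
  rewrite -[X in _ --> X](mulr0 c); apply: cvgMr.
  have /cvg_at_right_filter := has_derive_cont (has_derive_pow k.+1 (0 : R)).
  by rewrite expr0n.
have pd (x : R) : has_derive x 1 (fun t => c * t ^+ k.+1) (c * (k.+1%:R * x ^+ k)).
  apply: has_derive_val.
    exact: (has_derive_mul (has_derive_const c x 1) (has_derive_pow k.+1 x)).
  by rewrite mul0r add0r.
have main (s : R) : `|s| = 1 -> s * f r <= c * r ^+ k.+1.
  move=> s1; rewrite -subr_le0.
  apply: (@derive_le0_lim0 _ d (fun t => s * f t - c * t ^+ k.+1)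
    (fun t => (0 * f t + s * df t) - c * (k.+1%:R * t ^+ k))) => //.
  - move=> x xd; apply: has_derive_sub => //.
    by apply: has_derive_mul; [exact: has_derive_const|exact: fd].
  - move=> x xd; rewrite mul0r add0r subr_le0.
    apply: le_trans (ler_norm _) _; rewrite normrM s1 mul1r.
    apply: le_trans (dfc x xd) _; rewrite mulrA ler_wpM2r //.
      by apply: exprn_ge0; move/andP: xd => [/ltW].
    by rewrite ler_peMr // ler1n.
  - rewrite -[X in _ --> X](subr0 0); apply: cvgB => //.
    by rewrite -[X in _ --> X](mulr0 s); exact: cvgMr.
rewrite ler_norml lerNl; apply/andP; split.
  by rewrite -mulN1r main // normrN1.
by rewrite -[f r]mul1r main // normr1.
Qed.

(** Multiplied by r^(2n), the equation reads (r^k D')' = r^k q D with k = 2n + 1. As D is bounded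
    near 0, integration gives D' = O(r), so D and D' both tend to 0. The energy |D|^2 + |D'|^2 then
    vanishes by [gronwall_lim0], the singular term contributing -2(k/r)|D'|^2. *)
Lemma ode_unique (n : nat) (rho M : R) (q D D1 D2 : R -> R[i]) :
  0 < rho ->
  (forall r : R, 0 < r < rho -> normc (q r) <= M) ->
  (forall r : R, 0 < r < rho -> has_cderive r 1 D (D1 r)) ->
  (forall r : R, 0 < r < rho -> has_cderive r 1 D1 (D2 r)) ->
  (forall r : R, 0 < r < rho ->
     r%:C * (D2 r - q r * D r) + (2 * n + 1)%:R%:C * D1 r = 0) ->
  lim0 D -> lim0 (fun r => (r ^+ (2 * n + 1))%:C * D1 r) ->
  forall r : R, 0 < r < rho -> D r = 0.
Proof.
move=> rho0 qM Dd D1d ode D0 P0.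
set k := (2 * n + 1)%N in ode P0.
have M0 : 0 <= M.
  by apply: le_trans (qM (rho / 2) _); [exact: normc_ge0|apply/andP; split; lra].
have D2E r : 0 < r < rho -> D2 r = q r * D r - (k%:R / r)%:C * D1 r.
  move=> rr; have r0 : r%:C != 0 :> R[i].
    by move/andP: rr => [r0 _]; rewrite (inj_eq (@complexI R)) gt_eqF.
  apply: (mulfI r0); move/eqP: (ode r rr); rewrite mulrBr addrAC subr_eq0 => /eqP.
  rewrite mulrBr => /(canRL (addrK _)) ->; congr (_ - _).
  by rewrite rmorphM /= fmorphV /=; field.
have PD (r : R) : 0 < r < rho -> has_cderive r 1 (fun t => (t ^+ k)%:C * D1 t)
    ((r ^+ k)%:C * (q r * D r)).
  move=> rr; apply: has_cderive_eq.
    by apply: has_cderive_mul; [exact: (has_cderive_real (has_derive_pow k r))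
      |exact: D1d].
  rewrite D2E //; have r0 : r != 0 by move/andP: rr => [r0 _]; rewrite gt_eqF.
  have -> : (k%:R * r ^+ k.-1)%:C = (r ^+ k)%:C * (k%:R / r)%:C :> R[i].
    rewrite -rmorphM /=; congr (_%:C); rewrite /k addn1 /= exprS; field.
    by rewrite r0.
  by ring.
have /at_right0P/(_ _ ltr01)[d d0 Dd1] := D0.
pose d' := Num.min d rho.
have d'0 : 0 < d' by rewrite lt_min d0.
have d'P r : 0 < r < d' -> 0 < r < rho /\ normc (D r) <= 1.
  move=> /andP[r0]; rewrite lt_min => /andP[rd rr]; split; first by rewrite r0.
  by have := Dd1 r; rewrite r0 rd => /(_ isT); rewrite ger0_norm ?normc_ge0 // => /ltW.
have bnd r : 0 < r < d' -> normc ((r ^+ k)%:C * (q r * D r)) <= M * r ^+ k.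
  move=> /[dup] rd' /d'P[rr D1']; rewrite !Normc.normcM normcR.
  have rk : 0 <= r ^+ k by apply: exprn_ge0; move/andP: rr => [/ltW].
  rewrite ger0_norm // mulrC ler_wpM2r // -[leRHS]mulr1.
  by apply: ler_pM => //; rewrite ?normc_ge0 ?qM.
(* The real and imaginary parts of r^k D' are each at most M r^(k+1), whence the factor 2; division
   by r^k leaves O(r). *)
have D1b r : 0 < r < d' -> normc (D1 r) <= 2 * M * r.
  move=> rd'; have [rr _] := d'P r rd'; have r0 : 0 < r by move/andP: rr => [].
  have A := @integrate_power_bound _ _ d' M k M0
    (fun x h => (PD x (d'P x h).1).1)
    (fun x h => le_trans (ler_Re_normc _) (bnd x h)) (lim0_Re P0) r rd'.
  have B := @integrate_power_bound _ _ d' M k M0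
    (fun x h => (PD x (d'P x h).1).2)
    (fun x h => le_trans (ler_Im_normc _) (bnd x h)) (lim0_Im P0) r rd'.
  have := le_trans (ler_normc_ReIm _) (lerD A B).
  rewrite Normc.normcM normcR ger0_norm ?exprn_ge0 ?(ltW r0) //.
  rewrite (_ : _ + _ = r ^+ k * (2 * M * r)); last by rewrite exprS; ring.
  by rewrite ler_pM2l // exprn_gt0.
have D10 : lim0 D1 := lim0_Or d'0 D1b.
pose E r := (Re (D r) * Re (D r) + Im (D r) * Im (D r)) +
            (Re (D1 r) * Re (D1 r) + Im (D1 r) * Im (D1 r)).
suff H : forall r, 0 < r < rho -> E r = 0.
  move=> r rr; apply/eqP; have /eqP := H r rr.
  rewrite /E -!expr2 paddr_eq0 ?addr_ge0 ?sqr_ge0 // => /andP[+ _].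
  rewrite paddr_eq0 ?sqr_ge0 // !sqrf_eq0.
  by case: (D r) => p s /= /andP[/eqP-> /eqP->].
apply: (@gronwall_lim0 _ rho E (fun r =>
   (Re (D1 r) * Re (D r) + Re (D r) * Re (D1 r) +
   (Im (D1 r) * Im (D r) + Im (D r) * Im (D1 r))) +
   (Re (D2 r) * Re (D1 r) + Re (D1 r) * Re (D2 r) +
   (Im (D2 r) * Im (D1 r) + Im (D1 r) * Im (D2 r)))) (1 + 2 * M)).
- move=> r rr; have [A1 A2] := Dd r rr; have [A3 A4] := D1d r rr.
  by do !apply: has_derive_add; exact: has_derive_mul.
- by move=> r rr; rewrite /E -!expr2 !addr_ge0 ?sqr_ge0.
- move=> r rr; rewrite D2E // /E; have := qM r rr => qr.
  have q1 := le_trans (ler_Re_normc (q r)) qr.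
  have q2 := le_trans (ler_Im_normc (q r)) qr.
  (* Only the sign of the singular coefficient is used: it is unbounded near 0 but enters the
     derivative of the energy with a minus sign. *)
  have kr : 0 <= k%:R / r by rewrite divr_ge0 //; move/andP: rr => [/ltW].
  rewrite Re_add Im_add !raddfN /= !Re_mul !Im_mul /= !mul0r subr0 addr0.
  move: kr; set nu := k%:R / r => kr.
  move: (q r) (D r) (D1 r) q1 q2 => [a b] [x y] [s t] /=.
  rewrite !ler_norml => /andP[a1 a2] /andP[b1 b2].
  have aux (c u v : R) : - M <= c -> c <= M -> c * (u * v) <= M * (u ^+ 2 + v ^+ 2) / 2.
    move=> c1 c2; have := mulr_ge0 (_ : 0 <= M - c) (sqr_ge0 (u + v)).
    have := mulr_ge0 (_ : 0 <= M + c) (sqr_ge0 (u - v)).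
    by move=> /(_ ltac:(lra)) + /(_ ltac:(lra)); rewrite !expr2; lra.
  have := aux a x s a1 a2; have := aux a y t a1 a2.
  have := aux b x t b1 b2; have := aux (- b) y s ltac:(lra) ltac:(lra).
  have := mulr_ge0 kr (sqr_ge0 s); have := mulr_ge0 kr (sqr_ge0 t).
  have := sqr_ge0 (x - s); have := sqr_ge0 (y - t); rewrite !expr2; lra.
- have sq (f : R -> R) : f r @[r --> 0^'+] --> 0 -> f r * f r @[r --> 0^'+] --> 0.
    by move=> f0; rewrite -[X in _ --> X](mulr0 0); exact: cvgM.
  rewrite /E -[X in _ --> X](addr0 0); apply: cvgD; rewrite -[X in _ --> X](addr0 0);
    apply: cvgD; apply: sq; [exact: lim0_Re|exact: lim0_Im|exact: lim0_Re|exact: lim0_Im].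
Qed.

(** On [a, b] with a > 0 the coefficient nu/r is bounded by |nu|/a, so |u|^2 + |v|^2 obeys a
    two-sided Gronwall bound and a common zero spreads over the interval. *)
Lemma system_unique (nu : R) (a b r0 M : R) (g u v u1 v1 : R -> R[i]) :
  0 < a ->
  (forall r : R, a <= r <= b -> normc (g r) <= M) ->
  (forall r : R, a <= r <= b -> has_cderive r 1 u (u1 r)) ->
  (forall r : R, a <= r <= b -> has_cderive r 1 v (v1 r)) ->
  (forall r : R, a <= r <= b -> r%:C * u1 r = r%:C * g r * u r + nu%:C * v r) ->
  (forall r : R, a <= r <= b -> r%:C * v1 r = - (r%:C * g r * v r) + nu%:C * u r) ->
  a <= r0 <= b -> u r0 = 0 -> v r0 = 0 ->
  forall r : R, a <= r <= b -> u r = 0 /\ v r = 0.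
Proof.
move=> a0 gM ud vd uE vE r0ab u0 v0.
have rr r : a <= r <= b -> r%:C != 0 :> R[i].
  by move=> /andP[ar _]; rewrite (inj_eq (@complexI R)) gt_eqF ?(lt_le_trans a0).
have u1E r : a <= r <= b -> u1 r = g r * u r + (nu / r)%:C * v r.
  move=> rab; have rn0 := rr r rab; apply: (mulfI rn0); rewrite uE //.
  by rewrite rmorphM /= fmorphV /=; field.
have v1E r : a <= r <= b -> v1 r = - (g r * v r) + (nu / r)%:C * u r.
  move=> rab; have rn0 := rr r rab; apply: (mulfI rn0); rewrite vE //.
  by rewrite rmorphM /= fmorphV /=; field.
pose E r := (Re (u r) * Re (u r) + Im (u r) * Im (u r)) +
            (Re (v r) * Re (v r) + Im (v r) * Im (v r)).
suff H : forall r, a <= r <= b -> E r = 0.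
  move=> r rab; have /eqP := H r rab.
  rewrite /E -!expr2 paddr_eq0 ?addr_ge0 ?sqr_ge0 //.
  rewrite !paddr_eq0 ?sqr_ge0 // !sqrf_eq0.
  case: (u r) (v r) => p s [p' s'] /= /andP[/andP[/eqP-> /eqP->] /andP[/eqP-> /eqP->]].
  by [].
apply: (@gronwall_point _ a b r0 E (fun r =>
   (Re (u1 r) * Re (u r) + Re (u r) * Re (u1 r) +
   (Im (u1 r) * Im (u r) + Im (u r) * Im (u1 r))) +
   (Re (v1 r) * Re (v r) + Re (v r) * Re (v1 r) +
   (Im (v1 r) * Im (v r) + Im (v r) * Im (v1 r)))) (2 * M + 2 * (`|nu| / a))) => //.
- move=> r rab; have [A1 A2] := ud r rab; have [A3 A4] := vd r rab.
  by do !apply: has_derive_add; exact: has_derive_mul.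
- by move=> r rab; rewrite /E -!expr2 !addr_ge0 ?sqr_ge0.
- move=> r rab; rewrite u1E // v1E // /E; have gr := gM r rab.
  have g1 := le_trans (ler_Re_normc (g r)) gr.
  have nur : `|nu / r| <= `|nu| / a.
    move/andP: rab => [ar _]; have rp := lt_le_trans a0 ar.
    rewrite normrM ler_wpM2l // normfV gtr0_norm // lef_pV2 ?posrE //.
  rewrite !Re_add !Im_add !raddfN /= !Re_mul !Im_mul /= !mul0r !subr0 !addr0.
  move: nur; set N := `|nu| / a; set k := nu / r => nur.
  move: (g r) (u r) (v r) g1 => [p q] [x y] [s t] /= g1.
  have aux (c m w z : R) : `|c| <= m -> `|c * (w * z)| <= m * (w * w + z * z) / 2.
    rewrite !ler_norml => /andP[c1 c2].
    have := mulr_ge0 (_ : 0 <= m - c) (sqr_ge0 (w + z)).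
    have := mulr_ge0 (_ : 0 <= m + c) (sqr_ge0 (w - z)).
    have := mulr_ge0 (_ : 0 <= m - c) (sqr_ge0 (w - z)).
    have := mulr_ge0 (_ : 0 <= m + c) (sqr_ge0 (w + z)).
    move=> /(_ ltac:(lra)) + /(_ ltac:(lra)) + /(_ ltac:(lra)) + /(_ ltac:(lra)).
    by rewrite !expr2 => h1 h2 h3 h4; apply/andP; split; lra.
  have := aux p M x x g1; have := aux p M y y g1.
  have := aux p M s s g1; have := aux p M t t g1.
  have := aux k N x s nur; have := aux k N y t nur.
  rewrite !ler_norml => /andP[? ?] /andP[? ?] /andP[? ?] /andP[? ?] /andP[? ?] /andP[? ?].
  by apply/andP; split; lra.
- by rewrite /E u0 v0 /= !mul0r !addr0.
Qed.

End SecondOrderUniqueness.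

(** * Moments of the transmutation kernel *)

Section Clamping.
Context {R : realType}.

(** As [k] takes its values in [A], the composite only sees the limit of [F] along [A]. *)
Lemma continuous_comp_within {S T U : topologicalType} (A : set T) (F : T -> U)
    (k : S -> T) : {within A, continuous F} -> continuous k -> (forall x, A (k x)) ->
  continuous (fun x => F (k x)).
Proof.
move=> /subspace_continuousP FA kc kA x.
have FAx : F t @[t --> within A (nbhs (k x))] --> F (k x) := FA (k x) (kA x).
apply: (cvg_comp (G := within A (nbhs (k x))) k F) => //.
move=> B /= AB; rewrite /fmap /=.
have := kc x (fun t => A t -> B t) AB.
by rewrite /= /nbhs /=; apply: filterS => t; apply.
Qed.

Lemma continuous_pair {S T U : topologicalType} (u : S -> T) (v : S -> U) :
  continuous u -> continuous v -> continuous (fun s => (u s, v s)).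
Proof. by move=> uc vc s; apply: cvg_pair; [exact: uc|exact: vc]. Qed.

Lemma continuous_comp2 {S : topologicalType} (h : R * R -> R) (u v : S -> R) :
  continuous h -> continuous u -> continuous v -> continuous (fun s => h (u s, v s)).
Proof.
move=> hc uc vc s.
exact: (continuous_comp (@continuous_pair _ _ _ u v uc vc s) (hc (u s, v s))).
Qed.

Definition clamp (a b x : R) := Num.max a (Num.min b x).

Lemma clamp_in (a b x : R) : a <= b -> a <= clamp a b x <= b.
Proof. by move=> ab; rewrite /clamp le_max lexx ge_max ab ge_min lexx. Qed.

Lemma clamp_id (a b x : R) : a <= x <= b -> clamp a b x = x.
Proof. by move=> /andP[ax xb]; rewrite /clamp min_r // max_r. Qed.

Lemma clamp_continuous (a b : R) : continuous (clamp a b).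
Proof.
move=> x; apply: continuous_max; first exact: cvg_cst.
by apply: continuous_min; [exact: cvg_cst|exact: cvg_id].
Qed.

Definition rect (rho : R) : set (R * R) := `[0, rho] `*` `[0, 1].

Lemma rect_interior (rho r t : R) : 0 < r < rho -> 0 < t < 1 -> (rect rho)° (r, t).
Proof.
move=> rr tt; rewrite /interior /=.
exists (`]0, rho[%classic, `]0, 1[%classic) => /=.
  split; apply: open_nbhs_nbhs; split; try exact: interval_open.
  - by rewrite /= in_itv.
  - by rewrite /= in_itv.
by move=> [x y] /= []; rewrite /rect /= !in_itv /= => /andP[? ?] /andP[? ?];
  split; rewrite !ltW.
Qed.

(** [realCk] gives continuity relative to the closed rectangle only. Composition with the clamps
    yields a function continuous on the whole plane, so that later integrals and edge limits avoid
    the subspace topology. *)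
Lemma rect_extension (rho : R) (F : R * R -> R) : 0 <= rho ->
  {within rect rho, continuous F} ->
  exists2 g : R * R -> R, continuous g & forall p, rect rho p -> F p = g p.
Proof.
move=> rho0 FA; exists (fun p => F (clamp 0 rho p.1, clamp 0 1 p.2)).
  apply: (@continuous_comp_within _ _ _ _ F
    (fun p : R * R => (clamp 0 rho p.1, clamp 0 1 p.2)) FA).
    apply: continuous_pair => p.
      exact: (continuous_comp (@cvg_fst _ _ _ _ _) (@clamp_continuous 0 rho p.1)).
    exact: (continuous_comp (@cvg_snd _ _ _ _ _) (@clamp_continuous 0 1 p.2)).
  by move=> p; split => /=; rewrite in_itv /=; exact: clamp_in.
by move=> [x y] [] /=; rewrite !in_itv /= => xr yr; rewrite !clamp_id.
Qed.

Lemma continuous_compact_bounded {T : topologicalType} (A : set T) (g : T -> R) :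
  compact A -> {within A, continuous g} ->
  exists2 M : R, 0 <= M & forall p, A p -> `|g p| <= M.
Proof.
move=> Ac gc; have [[a Aa]|A0] := pselect (A !=set0); last first.
  by exists 0 => // p Ap; exfalso; apply: A0; exists p.
have gA : {within A, continuous (fun p => `|g p|)}.
  move=> p; apply: (continuous_comp (gc p)); exact: norm_continuous.
have [|c _ cM] := @compact_EVT_max T R (fun p => `|g p|) A _ Ac gA; first by exists a.
by exists `|g c| => // p pr; apply: cM; rewrite inE.
Qed.

Lemma continuous_bounded_rect (a b : R) (g : R * R -> R) : continuous g ->
  exists2 M : R, 0 <= M &
    forall r t : R, a <= r <= b -> 0 <= t <= 1 -> `|g (r, t)| <= M.
Proof.
move=> gc; have [||M M0 gM] := @continuous_compact_bounded _ (`[a, b] `*` `[0, 1] : set (R * R)) g.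
- by apply: compact_setX; exact: segment_compact.
- exact: continuous_subspaceT.
- by exists M => // r t rab t01; apply: gM; split; rewrite /= in_itv.
Qed.

End Clamping.

Section Partials.
Context {R : realType}.
Implicit Types (F : R * R -> R).

Lemma has_derive_dirx F (x y l : R) :
  has_derive (x, y) dirx F l <-> has_derive x 1 (fun t => F (t, y)) l.
Proof.
have E : (fun h : R => h^-1 *: (F (h *: dirx + (x, y)) - F (x, y))) =
         (fun h : R => h^-1 *: (F (h *: 1 + x, y) - F (x, y))).
  apply/funext => h; congr (_ *: (F _ - _)); apply/eqP; rewrite xpair_eqE /=.
  by rewrite /GRing.scale /= mulr0 add0r !eqxx.
by split=> -[d e]; split; move: d e; rewrite /derivable /derive /= E.
Qed.

Lemma has_derive_diry F (x y l : R) :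
  has_derive (x, y) diry F l <-> has_derive y 1 (fun t => F (x, t)) l.
Proof.
have E : (fun h : R => h^-1 *: (F (h *: diry + (x, y)) - F (x, y))) =
         (fun h : R => h^-1 *: (F (x, h *: 1 + y) - F (x, y))).
  apply/funext => h; congr (_ *: (F _ - _)); apply/eqP; rewrite xpair_eqE /=.
  by rewrite /GRing.scale /= mulr0 add0r !eqxx.
by split=> -[d e]; split; move: d e; rewrite /derivable /derive /= E.
Qed.

(** Trades the kernel and the three derivatives of its equation for functions continuous on the
    whole plane. They agree with [F] on the closed rectangle but with its derivatives only in the
    interior, which is what the open intervals of the later lemmas reflect. *)
Lemma kernel_regularity (rho : R) F : 0 <= rho ->
  realCk [:: dirx; diry] 2 (rect rho) F ->
  exists g0 g1 g11 g12 : R * R -> R,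
  [/\ continuous g0, continuous g1, continuous g11 & continuous g12] /\
  (forall p, rect rho p -> F p = g0 p) /\
  forall r t : R, 0 < r < rho -> 0 < t < 1 ->
  [/\ 'D_dirx F (r, t) = g1 (r, t),
      'D_dirx ('D_dirx F) (r, t) = g11 (r, t) &
      'D_diry ('D_dirx F) (r, t) = g12 (r, t)] /\
  [/\ has_derive r 1 (fun x => g0 (x, t)) (g1 (r, t)),
      has_derive r 1 (fun x => g1 (x, t)) (g11 (r, t)) &
      has_derive t 1 (fun x => g1 (r, x)) (g12 (r, t))].
Proof.
move=> rho0 [Fc [_ /= H]].
have /H[Fx [[k1 k1c k1E] H1]] : dirx \in [:: dirx; diry : R * R] by rewrite !inE eqxx.
have /H1[Fxx [[k11 k11c k11E] _]] : dirx \in [:: dirx; diry : R * R] by rewrite !inE eqxx.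
have /H1[Fxy [[k12 k12c k12E] _]] : diry \in [:: dirx; diry : R * R].
  by rewrite !inE eqxx orbT.
have [g0 g0c g0E] := rect_extension rho0 Fc.
have [g1 g1c g1E] := rect_extension rho0 k1c.
have [g11 g11c g11E] := rect_extension rho0 k11c.
have [g12 g12c g12E] := rect_extension rho0 k12c.
exists g0, g1, g11, g12; do 2!split => //.
move=> r t rr tt; have I := rect_interior rr tt.
have sub p : (rect rho)° p -> rect rho p by apply: interior_subset.
have D1 : 'D_dirx F (r, t) = g1 (r, t) by rewrite -k1E // g1E //; exact: sub.
have D11 : 'D_dirx ('D_dirx F) (r, t) = g11 (r, t).
  by rewrite -k11E // g11E //; exact: sub.
have D12 : 'D_diry ('D_dirx F) (r, t) = g12 (r, t).
  by rewrite -k12E // g12E //; exact: sub.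
have nr : \forall x \near r, (rect rho)° (x, t).
  by apply: filterS (in_oo_near rr) => x xr; exact: rect_interior.
have nt : \forall x \near t, (rect rho)° (r, x).
  by apply: filterS (in_oo_near tt) => x xr; exact: rect_interior.
split=> //; split.
- apply: (@has_derive_near _ _ (fun x => F (x, t))).
    by apply: filterS nr => x /sub/g0E.
  by apply: (has_derive_dirx F r t _).1; split; [exact: Fx|].
- apply: (@has_derive_near _ _ (fun x => 'D_dirx F (x, t))).
    by apply: filterS nr => x xi; rewrite -k1E // g1E //; exact: sub.
  by apply: (has_derive_dirx ('D_dirx F) r t _).1; split; [exact: Fxx|].
- apply: (@has_derive_near _ _ (fun x => 'D_dirx F (r, x))).
    by apply: filterS nt => x xi; rewrite -k1E // g1E //; exact: sub.
  by apply: (has_derive_diry ('D_dirx F) r t _).1; split; [exact: Fxy|].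
Qed.

End Partials.

Section KernelMoments.
Context {R : realType}.
Implicit Types (h g : R * R -> R) (m : nat).

Notation mu := (@lebesgue_measure R).

(** Arises from [Top] on functions homogeneous of degree n, with m = 2n + 1: one power of s comes
    from the operator and 2n from the argument s^2 z. *)
Definition moment m h (r : R) : R :=
  \int[mu]_(s in `[0, 1]) (s ^+ m * h (r, 1 - s ^+ 2)).

Lemma pow_continuous m : continuous (fun s : R => s ^+ m).
Proof. by move=> s; exact: has_derive_cont (has_derive_pow m s). Qed.

Lemma onem_sqr_continuous : continuous (fun s : R => 1 - s ^+ 2).
Proof. by move=> s; apply: cvgB; [exact: cvg_cst|exact: pow_continuous]. Qed.

Lemma moment_integrand_continuous m h r : continuous h ->
  continuous (fun s : R => s ^+ m * h (r, 1 - s ^+ 2)).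
Proof.
move=> hc; have c : continuous (fun s : R => h (r, 1 - s ^+ 2)).
  apply: (@continuous_comp2 _ _ h (fun=> r) (fun s : R => 1 - s ^+ 2)) => //.
    by move=> ?; exact: cvg_cst.
  exact: onem_sqr_continuous.
by move=> s; apply: cvgM; [exact: pow_continuous|exact: c].
Qed.

Lemma continuous_integrable_cc (f : R -> R) (a b : R) : continuous f ->
  mu.-integrable `[a, b] (EFin \o f).
Proof.
move=> fc; apply: continuous_compact_integrable; first exact: segment_compact.
exact: continuous_subspaceT.
Qed.

Lemma moment_integrable m h r : continuous h ->
  mu.-integrable `[0, 1] (EFin \o (fun s : R => s ^+ m * h (r, 1 - s ^+ 2))).
Proof. by move=> hc; apply: continuous_integrable_cc; exact: moment_integrand_continuous. Qed.

Lemma unit_itv_sqr (s : R) : 0 <= s <= 1 -> 0 <= 1 - s ^+ 2 <= 1.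
Proof.
move=> /andP[s0 s1]; rewrite subr_ge0 exprn_ile1 // gerBl sqr_ge0; exact: isT.
Qed.

Lemma unit_itv_sqr_oo (s : R) : 0 < s < 1 -> 0 < 1 - s ^+ 2 < 1.
Proof. by move=> /andP[s0 s1]; rewrite subr_gt0 exprn_ilt1 ?ltW // gtrBl exprn_gt0. Qed.

Lemma moment_bound m h (a b M r : R) : continuous h -> 0 <= M ->
  (forall r t, a <= r <= b -> 0 <= t <= 1 -> `|h (r, t)| <= M) ->
  a <= r <= b -> `|moment m h r| <= M.
Proof.
move=> hc M0 hM rab.
apply: (le_trans (le_normr_Rintegral _ (moment_integrable m r hc))); first by [].
have -> : M = \int[mu]_(s in `[0%R, 1%R]) M.
  by rewrite Rintegral_cst //= lebesgue_measure_itv /= lte_fin ltr01 /= oppr0 addr0 mulr1.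
apply: le_Rintegral => //.
- apply: continuous_integrable_cc => s; apply: cvg_norm.
  exact: moment_integrand_continuous.
- by apply: continuous_integrable_cc => s; exact: cvg_cst.
- move=> s /=; rewrite in_itv /= => s01; have := unit_itv_sqr s01 => t01.
  rewrite normrM -[leRHS]mul1r; apply: ler_pM => //; last exact: hM.
  by move/andP: s01 => [s0 s1]; rewrite ger0_norm ?exprn_ge0 // exprn_ile1.
Qed.

Lemma Rintegral_oo_cc (f : R -> R) (a b : R) : a < b ->
  mu.-integrable `[a, b] (EFin \o f) ->
  \int[mu]_(s in `]a, b[) f s = \int[mu]_(s in `[a, b]) f s.
Proof.
move=> ab fi; rewrite Rintegral_itv_bndo_bndc; last first.
  by apply: integrableS fi => //; exact: subset_itv_oo_cc.
rewrite Rintegral_itv_obnd_cbnd //.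
by apply: integrableS fi => //; exact: subset_itv_oc_cc.
Qed.

Lemma moment_derive m h g (rho r : R) : continuous h -> continuous g ->
  (forall x t : R, 0 < x < rho -> 0 < t < 1 -> has_derive x 1 (fun z => h (z, t)) (g (x, t))) ->
  0 < r < rho -> has_derive r 1 (moment m h) (moment m g r).
Proof.
move=> hc gc hg rr.
have [M M0 gM] := continuous_bounded_rect 0 rho gc.
pose f (x s : R) : R := s ^+ m * h (x, 1 - s ^+ 2).
have fd x s : 0 < x < rho -> 0 < s < 1 ->
    has_derive x 1 (f ^~ s) (s ^+ m * g (x, 1 - s ^+ 2)).
  move=> xr s01; apply: has_derive_val.
    exact: (has_derive_mul (has_derive_const (s ^+ m) x 1)
       (hg _ _ xr (unit_itv_sqr_oo s01))).
  by rewrite mul0r add0r.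
have fI x : mu.-integrable `]0, 1[ (EFin \o f x).
  apply: integrableS (moment_integrable m x hc) => //.
  exact: subset_itv_oo_cc.
(* The integral is moved to the open interval because [h] has a known derivative only for 0 < t < 1;
   the endpoints s = 0 and s = 1, that is t = 1 and t = 0, are negligible. *)
have EJ k : continuous k -> forall x,
    moment m k x = \int[mu]_(s in `]0, 1[) (s ^+ m * k (x, 1 - s ^+ 2)).
  by move=> kc x; rewrite Rintegral_oo_cc //; exact: moment_integrable.
have Ir : `]0, rho[%classic r by rewrite /= in_itv.
have derf x y : `]0, rho[%classic x -> `]0, 1[%classic y -> derivable (f ^~ y) x 1.
  by rewrite /= !in_itv /= => xr yr; have [] := fd x y xr yr.
have MI : mu.-integrable `]0, 1[ (EFin \o (fun _ : R => M)).
  have c : continuous (fun _ : R => M) by move=> s; exact: cvg_cst.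
  by apply: integrableS (continuous_integrable_cc 0 1 c) => //; exact: subset_itv_oo_cc.
have pub x y : `]0, rho[%classic x -> `]0, 1[%classic y -> `|partial1of2 f x y| <= M.
  rewrite /= !in_itv /= => xr yr; have [_ e] := fd x y xr yr.
  rewrite /partial1of2 derive1E e normrM -[leRHS]mul1r.
  move/andP: (yr) => [y0 y1]; apply: ler_pM => //.
    by rewrite ger0_norm ?exprn_ge0 ?exprn_ile1 ?(ltW y0) ?(ltW y1).
  have /andP[t0 t1] := unit_itv_sqr_oo yr; move/andP: xr => [x0 xr].
  by apply: gM; rewrite !ltW.
have mB : measurable (`]0, 1[%classic : set R) by [].
have A := @derivable_under_integral R _ _ mu f _ mB r 0 rho Ir (fun x _ => fI x) derf
   (fun=> M) (fun=> M0) MI pub.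
have B := @differentiation_under_integral R _ _ mu f _ mB r 0 rho Ir (fun x _ => fI x) derf
   (fun=> M) (fun=> M0) MI pub.
have -> : moment m h = (fun x => \int[mu]_(y in `]0, 1[) f x y).
  by apply/funext => x; rewrite EJ.
split; first exact: A.
rewrite -derive1E B EJ //; apply: eq_Rintegral => s; rewrite inE /= in_itv /= => s01.
by have [_ e] := fd r s rr s01; rewrite /partial1of2 derive1E e.
Qed.

Lemma moment_continuous m h : continuous h -> continuous (moment m h).
Proof.
move=> hc r.
have [M M0 hM] := continuous_bounded_rect (r - 1) (r + 1) hc.
pose f (x s : R) : R := s ^+ m * h (x, 1 - s ^+ 2).
have mB : measurable (`[0, 1]%classic : set R) by [].
have H := @continuity_under_integral R _ _ mu f _ mB (r - 1) (r + 1)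
  (fun x _ => moment_integrable m x hc).
have MI : mu.-integrable `[0, 1] (EFin \o (fun _ : R => M)).
  by apply: continuous_integrable_cc => s; exact: cvg_cst.
have cf : \forall y \ae mu, `[0%R, 1%R]%classic y ->
    {in `](r - 1), (r + 1)[%classic, continuous (f^~ y)}.
  apply: aeW => y _; have c : continuous (fun x => h (x, 1 - y ^+ 2)).
    apply: (@continuous_comp2 _ _ h (fun x : R => x) (fun=> 1 - y ^+ 2)) => //.
      by move=> ?; exact: cvg_id.
    by move=> ?; exact: cvg_cst.
  by move=> x _; apply: cvgM; [exact: cvg_cst|exact: c].
have ub x : `](r - 1), (r + 1)[%classic x ->
    \forall y \ae mu, `[0%R, 1%R]%classic y -> `|f x y| <= M.
  rewrite /= in_itv /= => /andP[x0 x1]; apply: aeW => y /=; rewrite in_itv /= => y01.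
  rewrite /f normrM -[leRHS]mul1r; apply: ler_pM => //.
    by move/andP: y01 => [y0 y1]; rewrite ger0_norm ?exprn_ge0 // exprn_ile1.
  by apply: hM; [rewrite !ltW|exact: unit_itv_sqr].
have := H cf (fun=> M) MI ub r; apply.
by rewrite inE /= in_itv /=; apply/andP; split; lra.
Qed.

Lemma FTC2 (F f : R -> R) (a b : R) : a < b ->
  continuous F -> continuous f -> (forall x : R, a < x < b -> has_derive x 1 F (f x)) ->
  \int[mu]_(s in `[a, b]) f s = F b - F a.
Proof.
move=> ab Fc fc Fd; rewrite /Rintegral (@continuous_FTC2 _ f F) //.
- exact: continuous_subspaceT.
- split.
  + by move=> x; rewrite in_itv /= => /Fd[].
  + by apply: cvg_at_right_filter; exact: Fc.
  + by apply: cvg_at_left_filter; exact: Fc.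
- by move=> x; rewrite in_itv /= => /Fd[_ e]; rewrite derive1E e.
Qed.

(** Integrates the derivative of s^(m+1) g(r, 1 - s^2). The inner derivative -2s raises the power in
    the second moment to m + 2, and the only boundary term is at s = 1, where t = 0. *)
Lemma moment_by_parts m g g' (r : R) : continuous g -> continuous g' ->
  (forall t : R, 0 < t < 1 -> has_derive t 1 (fun z => g (r, z)) (g' (r, t))) ->
  m.+1%:R * moment m g r - 2 * moment m.+2 g' r = g (r, 0).
Proof.
move=> gc gc' gd.
pose F (s : R) : R := s ^+ m.+1 * g (r, 1 - s ^+ 2).
pose f (s : R) : R := m.+1%:R * (s ^+ m * g (r, 1 - s ^+ 2)) -
                      2 * (s ^+ m.+2 * g' (r, 1 - s ^+ 2)).
have c1 := @moment_integrand_continuous m g r gc.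
have c2 := @moment_integrand_continuous m.+2 g' r gc'.
have := @FTC2 F f 0 1 ltr01 (@moment_integrand_continuous m.+1 g r gc).
have fc : continuous f.
  by move=> s; apply: cvgB; apply: cvgM; (exact: cvg_cst || exact: c1 || exact: c2).
move=> /(_ fc) H; rewrite /moment -!RintegralZl //; try exact: moment_integrable.
rewrite -RintegralB //; first last.
- by apply: continuous_integrable_cc => s; apply: cvgM; [exact: cvg_cst|exact: c2].
- by apply: continuous_integrable_cc => s; apply: cvgM; [exact: cvg_cst|exact: c1].
rewrite [LHS]H.
  by rewrite /F !expr1n mul1r subrr expr0n /= mul0r subr0.
move=> s s01; apply: has_derive_val.
  apply: (has_derive_mul (has_derive_pow m.+1 s)).
  apply: (@has_derive_chain _ _ (fun z : R => g (r, z)) (fun s : R => 1 - s ^+ 2)); last first.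
    exact: gd (unit_itv_sqr_oo s01).
  exact: (has_derive_sub (has_derive_const 1 s 1) (has_derive_pow 2 s)).
by rewrite /f /= expr1 !exprS; ring.
Qed.

(** Fits functions known through their increments, such as edge limits or integrals over annuli. The
    pair a, b need not surround x: a = x and b = x give the two one-sided quotients. *)
Lemma has_derive_bounds (f : R -> R) (x l : R) :
  (forall e, 0 < e -> exists2 d, 0 < d &
     forall a b, x - d < a -> a < b -> b < x + d ->
       (l - e) * (b - a) <= f b - f a <= (l + e) * (b - a)) ->
  has_derive x 1 f l.
Proof.
move=> H.
have C : h^-1 *: (f (h *: 1 + x) - f x) @[h --> 0^'] --> l.
  apply/cvgrPdist_le => e e0; have [d d0 Hd] := H _ e0.
  near=> h; have hd : `|h| < d by near: h; exact: dnbhs0_lt.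
  have h0 : h != 0 by near: h; exact: nbhs_dnbhs_neq.
  rewrite [h%:A]mulr1 /GRing.scale /=.
  move: hd; rewrite ltr_norml => /andP[hd1 hd2].
  have hh : h^-1 * (f (h + x) - f x) - l = (f (h + x) - f x - l * h) / h by field.
  rewrite distrC hh normrM normfV ler_pdivrMr ?normr_gt0 //.
  have [hp|hn] := ltP 0 h.
    have := Hd x (h + x) ltac:(lra) ltac:(lra) ltac:(lra).
    rewrite (gtr0_norm hp) ler_norml => /andP[? ?].
    by apply/andP; split; lra.
  have hn' : h < 0 by rewrite lt_def eq_sym h0.
  have := Hd (h + x) x ltac:(lra) ltac:(lra) ltac:(lra).
  rewrite (ltr0_norm hn') ler_norml => /andP[? ?].
  by apply/andP; split; lra.
split; last by apply/cvg_lim => //; exact: C.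
by apply/cvg_ex; exists l; exact: C.
Unshelve. all: by end_near. Qed.

(** Differentiability is given only for t > 0. There the mean value theorem bounds the increments of
    [h] by values of [g] close to (r, 0), and these bounds pass to t = 0 by continuity. *)
Lemma boundary_derivative h g (rho r : R) : continuous h -> continuous g ->
  (forall x t : R, 0 < x < rho -> 0 < t < 1 -> has_derive x 1 (fun z => h (z, t)) (g (x, t))) ->
  0 < r < rho -> has_derive r 1 (fun x => h (x, 0)) (g (r, 0)).
Proof.
move=> hc gc hd /andP[r0 rr]; apply: has_derive_bounds => e e0.
have /cvgrPdist_lt/(_ _ e0) := gc (r, 0).
move=> /nbhs_ballP[d /= d0 Hd].
pose d' := Num.min d (Num.min r (rho - r)).
have d'0 : 0 < d' by rewrite !lt_min d0 r0 subr_gt0.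
have [d'd d'r d'rr] : [/\ d' <= d, d' <= r & d' <= rho - r].
  by rewrite /d'; split; rewrite !ge_min lexx ?orbT.
exists d' => // a b ra ab br.
have lim0 x : h (x, t) @[t --> 0^'+] --> h (x, 0).
  have c : continuous (fun t => h (x, t)).
    apply: (@continuous_comp2 _ _ h (fun=> x) (fun t : R => t)) => //.
      by move=> ?; exact: cvg_cst.
    by move=> ?; exact: cvg_id.
  by have /cvg_at_right_filter := c 0.
have key : \forall t \near 0^'+,
    (g (r, 0) - e) * (b - a) <= h (b, t) - h (a, t) <= (g (r, 0) + e) * (b - a).
  near=> t.
  have t0 : 0 < t by near: t; exact: nbhs_right_gt.
  have t1 : t < 1 by near: t; exact: nbhs_right_lt.
  have td : t < d by near: t; exact: nbhs_right_lt.
  have t01 : 0 < t < 1 by rewrite t0.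
  have sub x : a <= x <= b -> 0 < x < rho.
    by move=> /andP[ax xb]; apply/andP; split; lra.
  have [||c] := @MVT _ (fun x => h (x, t)) (fun x => g (x, t)) a b ab.
  - by move=> x; rewrite in_itv /= => /andP[? ?]; apply: hd => //; apply: sub; rewrite !ltW.
  - by apply: (@derive_cc_cont _ _ (fun x => g (x, t))) => x xab; apply: hd => //; exact: sub.
  rewrite in_itv /= => /andP[ac cb] ->.
  have : `|g (r, 0) - g (c, t)| < e.
    apply: Hd; split => /=; rewrite /ball /= ltr_norml; apply/andP; split; lra.
  by rewrite ltr_norml => /andP[? ?]; rewrite !ler_pM2r ?subr_gt0 //; apply/andP; split; lra.
have L : h (b, t) - h (a, t) @[t --> 0^'+] --> h (b, 0) - h (a, 0) by apply: cvgB.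
apply/andP; split.
- apply: (ler_cvg_to (f := fun=> (g (r, 0) - e) * (b - a)) _ L).
    exact: cvg_cst.
  by apply: filterS key => t /andP[].
- apply: (ler_cvg_to (g := fun=> (g (r, 0) + e) * (b - a)) L).
    exact: cvg_cst.
  by apply: filterS key => t /andP[].
Unshelve. all: by end_near. Qed.

End KernelMoments.

Section RealIntegrable.
Context d (T : measurableType d) (R : realType) (mu : {measure set T -> \bar R}).
Context (D : set T) (mD : measurable D).
Implicit Types f g : T -> R.

Lemma integrable_add f g : mu.-integrable D (EFin \o f) ->
  mu.-integrable D (EFin \o g) -> mu.-integrable D (EFin \o (fun x => f x + g x)).
Proof. by move=> fi gi; apply: eq_integrable (integrableD mD fi gi). Qed.

Lemma integrable_scale (c : R) f : mu.-integrable D (EFin \o f) ->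
  mu.-integrable D (EFin \o (fun x => c * f x)).
Proof. by move=> fi; apply: eq_integrable (integrableZl mD c fi). Qed.

End RealIntegrable.

(** * The kernel moments solve the radial equation *)

Section KernelSolution.
Context {R : realType}.
Implicit Types (q : R -> R[i]) (G : R * R -> R[i]).

Notation mu := (@lebesgue_measure R).

Lemma bounded_integrable_itv (p : R -> R) (i : interval R) (M : R) :
  (mu [set` i] < +oo)%E -> measurable_fun [set` i] p ->
  (forall x, x \in i -> `|p x| <= M) -> mu.-integrable [set` i] (EFin \o p).
Proof.
move=> fi mp pM; apply: measurable_bounded_integrable => //.
exists M; split; first exact: num_real.
by move=> N MN x xi; apply: le_trans (ltW MN); exact: pM.
Qed.

(** [p] is controlled only inside the interval, so the fundamental theorem is used on ]0, u] with u
    between r and rho; adding the point 0 does not change the integral. *)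
Lemma derive_primitive (rho M r : R) (p : R -> R) :
  (forall x : R, 0 < x < rho -> {for x, continuous p}) ->
  (forall x : R, 0 < x < rho -> `|p x| <= M) ->
  0 < r < rho -> has_derive r 1 (fun x => \int[mu]_(t in `[0, x]) p t) (p r).
Proof.
move=> pc pM /andP[r0 rr]; pose u := (r + rho) / 2.
have ru : r < u by rewrite /u; lra.
have sub x : x \in `]0, u] -> 0 < x < rho.
  by rewrite in_itv /= => /andP[x0 xu]; apply/andP; split => //; rewrite /u in xu; lra.
have pI : mu.-integrable `]0, u] (EFin \o p).
  apply: (@bounded_integrable_itv p _ M) => [||x /sub/pM//].
    by rewrite /= lebesgue_measure_itv /=; case: ifP => _; rewrite ?ltry // -EFinB ltry.
  apply: subspace_continuous_measurable_fun => //.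
  by apply: continuous_in_subspaceT => x; rewrite inE => /sub/pc.
have [] := @continuous_FTC1 _ p (BRight 0) r u ru pI r0 (pc r _).
  by rewrite r0.
move=> d e; apply: (@has_derive_near _ _ (fun x : R => \int[mu]_(t in `]0, x]) p t)).
  have : 0 < r < u by rewrite r0.
  move=> /in_oo_near; apply: filterS => x /andP[x0 xu].
  rewrite Rintegral_itv_obnd_cbnd //; apply: integrableS pI => //.
  by move=> y /=; rewrite !in_itv /= => /andP[-> yx] /=; rewrite (le_trans yx) // ltW.
by split; [exact: d|rewrite -derive1E e].
Qed.

Definition kphi G (n : nat) (r : R) : R[i] :=
  1 + cintegral leb `[0, 1] (fun s => (s ^+ (2 * n + 1))%:C * G (r, 1 - s ^+ 2)).

(** This is the equation of y = r^(n + 1/2) F rewritten for F. The bound F' = O(r) expresses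
    regularity at 0 and later makes z -> F(|z|) continuously differentiable there. *)
Definition regular_radial (rho : R) (n : nat) q (F F1 F2 : R -> R[i]) : Prop :=
  [/\ forall r : R, 0 < r < rho -> has_cderive r 1 F (F1 r),
      forall r : R, 0 < r < rho -> has_cderive r 1 F1 (F2 r),
      forall r : R, 0 < r < rho ->
        r%:C * (F2 r - q r * F r) + (2 * n + 1)%:R%:C * F1 r = 0 &
      exists C : R, forall r : R, 0 < r < rho -> normc (F1 r) <= C * r].

Definition ccontinuous (F : R -> R[i]) :=
  continuous (fun r : R => Re (F r)) /\ continuous (fun r : R => Im (F r)).

(** Put t = 1 - s^2 in the equation of G, multiply by s^k with k = 2n + 1 and integrate. Integration
    by parts turns the mixed term into (k + 1) times the moment of G_r minus the edge value G_r(r,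
    0) = r q(r). The edge value cancels the contribution r q(r) of the summand 1 in [kphi], and the
    coefficient of F' is (k + 1) - 1 = k. *)
Lemma kphi_solution (rho M : R) (n : nat) q G : 0 < rho ->
  (forall x : R, 0 < x < rho -> {for x, continuous (fun r : R => Re (q r))}) ->
  (forall x : R, 0 < x < rho -> {for x, continuous (fun r : R => Im (q r))}) ->
  (forall x : R, 0 < x < rho -> normc (q x) <= M) ->
  transmutation_kernel rho q G ->
  [/\ exists2 F0, ccontinuous F0 & forall r : R, 0 <= r <= rho -> kphi G n r = F0 r,
      kphi G n 0 = 1 &
      exists F1 F2, regular_radial rho n q (kphi G n) F1 F2].
Proof.
move=> rho0 qrc qic qM [[Gr Gi] Geq Gint G0].
have [a0 [a1 [a11 [a12 [[a0c a1c a11c a12c] [aE aD]]]]]] := kernel_regularity (ltW rho0) Gr.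
have [b0 [b1 [b11 [b12 [[b0c b1c b11c b12c] [bE bD]]]]]] := kernel_regularity (ltW rho0) Gi.
pose k := (2 * n + 1)%N.
pose F0 r := (1 + moment k a0 r) +i* moment k b0 r.
have FE r : 0 <= r <= rho -> kphi G n r = F0 r.
  move=> rr; rewrite /kphi /F0 /cintegral.
  have -> : \int[leb]_(s in `[0, 1]) Re ((s ^+ (2 * n + 1))%:C * G (r, 1 - s ^+ 2)) =
            moment k a0 r.
    apply: eq_Rintegral => s; rewrite inE /= in_itv /= => s01.
    rewrite Re_mul /= mul0r subr0 aE //; split; rewrite /= in_itv //=.
    exact: unit_itv_sqr.
  have -> : \int[leb]_(s in `[0, 1]) Im ((s ^+ (2 * n + 1))%:C * G (r, 1 - s ^+ 2)) =
            moment k b0 r.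
    apply: eq_Rintegral => s; rewrite inE /= in_itv /= => s01.
    rewrite Im_mul /= mul0r addr0 bE //; split; rewrite /= in_itv //=.
    exact: unit_itv_sqr.
  by apply/eqP; rewrite eq_complex /= add0r !eqxx.
have nearE (r : R) : 0 < r < rho -> \forall x \near r, F0 x = kphi G n x.
  by move=> /in_oo_near; apply: filterS => x /andP[x0 xr]; rewrite FE // !ltW.
pose F1 r := moment k a1 r +i* moment k b1 r.
pose F2 r := moment k a11 r +i* moment k b11 r.
have F0d (r : R) : 0 < r < rho -> has_cderive r 1 F0 (F1 r).
  move=> rr; split => /=; last first.
    by apply: (moment_derive _ b0c b1c _ rr) => x t xr t01; have [_ []] := bD x t xr t01.
  apply: has_derive_val.
    apply: (has_derive_add (has_derive_const 1 r 1)).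
    by apply: (moment_derive _ a0c a1c _ rr) => x t xr t01; have [_ []] := aD x t xr t01.
  by rewrite add0r.
have F1d (r : R) : 0 < r < rho -> has_cderive r 1 F1 (F2 r).
  move=> rr; split => /=.
    by apply: (moment_derive _ a1c a11c _ rr) => x t xr t01; have [_ []] := aD x t xr t01.
  by apply: (moment_derive _ b1c b11c _ rr) => x t xr t01; have [_ []] := bD x t xr t01.
(* The edge condition on G(r, 0) is differentiated in two ways: as a primitive of tau q(tau), and as
   a limit of interior values of G_r. *)
have edge (r : R) : 0 < r < rho -> a1 (r, 0) = r * Re (q r) /\ b1 (r, 0) = r * Im (q r).
  move=> rr; have [r0 rrho] := andP rr.
  have cr (x : R) : 0 < x < rho -> {for x, continuous (fun r : R => r * Re (q r))}.
    by move=> xr; apply: cvgM; [exact: cvg_id|exact: qrc].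
  have ci (x : R) : 0 < x < rho -> {for x, continuous (fun r : R => r * Im (q r))}.
    by move=> xr; apply: cvgM; [exact: cvg_id|exact: qic].
  have bnd (p : R -> R) x : (forall x, `|p x| <= normc (q x)) -> 0 < x < rho ->
      `|x * p x| <= rho * M.
    move=> pq xr; rewrite normrM; apply: ler_pM => //.
      by move/andP: xr => [x0 xr]; rewrite gtr0_norm // ltW.
    exact: le_trans (pq x) (qM x xr).
  have dr := derive_primitive cr (fun x => bnd _ x (fun x : R => ler_Re_normc _)) rr.
  have di := derive_primitive ci (fun x => bnd _ x (fun x : R => ler_Im_normc _)) rr.
  have ea := boundary_derivative a0c a1c
    (fun x t xr t01 => let: conj _ (And3 e _ _) := aD x t xr t01 in e) rr.
  have eb := boundary_derivative b0c b1c
    (fun x t xr t01 => let: conj _ (And3 e _ _) := bD x t xr t01 in e) rr.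
  have Ga : \forall x \near r, \int[mu]_(t in `[0, x]) (t * Re (q t)) = a0 (x, 0).
    apply: filterS (in_oo_near rr) => x /andP[x0 xr].
    rewrite -aE; last by split; rewrite /= in_itv /= ?lexx ?ler01 // !ltW.
    rewrite Gint ?(ltW x0) ?(ltW xr) // /cintegral /=.
    by apply: eq_Rintegral => t _; rewrite Re_mul /= mul0r subr0.
  have Gb : \forall x \near r, \int[mu]_(t in `[0, x]) (t * Im (q t)) = b0 (x, 0).
    apply: filterS (in_oo_near rr) => x /andP[x0 xr].
    rewrite -bE; last by split; rewrite /= in_itv /= ?lexx ?ler01 // !ltW.
    rewrite Gint ?(ltW x0) ?(ltW xr) // /cintegral /=.
    by apply: eq_Rintegral => t _; rewrite Im_mul /= mul0r addr0.
  have [_ e1] := has_derive_near Ga dr; have [_ e2] := ea.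
  have [_ e3] := has_derive_near Gb di; have [_ e4] := eb.
  by split; [rewrite -e1 -e2|rewrite -e3 -e4].
have ode (r : R) : 0 < r < rho ->
    r%:C * (F2 r - q r * F0 r) + (2 * n + 1)%:R%:C * F1 r = 0.
  move=> rr; have [ea eb] := edge r rr; have [r0 rrho] := andP rr.
  have rr' : 0 <= r <= rho by rewrite !ltW.
  have pa := @moment_by_parts _ k a1 a12 r a1c a12c
    (fun t t01 => let: conj _ (And3 _ _ e) := aD r t rr t01 in e).
  have pb := @moment_by_parts _ k b1 b12 r b1c b12c
    (fun t t01 => let: conj _ (And3 _ _ e) := bD r t rr t01 in e).
  (* The real and imaginary parts of the equation share this shape: [h1] and [h4] are the two parts
     of G, which the parts [c0] and [c4] of q mix. *)
  have lin (h0 h1 h2 h3 h4 : R * R -> R) (c0 c4 : R) :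
      continuous h0 -> continuous h1 -> continuous h2 -> continuous h3 ->
      continuous h4 ->
      (forall t : R, 0 < t < 1 -> r * (h0 (r, t) - (c0 * h1 (r, t) + c4 * h4 (r, t)))
         - h2 (r, t) + 2 * (1 - t) * h3 (r, t) = 0) ->
      r * (moment k h0 r - (c0 * moment k h1 r + c4 * moment k h4 r)) - moment k h2 r
        + 2 * moment k.+2 h3 r = 0.
    move=> h0c h1c h2c h3c h4c H.
    have I m h : continuous h ->
        mu.-integrable `]0, 1[ (EFin \o (fun s : R => s ^+ m * h (r, 1 - s ^+ 2))).
      move=> hc; apply: integrableS (moment_integrable m r hc) => //.
      exact: subset_itv_oo_cc.
    have IZ (c : R) m h : continuous h ->
        mu.-integrable `]0, 1[ (EFin \o (fun s : R => c * (s ^+ m * h (r, 1 - s ^+ 2)))).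
      by move=> hc; apply: integrable_scale => //; exact: I.
    have E m h : continuous h -> moment m h r =
        \int[mu]_(s in `]0, 1[) (s ^+ m * h (r, 1 - s ^+ 2)).
      by move=> hc; rewrite Rintegral_oo_cc //; exact: moment_integrable.
    have -> : r * (moment k h0 r - (c0 * moment k h1 r + c4 * moment k h4 r))
        - moment k h2 r + 2 * moment k.+2 h3 r =
        r * moment k h0 r + ((- (r * c0)) * moment k h1 r + ((- (r * c4)) * moment k h4 r +
          (- 1 * moment k h2 r + 2 * moment k.+2 h3 r))) by ring.
    rewrite !E // -!RintegralZl //; try exact: I.
    rewrite -RintegralD //; try exact: IZ.
    rewrite -RintegralD //; try (apply: integrable_add => //; exact: IZ); try exact: IZ.
    rewrite -RintegralD //; try (do 2?apply: integrable_add => //; exact: IZ); try exact: IZ.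
    rewrite -RintegralD //; try (do 3?apply: integrable_add => //; exact: IZ); try exact: IZ.
    under eq_Rintegral => s.
      rewrite inE /= in_itv /= => s01.
      rewrite (_ : _ + _ = 0); first over.
      have := H _ (unit_itv_sqr_oo s01) => /(congr1 (fun z => s ^+ k * z)).
      rewrite mulr0 => <-; rewrite !exprS; ring.
    by rewrite Rintegral_cst //= mul0r.
  have eqs (t : R) : 0 < t < 1 ->
     r * (a11 (r, t) - (Re (q r) * a0 (r, t) + (- Im (q r)) * b0 (r, t))) - a1 (r, t)
       + 2 * (1 - t) * a12 (r, t) = 0 /\
     r * (b11 (r, t) - (Im (q r) * a0 (r, t) + Re (q r) * b0 (r, t))) - b1 (r, t)
       + 2 * (1 - t) * b12 (r, t) = 0.
    move=> t01; have := Geq r t rr t01.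
    have [t0 t1] := andP t01.
    have [[A1 A11 A12] _] := aD r t rr t01; have [[B1 B11 B12] _] := bD r t rr t01.
    have rt : rect rho (r, t) by split; rewrite /= in_itv /= ?rr' // !ltW.
    rewrite /cpartial /=.
    move=> /eqP; rewrite eq_complex => /andP[/eqP + /eqP].
    rewrite !ReImE /=.
    rewrite !(A1, A11, A12, B1, B11, B12) (aE _ rt) (bE _ rt) => eA eB.
    by split; [rewrite -[RHS]eA|rewrite -[RHS]eB]; ring.
  have la := lin a11 a0 a1 a12 b0 (Re (q r)) (- Im (q r)) a11c a0c a1c a12c b0c
    (fun t h => (eqs t h).1).
  have lb := lin b11 a0 b1 b12 b0 (Im (q r)) (Re (q r)) b11c a0c b1c b12c b0c
    (fun t h => (eqs t h).2).
  have kE : k%:R = 2 * n%:R + 1 :> R by rewrite /k natrD natrM.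
  have kE1 : k.+1%:R = 2 * n%:R + 2 :> R by rewrite -natr1 kE; ring.
  rewrite kE1 ea in pa; rewrite kE1 eb in pb.
  rewrite -/k kE; apply/eqP; rewrite eq_complex; apply/andP; split; apply/eqP.
  - rewrite !ReImE /=.
    rewrite -[RHS]la; nra.
  - rewrite !ReImE /=.
    rewrite -[RHS]lb; nra.
have [Ma11 Ma110 a11b] := continuous_bounded_rect 0 rho a11c.
have [Mb11 Mb110 b11b] := continuous_bounded_rect 0 rho b11c.
have [Ma0 Ma00 a0b] := continuous_bounded_rect 0 rho a0c.
have [Mb0 Mb00 b0b] := continuous_bounded_rect 0 rho b0c.
split.
- exists F0 => //; split => /=; last exact: moment_continuous.
  by move=> r; apply: cvgD; [exact: cvg_cst|exact: moment_continuous].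
- rewrite FE ?lexx ?(ltW rho0) // /F0.
  have z h (h0 : forall t : R, 0 <= t <= 1 -> h (0, t) = 0) : moment k h 0 = 0.
    rewrite /moment; under eq_Rintegral => s.
      rewrite inE /= in_itv /= => s01; rewrite h0 ?mulr0; last exact: unit_itv_sqr.
      over.
    by rewrite Rintegral_cst //= mul0r.
  have r0 (t : R) : 0 <= t <= 1 -> rect rho (0, t).
    by move=> t01; split; rewrite /= in_itv /= ?lexx ?(ltW rho0).
  rewrite !z ?addr0 // => t t01; first by rewrite -bE ?G0 //; exact: r0.
  by rewrite -aE ?G0 //; exact: r0.
- exists F1, F2; split => //.
  + by move=> r rr; apply: has_cderive_near (nearE r rr) (F0d r rr).
  + by move=> r rr; have [r0 rrho] := andP rr; rewrite FE ?ode // !ltW.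
  + pose N := (Ma11 + Mb11) + M * ((1 + Ma0) + Mb0).
    exists N => r rr; have [r0 rrho] := andP rr; have rr' : 0 <= r <= rho by rewrite !ltW.
    have N2 : normc (F2 r) <= Ma11 + Mb11.
      apply: le_trans (ler_normc_ReIm _) _; apply: lerD.
        exact: (moment_bound _ a11c Ma110 a11b).
      exact: (moment_bound _ b11c Mb110 b11b).
    have N0 : normc (F0 r) <= (1 + Ma0) + Mb0.
      apply: le_trans (ler_normc_ReIm _) _; apply: lerD.
        apply: le_trans (ler_normD _ _) _; rewrite normr1 lerD2l.
        exact: (moment_bound _ a0c Ma00 a0b).
      exact: (moment_bound _ b0c Mb00 b0b).
    (* The equation itself provides the bound at 0: F' is r times a bounded function. *)
    have e : (2 * n + 1)%:R%:C * F1 r = - (r%:C * (F2 r - q r * F0 r)).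
      by apply/eqP; rewrite -addr_eq0 addrC ode.
    have : normc ((2 * n + 1)%:R%:C * F1 r) <= r * N.
      rewrite e normcN Normc.normcM normcR gtr0_norm // ler_pM2l //.
      apply: le_trans (ler_normcD _ _) _; rewrite normcN Normc.normcM.
      by apply: lerD => //; apply: ler_pM; rewrite ?normc_ge0 ?qM.
    rewrite Normc.normcM normcR mulrC [N * r]mulrC; apply: le_trans.
    by rewrite ler_peMr ?normc_ge0 // ger0_norm // natrD lerDr.
Qed.

End KernelSolution.

(** * Uniqueness of the radial factors and the Darboux transformation *)

Section IntervalRegularity.
Context {R : realType}.
Implicit Types (p : R -> R) (F : R -> R[i]).

Lemma interior_cc (rho x : R) : 0 < x < rho -> (`[0, rho]%classic)° x.
Proof.
by move=> /in_oo_near; apply: filterS => t /andP[t0 tr]; rewrite /= in_itv /= !ltW.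
Qed.

Lemma interior_oc (rho x : R) : 0 < x < rho -> (`]0, rho]%classic)° x.
Proof.
by move=> /in_oo_near; apply: filterS => t /andP[t0 tr]; rewrite /= in_itv /= t0 ltW.
Qed.

Lemma realCk1_bounded (rho : R) (k : nat) p : 0 < rho -> realCk [:: (1 : R)] k.+1 `[0, rho] p ->
  exists M : R,
  [/\ forall x : R, 0 <= x <= rho -> `|p x| <= M,
      forall x : R, 0 < x < rho -> has_derive x 1 p ('D_1 p x) &
      forall x : R, 0 < x < rho -> `|'D_1 p x| <= M].
Proof.
move=> rho0 [pc [_ /= H]].
have /H[pd Hk] : (1 : R) \in [:: 1 : R] by rewrite inE eqxx.
have [d dc dE] : exists2 d : R -> R, {within `[0, rho], continuous d} &
    forall x, (`[0, rho]%classic)° x -> d x = 'D_1 p x.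
  by case: k Hk {H} => [|k] [].
have [M _ pM] := continuous_compact_bounded (@segment_compact _ 0 rho) pc.
have [N _ dN] := continuous_compact_bounded (@segment_compact _ 0 rho) dc.
exists (Num.max M N); split => x xr.
- by rewrite le_max pM // /= in_itv.
- by split => //; apply: pd; exact: interior_cc.
- have [x0 x1] := andP xr.
  by rewrite -dE ?le_max ?dN ?orbT //; [rewrite /= in_itv /= !ltW|exact: interior_cc].
Qed.

Lemma realCk2_derive (A : set R) p (x : R) : realCk [:: (1 : R)] 2 A p -> A° x ->
  has_derive x 1 p ('D_1 p x) /\ has_derive x 1 ('D_1 p) ('D_1 ('D_1 p) x).
Proof.
move=> [_ [_ /= H]] Ax.
have /H[pd [_ H1]] : (1 : R) \in [:: 1 : R] by rewrite inE eqxx.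
have /H1[pdd _] : (1 : R) \in [:: 1 : R] by rewrite inE eqxx.
by split; split => //; [exact: pd|exact: pdd].
Qed.

Lemma cderiveE F : cderive F = fun x => ('D_1 (fun t => Re (F t)) x) +i*
                                        ('D_1 (fun t => Im (F t)) x).
Proof. by apply/funext => x; rewrite /cderive !derive1E. Qed.

Lemma Ck1_derive2 (A : set R) F (x : R) : Ck1 2 A F -> A° x ->
  has_cderive x 1 F (cderive F x) /\ has_cderive x 1 (cderive F) (cderive (cderive F) x).
Proof.
move=> [Fr Fi] Ax; have [r1 r2] := realCk2_derive Fr Ax.
have [i1 i2] := realCk2_derive Fi Ax.
have Re1 : (fun x => Re (cderive F x)) = 'D_1 (fun t => Re (F t)).
  by apply/funext => t; rewrite cderiveE.
have Im1 : (fun x => Im (cderive F x)) = 'D_1 (fun t => Im (F t)).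
  by apply/funext => t; rewrite cderiveE.
have e2 : cderive (cderive F) x = ('D_1 ('D_1 (fun t => Re (F t))) x) +i*
   ('D_1 ('D_1 (fun t => Im (F t))) x).
  by rewrite (cderiveE (cderive F)) Re1 Im1.
split; split.
- by rewrite (congr1 (fun h => h x) Re1).
- by rewrite (congr1 (fun h => h x) Im1).
- by rewrite e2 Re1 /=; exact: r2.
- by rewrite e2 Im1 /=; exact: i2.
Qed.

Lemma Ck1_bounded (rho : R) (k : nat) F : 0 < rho -> Ck1 k.+1 `[0, rho] F ->
  exists2 M : R, (forall x : R, 0 <= x <= rho -> normc (F x) <= M) &
    forall x : R, 0 < x < rho ->
     has_cderive x 1 F (cderive F x) /\ normc (cderive F x) <= M.
Proof.
move=> rho0 [Fr Fi].
have [M [M1 M2 M3]] := realCk1_bounded rho0 Fr.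
have [N [N1 N2 N3]] := realCk1_bounded rho0 Fi.
exists (M + N) => x xr.
  by apply: le_trans (ler_normc_ReIm _) _; apply: lerD; [exact: M1|exact: N1].
rewrite cderiveE; split; first by split; [exact: M2|exact: N2].
by apply: le_trans (ler_normc_ReIm _) _; apply: lerD; [exact: M3|exact: N3].
Qed.

Lemma has_cderive_unique F (x : R) a b : has_cderive x 1 F a -> has_cderive x 1 F b ->
  a = b.
Proof.
move=> [[_ a1] [_ a2]] [[_ b1] [_ b2]]; move: a1 a2; rewrite b1 b2.
by case: a => ? ?; case: b {b1 b2} => ? ? /= -> ->.
Qed.

Lemma within_right0 p (rho : R) : 0 < rho -> {within `[0, rho], continuous p} ->
  p r @[r --> 0^'+] --> p 0.
Proof. by move=> rho0 /continuous_within_itvP => /(_ rho0)[]. Qed.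

Lemma lim0_sub_cst F (l : R[i]) : Re (F r) @[r --> 0^'+] --> Re l ->
  Im (F r) @[r --> 0^'+] --> Im l -> lim0 (fun r => F r - l).
Proof.
move=> Fr Fi.
apply: (@squeeze_right0 _ _ (fun r => `|Re (F r) - Re l| + `|Im (F r) - Im l|) _ ltr01).
  move=> r _; rewrite ger0_norm ?normc_ge0 //.
  by apply: le_trans (ler_normc_ReIm _) _; rewrite !ReImE.
have z (h : R -> R) (c : R) : h r @[r --> 0^'+] --> c ->
    `|h r - c| @[r --> 0^'+] --> 0.
  move=> hc; have : h r - c @[r --> 0^'+] --> c - c by apply: cvgB => //; exact: cvg_cst.
  by rewrite subrr => /cvg_norm; rewrite normr0.
by rewrite -[X in _ --> X](addr0 0); apply: cvgD; exact: z.
Qed.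

End IntervalRegularity.

Section RadialUniqueness.
Context {R : realType} (rho M : R) (n : nat) (q : R -> R[i]).
Hypotheses (rho0 : 0 < rho)
  (qM : forall r : R, 0 < r < rho -> normc (q r) <= M).

Lemma lim0_weighted (F1 : R -> R[i]) : lim0 (fun r => r%:C * F1 r) ->
  lim0 (fun r => (r ^+ (2 * n + 1))%:C * F1 r).
Proof.
apply: (@lim0_bound _ _ _ 1 1) => // r /andP[r0 r1].
rewrite mul1r !Normc.normcM ler_wpM2r ?normc_ge0 // !normcR.
rewrite !gtr0_norm ?exprn_gt0 // addn1 exprS ler_piMr ?(ltW r0) //.
by rewrite exprn_ile1 ?(ltW r0) ?(ltW r1).
Qed.

(** The difference F - H falls under [ode_unique]. Of [H'] only the limit r H' -> 0 is asked,
    because the asymptotics in [regular_solution] give no more. *)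
Lemma regular_radial_unique (F F1 F2 H H1 H2 : R -> R[i]) :
  regular_radial rho n q F F1 F2 -> lim0 (fun r => F r - 1) ->
  (forall r : R, 0 < r < rho -> has_cderive r 1 H (H1 r)) ->
  (forall r : R, 0 < r < rho -> has_cderive r 1 H1 (H2 r)) ->
  (forall r : R, 0 < r < rho ->
     r%:C * (H2 r - q r * H r) + (2 * n + 1)%:R%:C * H1 r = 0) ->
  lim0 (fun r => H r - 1) -> lim0 (fun r => r%:C * H1 r) ->
  forall r : R, 0 < r < rho -> F r = H r.
Proof.
move=> [Fd F1d Fode [C FC]] Fl Hd H1d Hode Hl H1l r rr.
apply/eqP; rewrite -subr_eq0; apply/eqP.
apply: (@ode_unique _ n rho M q (fun r => F r - H r) (fun r => F1 r - H1 r)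
  (fun r => F2 r - H2 r)) => //.
- by move=> x xr; apply: has_cderive_sub; [exact: Fd|exact: Hd].
- by move=> x xr; apply: has_cderive_sub; [exact: F1d|exact: H1d].
- by move=> x xr; rewrite -[RHS](subrr 0) -{1}(Fode x xr) -(Hode x xr); ring.
- have := lim0_add Fl (lim0_opp Hl); rewrite /lim0 (_ : (fun r => _) = fun r => normc (F r - H r)) //.
  by apply/funext => x; congr normc; ring.
- apply: lim0_weighted.
  have F1l : lim0 (fun r => r%:C * F1 r).
    apply: (@lim0_Or _ _ (Num.min rho 1) C); first by rewrite lt_min rho0 ltr01.
    move=> x /andP[x0]; rewrite lt_min => /andP[xr x1].
    have Fx := FC x; rewrite x0 xr in Fx; have := Fx isT => {}Fx.
    rewrite Normc.normcM normcR gtr0_norm //; apply: le_trans Fx.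
    by rewrite ler_piMl ?normc_ge0 ?ltW.
  have := lim0_add F1l (lim0_opp H1l); rewrite /lim0.
  rewrite (_ : (fun r => _) = fun r => normc (r%:C * (F1 r - H1 r))) //.
  by apply/funext => x; congr normc; ring.
Qed.

(* The substitution y = r^(n + 1/2) phi turns the radial equation into the
   Schroedinger form. *)
Lemma regular_solution_phi (y F F1 F2 : R -> R[i]) :
  regular_radial rho n q F F1 F2 -> lim0 (fun r => F r - 1) ->
  regular_solution rho q n y ->
  forall r : R, 0 < r < rho -> F r = phi_of n y r.
Proof.
move=> Freg Fl [yC yode yl y1l].
pose a : R := n%:R + 2^-1.
have a0 : 0 < a by rewrite /a ltr_wpDl // invr_gt0.
pose w (b : R) (r : R) : R[i] := (r `^ b)%:C.
have wd (b r : R) : 0 < r -> has_cderive r 1 (w b) (b%:C * w (b - 1) r).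
  move=> r0; rewrite /w -rmorphM; apply: has_cderive_real.
  exact: is_derive1_powR.
have wS (b r : R) : 0 < r -> w b r = r%:C * w (b - 1) r.
  move=> r0; rewrite /w -rmorphM /=; congr (_%:C).
  rewrite -{2}(powRr1 (ltW r0)) -powRD; last by apply/implyP => _; rewrite gt_eqF.
  by congr (_ `^ _); ring.
have w0 (b r : R) : 0 < r -> w b r != 0.
  by move=> r0; rewrite (inj_eq (@complexI R)) gt_eqF // powR_gt0.
have phiE r : phi_of n y r = y r * w (- a) r.
  by rewrite /phi_of /w powRN fmorphV.
pose H1 r := cderive y r * w (- a) r + y r * ((- a)%:C * w (- a - 1) r).
pose H2 r := (cderive (cderive y) r * w (- a) r + cderive y r * ((- a)%:C * w (- a - 1) r))
  + (cderive y r * ((- a)%:C * w (- a - 1) r)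
     + y r * (0 * w (- a - 1) r + (- a)%:C * ((- a - 1)%:C * w (- a - 1 - 1) r))).
apply: (@regular_radial_unique F F1 F2 _ H1 H2) => //.
- move=> r rr; have [r0 _] := andP rr; have [yd _] := Ck1_derive2 yC (interior_oc rr).
  apply: (@has_cderive_near _ _ (fun r => y r * w (- a) r)).
    by near=> x; rewrite phiE.
  by apply: has_cderive_mul; [exact: yd|exact: wd].
- move=> r rr; have [r0 _] := andP rr; have [yd ydd] := Ck1_derive2 yC (interior_oc rr).
  apply: has_cderive_add; apply: has_cderive_mul.
  - exact: ydd.
  - exact: wd.
  - exact: yd.
  - by apply: has_cderive_mul; [exact: has_cderive_const|exact: wd].
- move=> r rr; have [r0 _] := andP rr; have rn0 : r%:C != 0 :> R[i].
    by rewrite (inj_eq (@complexI R)) gt_eqF.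
  have := yode r rr; rewrite -/a => /eqP.
  rewrite -addrA addrC subr_eq0 => /eqP yE.
  rewrite /H2 /H1 phiE -yE (wS (- a) r r0) (wS (- a - 1) r r0).
  have kE : (2 * n + 1)%:R%:C = 2 * a%:C :> R[i].
    rewrite /a -[2 in RHS]/(2%:R) -(rmorph_nat (real_complex R)) -rmorphM /=.
    by congr (_%:C); rewrite natrD natrM; field.
  have nE : ((n%:R - 2^-1) * a / r ^+ 2)%:C = (a%:C - 1) * a%:C / r%:C ^+ 2 :> R[i].
    rewrite rmorphM /= fmorphV rmorphXn /= rmorphM /=; congr (_ * _ / _).
    rewrite -(rmorph1 (real_complex R)) -rmorphB /=; congr (_%:C).
    by rewrite /a; field.
  rewrite kE nE rmorphB rmorphN /= rmorph1.
  by field.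
(* With a = n + 1/2, the derivative of y r^(-a) times r equals a (y' / (a r^(a-1)) - y / r^a), and
   both quotients tend to 1. *)
- have B0 := lim0_add y1l (lim0_opp yl).
  apply: (@lim0_bound _ _ (fun r => (cderive y r / (a * r `^ (n%:R - 2^-1))%:C - 1)
     + - (y r / (r `^ a)%:C - 1)) 1 (normc a%:C)) => //.
  move=> r /andP[r0 _]; rewrite -Normc.normcM; rewrite le_eqVlt; apply/orP; left; apply/eqP; congr normc.
  have rn0 : r%:C != 0 :> R[i] by rewrite (inj_eq (@complexI R)) gt_eqF.
  have an0 : a%:C != 0 :> R[i] by rewrite (inj_eq (@complexI R)) gt_eqF.
  have -> : ((r `^ a)%:C)^-1 = w (- a) r by rewrite /w powRN fmorphV.
  have -> : ((a * r `^ (n%:R - 2^-1))%:C)^-1 = a%:C^-1 * (r%:C * w (- a) r).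
    have -> : - a = (1 - a) - 1 by ring.
    rewrite -wS // rmorphM invfM; congr (_ * _).
    rewrite /w -fmorphV -powRN; congr (_%:C); congr (_ `^ _).
    by rewrite /a; field.
  rewrite /H1 (wS (- a)) // rmorphN.
  by field.
Unshelve. all: by end_near. Qed.

End RadialUniqueness.

Section DarbouxPair.
Context {R : realType} (rho : R) (q f : R -> R[i]).
Hypotheses (rho0 : 0 < rho) (q_C1 : Ck1 1 `[0, rho] q) (f_C2 : Ck1 2 `[0, rho] f)
  (f_neq0 : forall r : R, 0 <= r <= rho -> f r != 0)
  (f_eq : radial_schrodinger rho q f) (f_0 : f 0 = 1).

Definition logder (r : R) : R[i] := cderive f r / f r.
Let g := logder.

Let f_neq (r : R) : 0 < r < rho -> f r != 0.
Proof. by move=> /andP[r0 rr]; rewrite f_neq0 // !ltW. Qed.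

Lemma f_lim1 : lim0 (fun r => f r - 1).
Proof.
by have [[fr _] [fi _]] := f_C2; rewrite -f_0; apply: lim0_sub_cst;
  [exact: (within_right0 rho0 fr)|exact: (within_right0 rho0 fi)].
Qed.

Lemma f_inv_bounded : exists M : R, forall r : R, 0 <= r <= rho -> normc (f r)^-1 <= M.
Proof.
have [[frc _] [fic _]] := f_C2.
pose N (x : R) := (Re (f x) ^+ 2 + Im (f x) ^+ 2)^-1.
have Nn (x : R) : 0 <= x <= rho -> 0 < Re (f x) ^+ 2 + Im (f x) ^+ 2.
  by move=> /f_neq0/sqr_normc_gt0.
have Nc : {within `[0, rho], continuous N}.
  apply/subspace_continuousP => x; rewrite /= in_itv /= => xr; apply: cvgV.
    by rewrite gt_eqF ?Nn.
  have cr := (subspace_continuousP _ _).1 frc x; rewrite /= in_itv /= in cr.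
  have ci := (subspace_continuousP _ _).1 fic x; rewrite /= in_itv /= in ci.
  by apply: cvgD; rewrite !expr2; apply: cvgM; (exact: cr || exact: ci).
have [M M0 NM] := continuous_compact_bounded (@segment_compact _ 0 rho) Nc.
(* [M] bounds the square of the modulus of 1/f, and c^2 <= M with c >= 0 implies c <= M + 1. *)
exists (M + 1) => r rr.
have e : (normc (f r)^-1) ^+ 2 = N r.
  rewrite Normc.normcV exprVn normc_sqr //.
have := NM r; rewrite /= in_itv /= => /(_ rr); rewrite -e ger0_norm ?sqr_ge0 //.
have := normc_ge0 (f r)^-1; move: (normc _) => c c0; rewrite expr2; nra.
Qed.

Lemma logder_bounded : exists M : R, forall r : R, 0 < r < rho -> normc (g r) <= M.
Proof.
have [M _ fM] := Ck1_bounded rho0 f_C2; have [N fN] := f_inv_bounded.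
exists (M * N) => r rr; have [r0 r1] := andP rr.
rewrite Normc.normcM; apply: ler_pM; rewrite ?normc_ge0 //.
  by have [] := fM r rr.
by apply: fN; rewrite !ltW.
Qed.

Let fd (r : R) : 0 < r < rho -> has_cderive r 1 f (cderive f r).
Proof. by move=> rr; have [] := Ck1_derive2 f_C2 (interior_cc rr). Qed.

Let fdd (r : R) : 0 < r < rho -> has_cderive r 1 (cderive f) (cderive (cderive f) r).
Proof. by move=> rr; have [] := Ck1_derive2 f_C2 (interior_cc rr). Qed.

Let rC (r : R) : 0 < r < rho -> r%:C != 0 :> R[i].
Proof. by move=> /andP[r0 _]; rewrite (inj_eq (@complexI R)) gt_eqF. Qed.

Let fddE (r : R) : 0 < r < rho -> cderive (cderive f) r = q r * f r - r%:C^-1 * cderive f r.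
Proof.
move=> rr; have := f_eq rr; rewrite fmorphV => /eqP.
rewrite subr_eq0 => /eqP <-; ring.
Qed.

(** The Riccati form of the radial equation of f. Through it g' is eliminated wherever the Darboux
    transform is differentiated. *)
Lemma logder_derive (r : R) : 0 < r < rho ->
  has_cderive r 1 g (q r - g r / r%:C - g r ^+ 2).
Proof.
move=> rr; apply: has_cderive_eq.
  exact: (has_cderive_mul (fdd rr) (has_cderive_inv (f_neq rr) (fd rr))).
rewrite fddE // /g /logder; have := rC rr; have := f_neq rr.
by move=> ? ?; field; apply/andP.
Qed.

Let q' := darboux q f.

Let q'E r : q' r = 2 * g r ^+ 2 - q r.
Proof. by []. Qed.

Lemma q_bounded : exists M : R, forall r : R, 0 < r < rho -> normc (q r) <= M.
Proof.
have [M qM _] := Ck1_bounded rho0 q_C1; exists M => r /andP[r0 rr].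
by apply: qM; rewrite !ltW.
Qed.

Lemma darboux_bounded : exists M : R, forall r : R, 0 < r < rho -> normc (q' r) <= M.
Proof.
have [M qM] := q_bounded; have [N gN] := logder_bounded.
have sq (z : R[i]) : normc z <= N -> normc (2 * z ^+ 2) <= 2 * N ^+ 2.
  move=> zN; rewrite -(rmorph_nat (real_complex R) 2) expr2 !Normc.normcM normcR.
  rewrite ger0_norm //; apply: ler_wpM2l => //; rewrite expr2.
  by apply: ler_pM; rewrite ?normc_ge0.
exists (2 * N ^+ 2 + M) => r rr; rewrite q'E.
apply: le_trans (ler_normcD _ _) _; rewrite normcN; apply: lerD; last exact: qM.
exact: sq (gN r rr).
Qed.

Lemma q_continuous (r : R) : 0 < r < rho ->
  {for r, continuous (fun x : R => Re (q x))} /\ {for r, continuous (fun x : R => Im (q x))}.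
Proof.
move=> rr; have [M _ qd] := Ck1_bounded rho0 q_C1; have [[qr qi] _] := qd r rr.
by split; [exact: has_derive_cont qr|exact: has_derive_cont qi].
Qed.

Lemma darboux_continuous (r : R) : 0 < r < rho ->
  {for r, continuous (fun x : R => Re (q' x))} /\ {for r, continuous (fun x : R => Im (q' x))}.
Proof.
move=> rr; have [cr ci] := q_continuous rr.
have [g2r g2i] := has_cderive_mul (has_cderive_const 2 r 1)
  (has_cderive_mul (logder_derive rr) (logder_derive rr)).
have E : q' = fun x => 2 * (g x * g x) - q x by apply/funext => x; rewrite q'E expr2.
split.
- have -> : (fun x => Re (q' x)) = (fun x => Re (2 * (g x * g x)) - Re (q x)).
    by apply/funext => x; rewrite E Re_add Re_opp.
  by apply: cvgB => //; exact: (has_derive_cont g2r).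
- have -> : (fun x => Im (q' x)) = (fun x => Im (2 * (g x * g x)) - Im (q x)).
    by apply/funext => x; rewrite E Im_add Im_opp.
  by apply: cvgB => //; exact: (has_derive_cont g2i).
Qed.

(* For n > 0 the function Q below is the Darboux transform of F; for n = 0 the
   regular solutions are f and 1/f. *)
Lemma darboux_pair (n : nat) (F F1 F2 Q Q1 Q2 : R -> R[i]) (K : R) :
  regular_radial rho n q F F1 F2 -> lim0 (fun r => F r - 1) ->
  (forall r : R, 0 < r < rho -> normc (F r) <= K) ->
  regular_radial rho n q' Q Q1 Q2 -> lim0 (fun r => Q r - 1) ->
  forall r : R, 0 < r < rho ->
  [/\ n = 0%N -> F r = f r,
      r%:C * F1 r + n%:R * F r - r%:C * g r * F r = n%:R * Q r &
      r%:C * Q1 r + n%:R * Q r + r%:C * g r * Q r = n%:R * F r].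
Proof.
move=> Freg Fl FK Qreg Ql.
have [Mq qM] := q_bounded; have [Mq' q'M] := darboux_bounded.
have [Mg gM] := logder_bounded.
have [Fd F1d Fode [C FC]] := Freg; have [Qd Q1d Qode _] := Qreg.
have [M _ fM] := Ck1_bounded rho0 f_C2; have [N fN] := f_inv_bounded.
have lift (U W : R -> R[i]) (r : R) a : (forall x : R, 0 < x < rho -> U x = W x) ->
    0 < r < rho -> has_cderive r 1 U a -> has_cderive r 1 W a.
  move=> UW rr; apply: has_cderive_near.
  by apply: filterS (in_oo_near rr) => x; exact: UW.
have [n0|n0] := posnP n.
  have FE : forall r : R, 0 < r < rho -> F r = f r.
    apply: (regular_radial_unique rho0 qM Freg Fl fd fdd _ f_lim1).
      move=> r rr; rewrite fddE // n0 muln0 add0n rmorph1.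
      by have := rC rr => ?; field.
    apply: (@lim0_Or _ _ rho M) => // r rr; rewrite Normc.normcM normcR.
    have [r0 _] := andP rr; rewrite gtr0_norm // mulrC ler_wpM2r ?(ltW r0) //.
    by have [] := fM r rr.
  (* The regular solution for n = 0 and the potential [darboux q f] is 1/f; the Riccati equation for
     g supplies its second derivative. *)
  pose H r := (f r)^-1; pose H1 r := - (g r * H r).
  pose H2 r := - ((q r - g r / r%:C - g r ^+ 2) * H r + g r * H1 r).
  have Hd (r : R) : 0 < r < rho -> has_cderive r 1 H (H1 r).
    move=> rr; apply: has_cderive_eq; first exact: (has_cderive_inv (f_neq rr) (fd rr)).
    by have := f_neq rr => ?; rewrite /H1 /H /g /logder; field.
  have H1d (r : R) : 0 < r < rho -> has_cderive r 1 H1 (H2 r).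
    by move=> rr; apply: has_cderive_opp; apply: has_cderive_mul;
      [exact: logder_derive|exact: Hd].
  have QE : forall r : R, 0 < r < rho -> Q r = H r.
    apply: (regular_radial_unique rho0 q'M Qreg Ql Hd H1d).
    - move=> r rr; rewrite q'E /H2 /H1 n0 muln0 add0n rmorph1.
      by have := rC rr => ?; field.
    - apply: (@lim0_bound _ _ (fun r => f r - 1) rho N) => //; last exact: f_lim1.
      move=> r rr; have [r0 r1] := andP rr.
      have -> : H r - 1 = - (H r * (f r - 1)).
        by have := f_neq rr => ?; rewrite /H; field.
      by rewrite normcN Normc.normcM ler_wpM2r ?normc_ge0 // fN // !ltW.
    - apply: (@lim0_Or _ _ rho (Mg * N)) => // r rr; have [r0 r1] := andP rr.
      rewrite Normc.normcM normcR gtr0_norm // mulrC ler_wpM2r ?(ltW r0) //.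
      rewrite normcN Normc.normcM; apply: ler_pM; rewrite ?normc_ge0 ?gM //.
      by rewrite fN // !ltW.
  move=> r rr.
  have e1 := has_cderive_unique (lift _ _ _ _ FE rr (Fd r rr)) (fd rr).
  have e2 := has_cderive_unique (lift _ _ _ _ QE rr (Qd r rr)) (Hd r rr).
  rewrite n0 !mul0r !addr0 FE // QE // e1 e2 /H1 /H /g /logder.
  by have := f_neq rr => ?; split=> [//||]; field.
have nC : n%:R != 0 :> R[i] by rewrite pnatr_eq0 -lt0n.
(* The first identity of the conclusion, solved for Q, dictates [P]; the second one dictates [P1],
   which is checked to be the derivative of [P]. It remains to identify Q with P by uniqueness. *)
pose P r := F r + n%:R^-1 * (r%:C * (F1 r - g r * F r)).
have PE r : n%:R * P r = n%:R * F r + r%:C * (F1 r - g r * F r).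
  by rewrite /P mulrDr mulVKf.
pose P1 r := - (g r * P r) + n%:R * (r%:C^-1 * (F r - P r)).
have F1E (r : R) : 0 < r < rho -> F1 r = g r * F r + n%:R * (r%:C^-1 * (P r - F r)).
  by move=> rr; have := rC rr => ?; rewrite /P; field; apply/andP.
have kE : (2 * n + 1)%:R%:C = 2 * n%:R + 1 :> R[i] by rewrite rmorph_nat natrD natrM.
have idd (r : R) : has_cderive r 1 (fun x : R => x%:C) (1%:C : R[i]).
  by apply: has_cderive_real; exact: has_derive_ident.
have Pd (r : R) : 0 < r < rho -> has_cderive r 1 P (P1 r).
  move=> rr; have r0 := rC rr; apply: has_cderive_eq.
    apply: has_cderive_add; first exact: Fd.
    apply: has_cderive_mul; first exact: has_cderive_const.
    apply: has_cderive_mul; first exact: idd.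
    apply: has_cderive_sub; first exact: F1d.
    apply: has_cderive_mul; [exact: logder_derive|exact: Fd].
  have F2E : F2 r = q r * F r - (2 * n%:R + 1) * (r%:C^-1 * F1 r).
    apply: (mulfI r0); have := Fode r rr; rewrite kE => /eqP.
    rewrite addr_eq0 => /eqP e; rewrite mulrBr -[r%:C * (q r * F r)]addr0.
    by rewrite -[LHS](subrK (r%:C * (q r * F r))) -mulrBr e; field.
  by rewrite F2E /P1 /P rmorph1; field; apply/andP.
pose P2 r := - ((q r - g r / r%:C - g r ^+ 2) * P r + g r * P1 r) +
   (0 * (r%:C^-1 * (F r - P r)) +
    n%:R * (- (1%:C) / r%:C ^+ 2 * (F r - P r) + r%:C^-1 * (F1 r - P1 r))).
have P1d (r : R) : 0 < r < rho -> has_cderive r 1 P1 (P2 r).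
  move=> rr; apply: has_cderive_add.
    apply: has_cderive_opp; apply: has_cderive_mul; [exact: logder_derive|exact: Pd].
  apply: has_cderive_mul; first exact: has_cderive_const.
  apply: has_cderive_mul; last by apply: has_cderive_sub; [exact: Fd|exact: Pd].
  by apply: has_cderive_inv => //; exact: rC.
have rho2 : 0 < rho / 2 < rho.
  by rewrite divr_gt0 //= ltr_pdivrMr // ltr_pMr // ltr1n.
have K0 : 0 <= K := le_trans (normc_ge0 _) (FK _ rho2).
have Mg0 : 0 <= Mg := le_trans (normc_ge0 _) (gM _ rho2).
pose B := C * rho + Mg * K.
have dB (r : R) : 0 < r < rho -> normc (F1 r - g r * F r) <= B.
  move=> rr; apply: le_trans (ler_normcD _ _) _; rewrite normcN Normc.normcM.
  apply: lerD; last by apply: ler_pM; rewrite ?normc_ge0 ?gM ?FK.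
  have [r0 r1] := andP rr; have Fr := FC r rr; apply: (le_trans Fr).
  rewrite ler_wpM2l ?(ltW r1) // -(pmulr_lge0 _ r0).
  by apply: le_trans Fr; exact: normc_ge0.
(* F' and g F are bounded, so P - F is O(r) and P inherits the limit 1 at 0. *)
have PF (r : R) : 0 < r < rho -> normc (P r - F r) <= normc (n%:R^-1 : R[i]) * B * r.
  move=> rr; have [r0 _] := andP rr.
  rewrite /P addrAC subrr add0r Normc.normcM -mulrA ler_wpM2l ?normc_ge0 //.
  by rewrite Normc.normcM normcR gtr0_norm // mulrC ler_wpM2r ?(ltW r0) ?dB.
have Pl : lim0 (fun r => P r - 1).
  have := lim0_add (lim0_Or rho0 PF) Fl; rewrite /lim0.
  rewrite (_ : (fun r => _) = fun r => normc (P r - 1)) //.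
  by apply/funext => r; congr normc; ring.
have P1l : lim0 (fun r => r%:C * P1 r).
  have l1 : lim0 (fun r => - (r%:C * (F1 r - g r * F r))).
    apply: lim0_opp; apply: (@lim0_Or _ _ rho B) => // r rr; have [r0 _] := andP rr.
    by rewrite Normc.normcM normcR gtr0_norm // mulrC ler_wpM2r ?(ltW r0) ?dB.
  have l2 : lim0 (fun r => - (r%:C * (g r * P r))).
    apply: lim0_opp.
    apply: (@lim0_Or _ _ rho (Mg * (normc (n%:R^-1 : R[i]) * B * rho + K))) => // r rr.
    have [r0 r1] := andP rr; rewrite Normc.normcM normcR gtr0_norm // mulrC.
    rewrite ler_wpM2r ?(ltW r0) // Normc.normcM.
    apply: ler_pM; rewrite ?normc_ge0 ?gM //.
    have -> : P r = (P r - F r) + F r by rewrite subrK.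
    apply: le_trans (ler_normcD _ _) _; apply: lerD; last exact: FK.
    apply: le_trans (PF r rr) _; rewrite ler_wpM2l ?(ltW r1) //.
    rewrite mulr_ge0 ?normc_ge0 //.
    by apply: le_trans (dB r rr); exact: normc_ge0.
  (* Since n (F - P) = - r (F' - g F), the product r P' splits into two terms of order r. *)
  apply: (@lim0_bound _ _ (fun r => - (r%:C * (g r * P r)) +
       - (r%:C * (F1 r - g r * F r))) rho 1) => //; last exact: lim0_add.
  move=> r rr; rewrite mul1r; rewrite le_eqVlt; apply/orP; left; apply/eqP; congr normc.
  by have := rC rr => ?; rewrite /P1 /P; field; apply/andP.
have QE : forall r : R, 0 < r < rho -> Q r = P r.
  apply: (regular_radial_unique rho0 q'M Qreg Ql Pd P1d _ Pl P1l) => r rr.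
  rewrite q'E kE /P2 (F1E r rr) /P1 rmorph1.
  by have := rC rr => ?; field.
move=> r rr.
have e2 := has_cderive_unique (lift _ _ _ _ QE rr (Qd r rr)) (Pd r rr).
rewrite QE // e2; split; [by move=> n0'; rewrite n0' in n0|by rewrite PE; ring|].
by have := rC rr => ?; rewrite /P1; field.
Qed.

End DarbouxPair.

(** * The Vekua equation in the plane *)

Section Plane.
Context {R : realType}.
Implicit Types (z : R * R) (w : R * R -> R).

Definition cx z : R[i] := z.1 +i* z.2.

Lemma cmodE z : cmod z = Num.sqrt (z.1 ^+ 2 + z.2 ^+ 2).
Proof. by []. Qed.

Lemma cmod_ge0 z : 0 <= cmod z.
Proof. exact: normc_ge0. Qed.

Lemma sqr_cmod z : cmod z ^+ 2 = z.1 ^+ 2 + z.2 ^+ 2.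
Proof. exact: (normc_sqr (cx z)). Qed.

Lemma cmod0 : cmod ((0, 0) : R * R) = 0.
Proof. by rewrite cmodE /= expr0n /= addr0 sqrtr0. Qed.

Lemma cmod_eq0 z : (cmod z == 0) = (z == (0, 0)).
Proof.
rewrite /cmod normc_eq0; apply/eqP/eqP => [[z1 z2]|->] //.
by rewrite [z]surjective_pairing z1 z2.
Qed.

Lemma fst_continuous : continuous (fun z : R * R => z.1).
Proof. by move=> z; exact: cvg_fst. Qed.

Lemma snd_continuous : continuous (fun z : R * R => z.2).
Proof. by move=> z; exact: cvg_snd. Qed.

Lemma cmod_continuous : continuous (@cmod R).
Proof.
have c : continuous (fun z : R * R => z.1 ^+ 2 + z.2 ^+ 2).
  by move=> z; apply: cvgD; rewrite expr2; apply: cvgM;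
    (exact: fst_continuous || exact: snd_continuous).
by move=> z; apply: (continuous_comp (c z)); exact: sqrt_continuous.
Qed.

Lemma disk_near (rho : R) z : disk rho z -> \forall p \near z, disk rho p.
Proof. by move=> zr; apply: (cvgr_lt _ (@cmod_continuous z)). Qed.

Lemma disk_open (rho : R) : open (disk rho).
Proof. by rewrite openE => z zr; exact: disk_near. Qed.

Lemma fst_derive z : has_derive z dirx (fun p : R * R => p.1) 1 /\
  has_derive z diry (fun p : R * R => p.1) 0.
Proof.
case: z => x y; split.
- by apply: (has_derive_dirx _ _ _ _).2; exact: has_derive_ident.
- by apply: (has_derive_diry _ _ _ _).2; exact: has_derive_const.
Qed.

Lemma snd_derive z : has_derive z dirx (fun p : R * R => p.2) 0 /\
  has_derive z diry (fun p : R * R => p.2) 1.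
Proof.
case: z => x y; split.
- by apply: (has_derive_dirx _ _ _ _).2; exact: has_derive_const.
- by apply: (has_derive_diry _ _ _ _).2; exact: has_derive_ident.
Qed.

Lemma has_derive_caratheodory (f : R -> R) (x a : R) : has_derive x 1 f a <->
  exists g, [/\ forall t, f t - f x = g t * (t - x), {for x, continuous g} & g x = a].
Proof. exact: is_derive1_caratheodory. Qed.

Lemma MVT_ball (f df : R -> R) (x d t : R) :
  (forall s, `|s - x| < d -> has_derive s 1 f (df s)) -> `|t - x| < d ->
  exists2 c, `|c - x| < d & f t - f x = df c * (t - x).
Proof.
move=> fd; rewrite ltr_norml => /andP[t1 t2].
have [tx|xt|->] := ltgtP t x; last first.
- exists x; first by rewrite subrr normr0; lra.
  by rewrite !subrr mulr0.
- have sub s : x <= s <= t -> has_derive s 1 f (df s).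
    by move=> /andP[s1 s2]; apply: fd; rewrite ltr_norml; apply/andP; split; lra.
  have [|c] := @MVT _ f df x t xt _ (derive_cc_cont sub).
    by move=> s; rewrite in_itv /= => /andP[s1 s2]; apply: sub; rewrite !ltW.
  rewrite in_itv /= => /andP[c1 c2] ->; exists c => //.
  by rewrite ltr_norml; apply/andP; split; lra.
- have sub s : t <= s <= x -> has_derive s 1 f (df s).
    by move=> /andP[s1 s2]; apply: fd; rewrite ltr_norml; apply/andP; split; lra.
  have [|c] := @MVT _ f df t x tx _ (derive_cc_cont sub).
    by move=> s; rewrite in_itv /= => /andP[s1 s2]; apply: sub; rewrite !ltW.
  rewrite in_itv /= => /andP[c1 c2] e; exists c.
    by rewrite ltr_norml; apply/andP; split; lra.
  by rewrite -opprB e; ring.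
Qed.

(** A Caratheodory form of differentiability in the plane. [P] is the difference quotient along x at
    the height of the moving point, continuous at the base point by the mean value theorem and the
    continuity of [wx]. The other factor lives on the vertical line through x, where one derivative
    at y suffices. *)
Lemma C1_increment w wx wy (x y : R) :
  (\forall p \near (x, y), has_derive p dirx w (wx p)) ->
  has_derive (x, y) diry w (wy (x, y)) ->
  {for (x, y), continuous wx} ->
  exists P Q : R * R -> R,
  [/\ forall p, w p - w (x, y) = P p * (p.1 - x) + Q p * (p.2 - y),
      {for (x, y), continuous P} /\ P (x, y) = wx (x, y) &
      {for (x, y), continuous Q} /\ Q (x, y) = wy (x, y)].
Proof.
move=> wd /has_derive_diry/has_derive_caratheodory[g [gE gc gx]] wxc.
pose P (p : R * R) := if p.1 == x then wx (x, y)
                      else (w p - w (x, p.2)) / (p.1 - x).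
have Px : P (x, y) = wx (x, y) by rewrite /P eqxx.
exists P, (fun p => g p.2); split.
- move=> [a b] /=; rewrite -gE /P /=; case: eqP => [->|/eqP ax].
    by rewrite subrr mulr0 add0r.
  by rewrite divfK ?subr_eq0 // subrKA.
- split => //; apply/cvgrPdist_lt => e e0.
  have /cvgrPdist_lt/(_ _ e0)/nbhs_ballP[d1 /= d10 H1] := wxc.
  have /nbhs_ballP[d2 /= d20 H2] := wd.
  have d0 : 0 < Num.min d1 d2 by rewrite lt_min d10.
  apply: filterS (nbhsx_ballx (x, y) _ d0) => -[a b] [/=]; rewrite /ball /= !lt_min => /andP[a1 a2] /andP[b1 b2].
  rewrite Px /P /=; case: eqP => [_|/eqP ax]; first by rewrite subrr normr0.
  have [||c cx cE] := @MVT_ball (fun s => w (s, b)) (fun s => wx (s, b)) x (Num.min d1 d2) a.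
  + move=> s; rewrite lt_min => /andP[s1 s2]; apply: (has_derive_dirx _ _ _ _).1.
    by apply: H2; split; [rewrite /ball /= distrC|exact: b2].
  + by rewrite lt_min distrC a1 a2.
  move: cx; rewrite lt_min => /andP[c1 c2].
  rewrite cE mulfK ?subr_eq0 //; apply: H1.
  by split; [rewrite /ball /= distrC|exact: b1].
- split=> //; apply: (continuous_comp (@snd_continuous (x, y))); exact: gc.
Qed.

(** Substituting the Caratheodory factors of the curves into the increment formula exhibits the
    factor of the composite, so no estimate is required. *)
Lemma C1_chain w wx wy (a b : R -> R) (a' b' t : R) :
  (\forall p \near (a t, b t), has_derive p dirx w (wx p)) ->
  has_derive (a t, b t) diry w (wy (a t, b t)) ->
  {for (a t, b t), continuous wx} ->
  has_derive t 1 a a' -> has_derive t 1 b b' ->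
  has_derive t 1 (fun s => w (a s, b s)) (wx (a t, b t) * a' + wy (a t, b t) * b').
Proof.
move=> wd wyd wxc ad bd.
have [P [Q [E [Pc Pe] [Qc Qe]]]] := C1_increment wd wyd wxc.
have [A [AE Ac Ax]] := (has_derive_caratheodory _ _ _).1 ad.
have [B [BE Bc Bx]] := (has_derive_caratheodory _ _ _).1 bd.
apply: (has_derive_caratheodory _ _ _).2.
have ac := has_derive_cont ad; have bc := has_derive_cont bd.
have comp (T : R * R -> R) : {for (a t, b t), continuous T} ->
    {for t, continuous (fun s => T (a s, b s))}.
  move=> Tc; apply: (@continuous_comp _ _ _ (fun s => (a s, b s)) T t) => //.
  exact: (cvg_pair ac bc).
exists (fun s => P (a s, b s) * A s + Q (a s, b s) * B s); split.
- by move=> s; rewrite E /= AE BE; ring.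
- by apply: cvgD; apply: cvgM; [exact: comp|exact: Ac|exact: comp|exact: Bc].
- by rewrite Pe Qe Ax Bx.
Qed.

Definition ccont_at (T : topologicalType) (z : T) (F : T -> R[i]) :=
  {for z, continuous (fun p => Re (F p))} /\ {for z, continuous (fun p => Im (F p))}.

Section ccont.
Context {T : topologicalType}.
Implicit Types (F G : T -> R[i]) (p : T).

Lemma ccont_add F G p : ccont_at p F -> ccont_at p G -> ccont_at p (fun s => F s + G s).
Proof.
move=> [Fr Fi] [Gr Gi]; split.
- have -> : (fun s => Re (F s + G s)) = (fun s => Re (F s) + Re (G s)).
    by apply/funext => s; rewrite !ReImE.
  exact: cvgD.
- have -> : (fun s => Im (F s + G s)) = (fun s => Im (F s) + Im (G s)).
    by apply/funext => s; rewrite !ReImE.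
  exact: cvgD.
Qed.

Lemma ccont_mul F G p : ccont_at p F -> ccont_at p G -> ccont_at p (fun s => F s * G s).
Proof.
move=> [Fr Fi] [Gr Gi]; split.
- have -> : (fun s => Re (F s * G s)) =
      (fun s => Re (F s) * Re (G s) - Im (F s) * Im (G s)).
    by apply/funext => s; rewrite !ReImE.
  by apply: cvgB; apply: cvgM; (exact: Fr || exact: Gr || exact: Fi || exact: Gi).
- have -> : (fun s => Im (F s * G s)) =
      (fun s => Re (F s) * Im (G s) + Im (F s) * Re (G s)).
    by apply/funext => s; rewrite !ReImE.
  by apply: cvgD; apply: cvgM; (exact: Fr || exact: Gr || exact: Fi || exact: Gi).
Qed.

Lemma ccont_const (c : R[i]) p : ccont_at p (fun=> c).
Proof. by split; exact: cvg_cst. Qed.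

Lemma ccont_real (f : T -> R) p : {for p, continuous f} -> ccont_at p (fun s => (f s)%:C).
Proof. by move=> fc; split => //; exact: cvg_cst. Qed.

Lemma ccont_near F G p : (\forall s \near p, F s = G s) -> ccont_at p F -> ccont_at p G.
Proof.
move=> FG [Fr Fi]; have FGp : F p = G p := nbhs_singleton FG.
have aux (h : R[i] -> R) : {for p, continuous (fun s => h (F s))} ->
    {for p, continuous (fun s => h (G s))}.
  rewrite /prop_for /continuous_at -FGp; apply: cvg_trans; apply: near_eq_cvg.
  by apply: filterS FG => s ->.
by split; apply: aux.
Qed.

End ccont.

Lemma cderive_ccont (F : R -> R[i]) (x : R) a : has_cderive x 1 F a -> ccont_at x F.
Proof. by move=> [Fr Fi]; split; [exact: has_derive_cont Fr|exact: has_derive_cont Fi]. Qed.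

Lemma ccont_comp (T U : topologicalType) (F : U -> R[i]) (k : T -> U) p :
  {for p, continuous k} -> ccont_at (k p) F -> ccont_at p (fun s => F (k s)).
Proof.
by move=> kc [Fr Fi]; split;
  [exact: (@continuous_comp _ _ _ k (fun s => Re (F s)) p)
  |exact: (@continuous_comp _ _ _ k (fun s => Im (F s)) p)].
Qed.

Lemma cx_continuous z : ccont_at z cx.
Proof. by split; [exact: fst_continuous|exact: snd_continuous]. Qed.

Lemma pow_ccont (k : R[i]) n z : ccont_at z (fun p => k * cx p ^+ n).
Proof.
apply: ccont_mul; first exact: ccont_const.
elim: n => [|n IH]; first exact: (ccont_const 1).
under eq_fun do rewrite exprS.
by apply: ccont_mul; [exact: cx_continuous|exact: IH].
Qed.

Lemma cx_derive z : has_cderive z dirx cx 1 /\ has_cderive z diry cx 'i.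
Proof.
have [x1 x2] := fst_derive z; have [y1 y2] := snd_derive z.
by split; split; [exact: x1|exact: y1|exact: x2|exact: y2].
Qed.

Lemma pow_derive (k : R[i]) n z :
  has_cderive z dirx (fun p => k * cx p ^+ n) (k * (n%:R * cx z ^+ n.-1)) /\
  has_cderive z diry (fun p => k * cx p ^+ n) (k * (n%:R * cx z ^+ n.-1 * 'i)).
Proof.
have [dx dy] := cx_derive z.
have aux v a : has_cderive z v cx a ->
    has_cderive z v (fun p => cx p ^+ n) (n%:R * cx z ^+ n.-1 * a).
  move=> d; elim: n => [|n IH].
    by rewrite !mul0r; exact: (has_cderive_const 1).
  under [X in has_cderive _ _ X]eq_fun do rewrite exprS.
  apply: has_cderive_eq; first exact: (has_cderive_mul d IH).
  rewrite /= -natr1; case: n {IH} => [|n] /=; first by rewrite !mul0r expr0; ring.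
  by rewrite exprS; ring.
split; apply: has_cderive_eq.
- exact: (has_cderive_mul (has_cderive_const k z dirx) (aux _ _ dx)).
- by rewrite mul0r add0r mulr1.
- exact: (has_cderive_mul (has_cderive_const k z diry) (aux _ _ dy)).
- by rewrite mul0r add0r.
Qed.

Lemma cmod_derive z : cmod z != 0 ->
  has_derive z dirx (@cmod R) (z.1 / cmod z) /\ has_derive z diry (@cmod R) (z.2 / cmod z).
Proof.
move=> z0; have z2 : 0 < z.1 ^+ 2 + z.2 ^+ 2.
  by rewrite -sqr_cmod exprn_gt0 // lt_def z0 cmod_ge0.
have [x1 x2] := fst_derive z; have [y1 y2] := snd_derive z.
have sq : has_derive (z.1 * z.1 + z.2 * z.2) 1 (@Num.sqrt R) (2 * cmod z)^-1.
  rewrite cmodE -!expr2; exact: is_derive1_sqrt.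
have E : @cmod R = fun p => Num.sqrt (p.1 * p.1 + p.2 * p.2).
  by apply/funext => p; rewrite cmodE !expr2.
have dx := has_derive_chain (f := fun p : R * R => p.1 * p.1 + p.2 * p.2)
  (has_derive_add (has_derive_mul x1 x1) (has_derive_mul y1 y1)) sq.
have dy := has_derive_chain (f := fun p : R * R => p.1 * p.1 + p.2 * p.2)
  (has_derive_add (has_derive_mul x2 x2) (has_derive_mul y2 y2)) sq.
rewrite -E in dx dy.
by split; [apply: (has_derive_val dx)|apply: (has_derive_val dy)]; field.
Qed.

End Plane.

(** * Radial factors times powers of z, and their Vekua equation *)

Section RadialElements.
Context {R : realType}.
Implicit Types (z : R * R) (F Q : R -> R[i]) (k : R[i]).

(** What makes [radial F] of class C^1 on the disk, origin included: the bound F' = O(r) compensates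
    the missing limit of z/|z| at 0. The representative [F0], continuous on the whole line, serves
    the integrals. *)
Definition radial_profile (rho : R) F (F1 : R -> R[i]) : Prop :=
  [/\ exists2 F0, ccontinuous F0 & forall r : R, 0 <= r <= rho -> F r = F0 r,
      F 0 = 1,
      forall r : R, 0 < r < rho -> has_cderive r 1 F (F1 r),
      forall r : R, 0 < r < rho -> ccont_at r F1 &
      exists C : R, forall r : R, 0 < r < rho -> normc (F1 r) <= C * r].

Definition radial_dx (F1 : R -> R[i]) z : R[i] := F1 (cmod z) * (z.1 / cmod z)%:C.
Definition radial_dy (F1 : R -> R[i]) z : R[i] := F1 (cmod z) * (z.2 / cmod z)%:C.

Lemma ler_fst_cmod z : `|z.1| <= cmod z.
Proof. exact: (ler_Re_normc (cx z)). Qed.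

Lemma ler_snd_cmod z : `|z.2| <= cmod z.
Proof. exact: (ler_Im_normc (cx z)). Qed.

(** The Caratheodory factor (h t - h 0)/t is at most |C| |t|; at t = 0 division by 0 gives 0, which
    is the value required there. *)
Lemma quadratic_derive0 (h : R -> R) (d C : R) : 0 < d ->
  (forall t, `|t| < d -> `|h t - h 0| <= C * t ^+ 2) -> has_derive (0 : R) 1 h 0.
Proof.
move=> d0 hC; apply: (has_derive_caratheodory _ _ _).2.
exists (fun t => (h t - h 0) / t); split; last by rewrite invr0 mulr0.
- move=> t; rewrite subr0; have [->|t0] := eqVneq t 0; first by rewrite subrr mulr0.
  by rewrite divfK.
- rewrite /prop_for /continuous_at subrr mul0r.
  apply/cvgr0Pnorm_lt => e e0.
  have ee : 0 < e / (`|C| + 1) by rewrite divr_gt0 // ltr_wpDl.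
  near=> t; have [->|t0] := eqVneq t 0; first by rewrite subrr mul0r normr0.
  have C0 : 0 <= `|C| := normr_ge0 C.
  have td : `|t| < d by near: t; apply: filterS (nbhsx_ballx (0 : R) d d0) => x;
    rewrite /ball /= sub0r normrN.
  have te : `|t| < e / (`|C| + 1) by near: t;
    apply: filterS (nbhsx_ballx (0 : R) _ ee) => x; rewrite /ball /= sub0r normrN.
  rewrite normrM normfV ltr_pdivrMr ?normr_gt0 //.
  apply: le_lt_trans (hC t td) _.
  rewrite -[t ^+ 2]ger0_norm ?sqr_ge0 // normrX expr2 mulrA.
  rewrite ltr_pM2r ?normr_gt0 //; move: te; rewrite ltr_pdivlMr ?ltr_wpDl // => te.
  have := ler_norm C; have := normr_ge0 t; nra.
Unshelve. all: by end_near. Qed.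

Section Profile.
Context (rho : R) (F F1 : R -> R[i]).
Hypotheses (rho0 : 0 < rho) (FP : radial_profile rho F F1).

(** Integrates F' = O(r) from the value F(0) = 1. The quadratic order is what gives [radial F] a
    zero gradient at the origin. *)
Lemma profile_quadratic : exists C : R, forall r : R, 0 <= r < rho ->
  `|Re (F r) - 1| <= C * r ^+ 2 /\ `|Im (F r)| <= C * r ^+ 2.
Proof.
have [[F0 [F0r F0i] FE] F01 Fd _ [C FC]] := FP; exists `|C| => r /andP[r0 rr].
move: r0; rewrite le_eqVlt => /predU1P[<-|r0].
  by rewrite F01 /= subrr normr0 expr0n /= mulr0.
have rr' : 0 < r < rho by rewrite r0.
have bnd (x : R) : 0 < x < rho -> normc (F1 x) <= `|C| * x ^+ 1.
  move=> xr; have [x0 _] := andP xr; apply: le_trans (FC x xr) _.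
  by rewrite expr1 ler_wpM2r ?ler_norm // ltW.
have near0 (p : R[i] -> R) : continuous (fun r => p (F0 r)) ->
    p (F x) @[x --> 0^'+] --> p (F 0).
  move=> pc; have -> : p (F 0) = p (F0 0) by rewrite FE ?lexx ?ltW.
  have /cvg_at_right_filter := pc 0; apply: cvg_trans; apply: near_eq_cvg.
  near=> x; rewrite FE //; apply/andP; split; near: x.
    by apply: filterS (nbhs_right_gt 0) => x /ltW.
  by apply: filterS (nbhs_right_lt rho0) => x /ltW.
have pr : Re (F x) - 1 @[x --> 0^'+] --> 0.
  have := near0 Re F0r; rewrite F01 /= => h.
  by rewrite -[X in _ --> X](subrr 1); apply: cvgB => //; exact: cvg_cst.
have pi : Im (F x) @[x --> 0^'+] --> 0 by have := near0 Im F0i; rewrite F01.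
split.
- apply: (@integrate_power_bound _ (fun x => Re (F x) - 1) (fun x => Re (F1 x) - 0)
    rho `|C| 1) => // x xr.
    by apply: has_derive_sub; [exact: (Fd x xr).1|exact: has_derive_const].
  by rewrite subr0; apply: le_trans (ler_Re_normc _) (bnd x xr).
- apply: (@integrate_power_bound _ (fun x => Im (F x)) (fun x => Im (F1 x))
    rho `|C| 1) => // x xr; first exact: (Fd x xr).2.
  by apply: le_trans (ler_Im_normc _) (bnd x xr).
Unshelve. all: by end_near. Qed.

Lemma radial_derive0 : has_cderive (0, 0) dirx (radial F) 0 /\
  has_cderive (0, 0) diry (radial F) 0.
Proof.
have [C FC] := profile_quadratic; have F01 : F 0 = 1 by case: FP.
have [e1 e2] : (forall t : R, cmod (t, 0) = `|t|) /\ (forall t : R, cmod (0, t) = `|t|).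
  by split => t; rewrite cmodE /= expr0n /= ?addr0 ?add0r sqrtr_sqr.
have Cr (t : R) : `|t| < rho -> `|Re (F `|t|) - Re (F `|0 : R|)| <= C * t ^+ 2.
  move=> tr; rewrite normr0 F01 /= -[t ^+ 2]ger0_norm ?sqr_ge0 // normrX.
  by apply: (FC _ _).1; rewrite normr_ge0.
have Ci (t : R) : `|t| < rho -> `|Im (F `|t|) - Im (F `|0 : R|)| <= C * t ^+ 2.
  move=> tr; rewrite normr0 F01 /= subr0 -[t ^+ 2]ger0_norm ?sqr_ge0 // normrX.
  by apply: (FC _ _).2; rewrite normr_ge0.
split; split.
- apply: (has_derive_dirx _ _ _ _).2; rewrite /radial /=; under eq_fun do rewrite e1.
  exact: (@quadratic_derive0 (fun t : R => Re (F `|t|)) rho C rho0 Cr).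
- apply: (has_derive_dirx _ _ _ _).2; rewrite /radial /=; under eq_fun do rewrite e1.
  exact: (@quadratic_derive0 (fun t : R => Im (F `|t|)) rho C rho0 Ci).
- apply: (has_derive_diry _ _ _ _).2; rewrite /radial /=; under eq_fun do rewrite e2.
  exact: (@quadratic_derive0 (fun t : R => Re (F `|t|)) rho C rho0 Cr).
- apply: (has_derive_diry _ _ _ _).2; rewrite /radial /=; under eq_fun do rewrite e2.
  exact: (@quadratic_derive0 (fun t : R => Im (F `|t|)) rho C rho0 Ci).
Qed.

Lemma radial_derive z : disk rho z ->
  has_cderive z dirx (radial F) (radial_dx F1 z) /\
  has_cderive z diry (radial F) (radial_dy F1 z).
Proof.
move=> zr; have [z0|z0] := eqVneq (cmod z) 0.
  have -> : z = (0, 0) by apply/eqP; rewrite -cmod_eq0 z0.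
  by rewrite /radial_dx /radial_dy /= !mul0r !mulr0; exact: radial_derive0.
have [_ _ Fd _ _] := FP; have [dx dy] := cmod_derive z0.
have zz : 0 < cmod z < rho by rewrite lt_def z0 cmod_ge0.
by split; [exact: (has_cderive_chain dx (Fd _ zz))|exact: (has_cderive_chain dy (Fd _ zz))].
Qed.

Lemma radial_ccont z : disk rho z -> ccont_at z (radial F).
Proof.
have [[F0 F0c FE] _ _ _ _] := FP; move=> zr.
apply: (@ccont_near _ _ (fun p : R * R => F0 (cmod p))).
  apply: filterS (disk_near zr) => p pr.
  by rewrite /radial FE // cmod_ge0 /= ltW.
apply: (ccont_comp (F := F0)); first exact: cmod_continuous.
by split; [exact: F0c.1|exact: F0c.2].
Qed.

(** Away from the origin each factor is continuous. At the origin p z / |z| need not converge, but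
    it is bounded by 1 and F' = O(|z|) forces the product to 0. *)
Let radial_grad_ccont (p : R * R -> R) z : continuous p ->
  (forall z, `|p z| <= cmod z) -> disk rho z ->
  ccont_at z (fun z => F1 (cmod z) * (p z / cmod z)%:C).
Proof.
move=> pc pz zr; have [_ _ _ F1c [C FC]] := FP.
have [z0|z0] := eqVneq (cmod z) 0; last first.
  have zz : 0 < cmod z < rho by rewrite lt_def z0 cmod_ge0.
  apply: ccont_mul.
    by apply: (ccont_comp (F := F1)); [exact: cmod_continuous|exact: F1c].
  apply: ccont_real; apply: cvgM; first exact: pc.
  by apply: cvgV => //; exact: cmod_continuous.
have B (s : R * R) : disk rho s ->
    normc (F1 (cmod s) * (p s / cmod s)%:C) <= `|C| * cmod s.
  move=> sr; have [s0|s0] := eqVneq (cmod s) 0.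
    by rewrite s0 invr0 !mulr0 Normc.normc0.
  have sz : 0 < cmod s by rewrite lt_def s0 cmod_ge0.
  rewrite Normc.normcM normcR -[leRHS]mulr1; apply: ler_pM; rewrite ?normc_ge0 //.
    apply: le_trans (FC _ _) _; first by rewrite sz.
    by rewrite ler_wpM2r ?ler_norm // ltW.
  by rewrite normrM normfV (gtr0_norm sz) ler_pdivrMr // mul1r.
have lim (h : R[i] -> R) : (forall a, `|h a| <= normc a) ->
    {for z, continuous (fun s => h (F1 (cmod s) * (p s / cmod s)%:C))}.
  move=> hn; have h0 : h 0 = 0.
    by apply/eqP; rewrite -normr_le0; apply: le_trans (hn 0) _; rewrite Normc.normc0.
  rewrite /prop_for /continuous_at z0 invr0 !mulr0 h0.
  have cl : `|C| * cmod s @[s --> z] --> 0.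
    rewrite -[X in _ --> X](mulr0 `|C|) -z0; apply: cvgMr.
    exact: cmod_continuous.
  apply/cvgr0Pnorm_lt => e e0; near=> s.
  apply: le_lt_trans (hn _) _; apply: le_lt_trans (B s _) _.
    by near: s; exact: disk_near.
  apply: le_lt_trans (ler_norm _) _; near: s.
  by have /cvgr0Pnorm_lt/(_ _ e0) := cl.
by split; apply: lim => a; [exact: ler_Re_normc|exact: ler_Im_normc].
Unshelve. all: by end_near. Qed.

Lemma radial_dx_ccont z : disk rho z -> ccont_at z (radial_dx F1).
Proof. exact: (radial_grad_ccont fst_continuous ler_fst_cmod). Qed.

Lemma radial_dy_ccont z : disk rho z -> ccont_at z (radial_dy F1).
Proof. exact: (radial_grad_ccont snd_continuous ler_snd_cmod). Qed.

End Profile.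

Lemma C1_Ck2 (A : set (R * R)) (U Ux Uy : R * R -> R[i]) : open A ->
  (forall z, A z -> ccont_at z U /\
    (has_cderive z dirx U (Ux z) /\ ccont_at z Ux) /\
    (has_cderive z diry U (Uy z) /\ ccont_at z Uy)) ->
  Ck2 1 A U.
Proof.
move=> oA H.
have aux (u ux uy : R * R -> R) :
    (forall z, A z -> {for z, continuous u} /\
      (has_derive z dirx u (ux z) /\ {for z, continuous ux}) /\
      (has_derive z diry u (uy z) /\ {for z, continuous uy})) ->
    realCk [:: dirx; diry] 1 A u.
  move=> h; have sub p : A° p -> A p by apply: interior_subset.
  have inA (v : R * R -> R) : (forall z, A z -> {for z, continuous v}) ->
      {within A, continuous v}.
    by move=> vc; apply: continuous_in_subspaceT => z; rewrite inE => /vc.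
  have uc : {within A, continuous u} by apply: inA => z /h[].
  split=> //; split; first by exists u.
  move=> v; rewrite !inE => /orP[/eqP ->|/eqP ->].
  - split; first by move=> p /sub/h[_ [[[]]]].
    split=> //; exists ux; first by apply: inA => z /h[_ [[]]].
    by move=> p /sub/h[_ [[[_ ->]]]].
  - split; first by move=> p /sub/h[_ [_ [[]]]].
    split=> //; exists uy; first by apply: inA => z /h[_ [_ []]].
    by move=> p /sub/h[_ [_ [[_ ->]]]].
split; [apply: (aux _ (fun z => Re (Ux z)) (fun z => Re (Uy z)))
       |apply: (aux _ (fun z => Im (Ux z)) (fun z => Im (Uy z)))];
  move=> z /H[[c1 c2] [[[d1 d2] [e1 e2]] [[d3 d4] [e3 e4]]]]; split;
  [exact: c1|split; split; [exact: d1|exact: e1|exact: d3|exact: e3]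
  |exact: c2|split; split; [exact: d2|exact: e2|exact: d4|exact: e4]].
Qed.

Lemma has_cderive_cpartial (U : R * R -> R[i]) z v a :
  has_cderive z v U a -> cpartial v U z = a.
Proof. by move=> [[_ e1] [_ e2]]; rewrite /cpartial e1 e2; case: a {e1 e2}. Qed.

Lemma bicomplexM (W V : bicomplex R) :
  W * V = mkB (Sc W * Sc V - Vec W * Vec V) (Sc W * Vec V + Vec W * Sc V).
Proof. by case: W V => [? ?] [? ?]. Qed.

Lemma bicomplexZ k (W : bicomplex R) : k *: W = mkB (k * Sc W) (k * Vec W).
Proof. by case: W. Qed.

Lemma dbarE (W : R * R -> bicomplex R) z Ux Uy Vx Vy :
  has_cderive z dirx (fun p => Sc (W p)) Ux -> has_cderive z diry (fun p => Sc (W p)) Uy ->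
  has_cderive z dirx (fun p => Vec (W p)) Vx -> has_cderive z diry (fun p => Vec (W p)) Vy ->
  dbar W z = mkB (2^-1 * (Ux - Vy)) (2^-1 * (Uy + Vx)).
Proof.
move=> e1 e2 e3 e4; rewrite /dbar /bpartial !(has_cderive_cpartial e1, has_cderive_cpartial e2,
  has_cderive_cpartial e3, has_cderive_cpartial e4).
rewrite bicomplexM bicomplexZ /jB /mkB /=; congr (Complex _ _); rewrite /Sc /Vec /=; ring.
Qed.

(** Separates the Bicomplex equation into its Sc and Vec components and cancels the factor 1/2
    present in both [dbar]. All later work uses this pair of complex equations. *)
Lemma vekuaP (f : R -> R[i]) (W : R * R -> bicomplex R) z Ux Uy Vx Vy fx fy :
  has_cderive z dirx (fun p => Sc (W p)) Ux -> has_cderive z diry (fun p => Sc (W p)) Uy ->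
  has_cderive z dirx (fun p => Vec (W p)) Vx -> has_cderive z diry (fun p => Vec (W p)) Vy ->
  has_cderive z dirx (radial f) fx -> has_cderive z diry (radial f) fy ->
  dbar W z = ((radial f z)^-1 *: dbar (fun w => mkB (radial f w) 0) z) * bconj (W z) <->
  Ux - Vy = (radial f z)^-1 * (fx * Sc (W z) + fy * Vec (W z)) /\
  Uy + Vx = (radial f z)^-1 * (fy * Sc (W z) - fx * Vec (W z)).
Proof.
move=> e1 e2 e3 e4 e5 e6; rewrite (dbarE e1 e2 e3 e4).
rewrite (dbarE (W := fun w => mkB (radial f w) 0) e5 e6 (has_cderive_const 0 z dirx)
  (has_cderive_const 0 z diry)).
rewrite bicomplexZ bicomplexM /mkB /bconj /Sc /Vec /= subr0 addr0.
move: ((radial f z)^-1) (Re (W z)) (Im (W z)) => a U V.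
have two : (2 : R[i]) != 0 by rewrite pnatr_eq0.
split.
- move=> [E1 E2]; split.
    by apply: (mulfI (invr_neq0 two)); rewrite E1; ring.
  by apply: (mulfI (invr_neq0 two)); rewrite E2; ring.
- by move=> [-> ->]; congr (Complex _ _); ring.
Qed.

(** The closed form of a formal power. Re and Im of k z^n play the part of r^n cos n t and r^n sin n
    t, and the scalars k = 1 and k = i cover both families. *)
Definition element F Q k (n : nat) z : bicomplex R :=
  mkB (radial F z * (Re (k * cx z ^+ n))%:C) (radial Q z * (Im (k * cx z ^+ n))%:C).

Section Vekua.
Context (rho : R) (f g F F1 Q Q1 f1 : R -> R[i]) (n : nat).
Hypotheses (rho0 : 0 < rho) (FP : radial_profile rho F F1) (QP : radial_profile rho Q Q1)
  (fd : forall z, disk rho z -> has_cderive z dirx (radial f) (radial_dx f1 z) /\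
                               has_cderive z diry (radial f) (radial_dy f1 z))
  (f_neq0 : forall r : R, 0 <= r < rho -> f r != 0)
  (f1E : forall r : R, 0 < r < rho -> f1 r = g r * f r)
  (S1 : forall r : R, 0 < r < rho ->
     r%:C * F1 r + n%:R * F r - r%:C * g r * F r = n%:R * Q r)
  (S2 : forall r : R, 0 < r < rho ->
     r%:C * Q1 r + n%:R * Q r + r%:C * g r * Q r = n%:R * F r).

Lemma element_C1 k : BCk 1 (disk rho) (element F Q k n).
Proof.
(* Both components have this form, [p] being Re or Im. *)
have part (p : R[i] -> R) (H H1 : R -> R[i]) :
  (forall z v a, has_cderive z v (fun p => k * cx p ^+ n) a ->
     has_derive z v (fun s => p (k * cx s ^+ n)) (p a)) ->
  (forall z (h : R * R -> R[i]), ccont_at z h -> {for z, continuous (fun s => p (h s))}) ->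
  radial_profile rho H H1 ->
  Ck2 1 (disk rho) (fun z => radial H z * (p (k * cx z ^+ n))%:C).
  move=> pd pc HP.
  apply: (@C1_Ck2 _ _
   (fun z => radial_dx H1 z * (p (k * cx z ^+ n))%:C +
             radial H z * (p (k * (n%:R * cx z ^+ n.-1)))%:C)
   (fun z => radial_dy H1 z * (p (k * cx z ^+ n))%:C +
             radial H z * (p (k * (n%:R * cx z ^+ n.-1 * 'i)))%:C)).
    exact: disk_open.
  move=> z zr; have [dx dy] := radial_derive rho0 HP zr; have [hx hy] := pow_derive k n z.
  have c0 := radial_ccont HP zr.
  have cp : ccont_at z (fun z => (p (k * cx z ^+ n))%:C).
    by apply: ccont_real; apply: pc; exact: pow_ccont.
  have ck (c : R[i]) : ccont_at z (fun z => (p (k * (n%:R * cx z ^+ n.-1 * c)))%:C).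
    apply: ccont_real; apply: (pc z (fun z => k * (n%:R * cx z ^+ n.-1 * c))).
    apply: ccont_mul; first exact: ccont_const.
    by apply: ccont_mul; [exact: pow_ccont|exact: ccont_const].
  split; first exact: (ccont_mul c0 cp).
  split; split.
  - exact: (has_cderive_mul dx (has_cderive_real (pd _ _ _ hx))).
  - apply: ccont_add; apply: ccont_mul.
    + exact (radial_dx_ccont HP zr).
    + exact: cp.
    + exact: c0.
    + have e : (fun s => (p (k * (n%:R * cx s ^+ n.-1 * 1)))%:C) =
          (fun s => (p (k * (n%:R * cx s ^+ n.-1)))%:C).
        by apply/funext => s; rewrite mulr1.
      by rewrite -e; exact: ck.
  - exact: (has_cderive_mul dy (has_cderive_real (pd _ _ _ hy))).
  - apply: ccont_add; apply: ccont_mul.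
    + exact (radial_dy_ccont HP zr).
    + exact: cp.
    + exact: c0.
    + exact: ck.
split.
- by apply: (part Re _ F1) => // [z v a []|z h []].
- by apply: (part Im _ Q1) => // [z v a []|z h []].
Qed.

(** Let d = k n z^(n-1); the gradients of Re and Im of k z^n are (Re d, -Im d) and (Im d, Re d).
    Once F' and Q' are replaced through [S1] and [S2], the two sides differ by (Q - F)/|z|^2 times
    the identities [e1] and [e2], which are the parts of conj(z) n k z^n = d |z|^2. *)
Lemma element_vekua k z : disk rho z ->
  dbar (element F Q k n) z =
  ((radial f z)^-1 *: dbar (fun w => mkB (radial f w) 0) z) * bconj (element F Q k n z).
Proof.
move=> zr; have [Fx Fy] := radial_derive rho0 FP zr.
have [Qx Qy] := radial_derive rho0 QP zr.
have [fx fy] := fd zr; have [hx hy] := pow_derive k n z.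
apply: (proj2 (@vekuaP f (element F Q k n) z _ _ _ _ _ _ (has_cderive_mul Fx (has_cderive_real hx.1))
  (has_cderive_mul Fy (has_cderive_real hy.1))
  (has_cderive_mul Qx (has_cderive_real hx.2))
  (has_cderive_mul Qy (has_cderive_real hy.2)) fx fy)).
rewrite /element /Sc /Vec /=.
set d := k * (n%:R * cx z ^+ n.-1).
have -> : k * (n%:R * cx z ^+ n.-1 * 'i) = d * 'i by rewrite /d; ring.
have -> : Re (d * 'i) = - Im d by rewrite Re_mul /=; ring.
have -> : Im (d * 'i) = Re d by rewrite Im_mul /=; ring.
(* At the origin the radial gradients vanish and F = Q = 1, so the equations reduce to those of
   Cauchy and Riemann for k z^n. *)
have [z0|z0] := eqVneq (cmod z) 0.
  rewrite /radial_dx /radial_dy /radial z0 invr0 !mulr0.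
  have [_ -> _ _ _] := FP; have [_ -> _ _ _] := QP.
  by rewrite rmorphN /=; split; ring.
have zz : 0 < cmod z < rho by rewrite lt_def z0 cmod_ge0.
have fE := f1E zz; have rn0 : (cmod z)%:C != 0 :> R[i].
  by rewrite (inj_eq (@complexI R)).
have F1E : F1 (cmod z) = n%:R * (Q (cmod z) - F (cmod z)) / (cmod z)%:C +
                         g (cmod z) * F (cmod z).
  have e : (cmod z)%:C * F1 (cmod z) = n%:R * Q (cmod z) - n%:R * F (cmod z) +
      (cmod z)%:C * g (cmod z) * F (cmod z) by rewrite -(S1 zz); ring.
  by apply: (mulfI rn0); rewrite e; field.
have Q1E : Q1 (cmod z) = n%:R * (F (cmod z) - Q (cmod z)) / (cmod z)%:C -
                         g (cmod z) * Q (cmod z).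
  have e : (cmod z)%:C * Q1 (cmod z) = n%:R * F (cmod z) - n%:R * Q (cmod z) -
      (cmod z)%:C * g (cmod z) * Q (cmod z) by rewrite -(S2 zz); ring.
  by apply: (mulfI rn0); rewrite e; field.
have fz : f (cmod z) != 0 by apply: f_neq0; rewrite cmod_ge0.
rewrite /radial_dx /radial_dy /radial fE.
have xy : cmod z ^+ 2 = z.1 ^+ 2 + z.2 ^+ 2 := sqr_cmod z.
pose h := k * cx z ^+ n.
have hd : n%:R * h = d * cx z.
  rewrite /h /d; case: (n) => [|m] /=; first by rewrite !mul0r mulr0 mul0r.
  by rewrite exprS; ring.
have h1 : n%:R * Re h = Re d * z.1 - Im d * z.2.
  have := congr1 Re hd; rewrite !Re_mul /= => <-.
  rewrite -[n%:R in RHS]/(n%:R : R[i]) -(rmorph_nat (real_complex R)) /=.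
  by rewrite mul0r subr0.
have h2 : n%:R * Im h = Re d * z.2 + Im d * z.1.
  have := congr1 Im hd; rewrite !Im_mul /= => <-.
  by rewrite -(rmorph_nat (real_complex R)) /= mul0r addr0.
have e1 : z.1%:C * (n%:R * (Re h)%:C) + z.2%:C * (n%:R * (Im h)%:C) =
    (Re d)%:C * (cmod z)%:C ^+ 2.
  rewrite -(rmorph_nat (real_complex R) n) -!rmorphM h1 h2 -!rmorphXn /= xy.
  by rewrite -!rmorphM -rmorphD /=; congr (_%:C); ring.
have e2 : z.2%:C * (n%:R * (Re h)%:C) - z.1%:C * (n%:R * (Im h)%:C) =
    - (Im d)%:C * (cmod z)%:C ^+ 2.
  rewrite -(rmorph_nat (real_complex R) n) -!rmorphM h1 h2 -!rmorphXn /= xy.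
  by rewrite mulNr -!rmorphM -rmorphB -rmorphN /=; congr (_%:C); ring.
rewrite -/h F1E Q1E !rmorphM !fmorphV rmorphN /=.
have rfz : (cmod z)%:C != 0 :> R[i] by [].
split.
- set W := (X in _ = X); transitivity (W + (Q (cmod z) - F (cmod z)) / (cmod z)%:C ^+ 2 *
    (z.1%:C * (n%:R * (Re h)%:C) + z.2%:C * (n%:R * (Im h)%:C)
       - (Re d)%:C * (cmod z)%:C ^+ 2)).
    by rewrite /W; field; apply/andP.
  by rewrite e1 subrr mulr0 addr0.
- set W := (X in _ = X); transitivity (W + (Q (cmod z) - F (cmod z)) / (cmod z)%:C ^+ 2 *
    (z.2%:C * (n%:R * (Re h)%:C) - z.1%:C * (n%:R * (Im h)%:C)
       - (- (Im d)%:C * (cmod z)%:C ^+ 2))).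
    by rewrite /W; field; apply/andP.
  by rewrite e2 subrr mulr0 addr0.
Qed.

End Vekua.

End RadialElements.

(** * Formal powers as products of radial factors and powers of z *)

Section FormalPowers.
Context {R : realType} (rho : R).
Hypothesis rho0 : 0 < rho.
Notation mu := (@lebesgue_measure R).

Lemma kernel_moment_integrable (q : R -> R[i]) G m (r : R) :
  transmutation_kernel rho q G -> 0 <= r <= rho ->
  mu.-integrable `[0, 1] (EFin \o (fun s : R => s ^+ m * Re (G (r, 1 - s ^+ 2)))) /\
  mu.-integrable `[0, 1] (EFin \o (fun s : R => s ^+ m * Im (G (r, 1 - s ^+ 2)))).
Proof.
move=> [[Gr Gi] _ _ _] rr.
have aux (h : R * R -> R) : realCk [:: dirx; diry] 2 (rect rho) h ->
    mu.-integrable `[0, 1] (EFin \o (fun s : R => s ^+ m * h (r, 1 - s ^+ 2))).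
  move=> hC; have [g0 [_ [_ [_ [[g0c _ _ _] [gE _]]]]]] := kernel_regularity (ltW rho0) hC.
  apply: eq_integrable (moment_integrable m r g0c) => // s.
  rewrite inE /= in_itv /= => s01; congr (_%:E); rewrite gE //.
  by split; rewrite /= in_itv //=; exact: unit_itv_sqr.
by split; [exact: (aux _ Gr)|exact: (aux _ Gi)].
Qed.

(** Homogeneity takes p z out of the integral, and the power s^(2n) joins the factor s to form the
    moment in [kphi]. Real values of [p] let the two parts of the integral scale separately. *)
Lemma Top_homogeneous (q : R -> R[i]) G n (p : R * R -> R) z :
  transmutation_kernel rho q G -> cmod z <= rho ->
  (forall s : R, p (s ^+ 2 * z.1, s ^+ 2 * z.2) = s ^+ (2 * n) * p z) ->
  Top G (fun w => (p w)%:C) z = kphi G n (cmod z) * (p z)%:C.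
Proof.
move=> GK zr ph; rewrite /Top /kphi mulrDl mul1r; congr (_ + _).
have zz : 0 <= cmod z <= rho by rewrite cmod_ge0.
have [Ir Ii] := kernel_moment_integrable (2 * n + 1) GK zz.
move: (2 * n)%N ph Ir Ii => k ph Ir Ii; rewrite /cintegral.
have -> : \int[leb]_(s in `[0, 1]) Re (s%:C * G (cmod z, 1 - s ^+ 2) *
    (p (s ^+ 2 * z.1, s ^+ 2 * z.2))%:C) =
    \int[mu]_(s in `[0, 1]) (s ^+ (k + 1) * Re (G (cmod z, 1 - s ^+ 2))) * p z.
  rewrite -RintegralZr //; apply: eq_Rintegral => s _.
  by rewrite ph !ReImE /= addn1 (exprS s k); ring.
have -> : \int[leb]_(s in `[0, 1]) Im (s%:C * G (cmod z, 1 - s ^+ 2) *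
    (p (s ^+ 2 * z.1, s ^+ 2 * z.2))%:C) =
    \int[mu]_(s in `[0, 1]) (s ^+ (k + 1) * Im (G (cmod z, 1 - s ^+ 2))) * p z.
  rewrite -RintegralZr //; apply: eq_Rintegral => s _.
  by rewrite ph !ReImE /= addn1 (exprS s k); ring.
have -> : \int[leb]_(s in `[0, 1]) Re ((s ^+ (k + 1))%:C * G (cmod z, 1 - s ^+ 2)) =
    \int[mu]_(s in `[0, 1]) (s ^+ (k + 1) * Re (G (cmod z, 1 - s ^+ 2))).
  by apply: eq_Rintegral => s _; rewrite !ReImE /= mul0r subr0.
have -> : \int[leb]_(s in `[0, 1]) Im ((s ^+ (k + 1))%:C * G (cmod z, 1 - s ^+ 2)) =
    \int[mu]_(s in `[0, 1]) (s ^+ (k + 1) * Im (G (cmod z, 1 - s ^+ 2))).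
  by apply: eq_Rintegral => s _; rewrite !ReImE /= mul0r addr0.
by apply/eqP; rewrite eq_complex /= !mulr0 subr0 add0r !eqxx.
Qed.

Lemma hat_pow (z : R * R) n :
  hat z ^+ n = mkB (Re (cx z ^+ n))%:C (Im (cx z ^+ n))%:C.
Proof.
elim: n => [|n IH]; first by rewrite !expr0.
rewrite !exprS IH bicomplexM /hat /mkB /Sc /Vec /= !ReImE /=.
by congr (Complex _ _); rewrite ?rmorphB ?rmorphD !rmorphM.
Qed.

Lemma cx_scale (s : R) (z : R * R) n :
  cx (s * z.1, s * z.2) ^+ n = (s ^+ n)%:C * cx z ^+ n.
Proof.
have -> : cx (s * z.1, s * z.2) = s%:C * cx z.
  by apply/eqP; rewrite eq_complex /= !mul0r subr0 addr0 !eqxx.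
by rewrite exprMn rmorphXn.
Qed.

Lemma Re_scale (r : R) (a : R[i]) : Re (r%:C * a) = r * Re a.
Proof. by rewrite Re_mul /= mul0r subr0. Qed.

Lemma Im_scale (r : R) (a : R[i]) : Im (r%:C * a) = r * Im a.
Proof. by rewrite Im_mul /= mul0r addr0. Qed.

(** Multiplication by the Bicomplex unit j turns Re + j Im of z^n into -Im + j Re, which is the same
    pair for i z^n. Hence j corresponds to the scalar i. *)
Definition unit_of (b : bool) : R[i] := if b then 'i else 1.

Lemma formal_power_element (q q' : R -> R[i]) Gf Ginv n (b : bool) z :
  transmutation_kernel rho q Gf -> transmutation_kernel rho q' Ginv -> disk rho z ->
  formal_power Gf Ginv n (if b then jB else 1) z =
  element (kphi Gf n) (kphi Ginv n) (unit_of b) n z.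
Proof.
move=> GK GK' zr; have zz : cmod z <= rho := ltW zr.
have E w : (if b then jB else 1) * hat w ^+ n =
    mkB (Re (unit_of b * cx w ^+ n))%:C (Im (unit_of b * cx w ^+ n))%:C :> bicomplex R.
  rewrite hat_pow bicomplexM /unit_of /mkB /Sc /Vec; case: b => /=; rewrite !ReImE /=.
    by congr (Complex _ _); rewrite !mul0r !mul1r ?add0r ?sub0r ?addr0 // rmorphN.
  by congr (Complex _ _); rewrite !mul0r !mul1r ?subr0 ?addr0.
rewrite /formal_power /TTop /element; congr mkB.
- have -> : (fun w => Sc ((if b then jB else 1) * hat w ^+ n)) =
            (fun w => (Re (unit_of b * cx w ^+ n))%:C) by apply/funext => w; rewrite E.
  apply: (Top_homogeneous GK zz) => s.
  by rewrite cx_scale -exprM [unit_of b * _]mulrCA Re_scale.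
- have -> : (fun w => Vec ((if b then jB else 1) * hat w ^+ n)) =
            (fun w => (Im (unit_of b * cx w ^+ n))%:C) by apply/funext => w; rewrite E.
  apply: (Top_homogeneous GK' zz) => s.
  by rewrite cx_scale -exprM [unit_of b * _]mulrCA Im_scale.
Qed.

End FormalPowers.

(** * Area integrals and orthogonality *)

Section PlaneMeasure.
Context {R : realType}.
Notation mu := (@lebesgue_measure R).
Local Notation T1 := (measurableTypeR R).
Local Notation T2 := (measurableTypeR R * measurableTypeR R)%type.

Lemma ball_plane_measurable (p : R * R) (e : R) : measurable (ball p e : set T2).
Proof.
have -> : ball p e = (ball p.1 e) `*` (ball p.2 e) by [].
by apply: measurableX; rewrite ball_itv; exact: measurable_itv.
Qed.

(** The sigma-algebra is generated by rectangles, and balls of the max norm are squares; an open set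
    is the countable union of the squares with rational data inside it. *)
Lemma open_measurable_plane (A : set (R * R)) : open A -> measurable (A : set T2).
Proof.
move=> oA.
pose B (a b e : rat) : set T2 := if `[< ball (ratr a : R, ratr b : R) (ratr e) `<=` A >]
  then ball (ratr a : R, ratr b : R) (ratr e) else set0.
have -> : (A : set T2) = \bigcup_a \bigcup_b \bigcup_e B a b e.
  apply/seteqP; split => [[x y] Axy|z [a _ [b _ [e _]]]]; last first.
    by rewrite /B; case: asboolP => // sA /sA.
  have /nbhs_ballP[d /= d0 dA] : nbhs (x, y) A by apply: open_nbhs_nbhs.
  (* With e < d/2 and a centre within e of (x, y), every point of the square stays within 2e < d of
     (x, y). *)
  have [e] := @rat_in_itvoo R 0 (d / 2) ltac:(lra).
  rewrite in_itv /= => /andP[e0 ed].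
  have [a] := @rat_in_itvoo R (x - ratr e) (x + ratr e) ltac:(lra).
  rewrite in_itv /= => /andP[a1 a2].
  have [b] := @rat_in_itvoo R (y - ratr e) (y + ratr e) ltac:(lra).
  rewrite in_itv /= => /andP[b1 b2].
  exists a => //; exists b => //; exists e => //; rewrite /B; case: asboolP; last first.
    move=> nA; exfalso; apply: nA => -[s t] [/= sa tb]; apply: dA.
    move: sa tb; rewrite /ball /= !ltr_norml => /andP[? ?] /andP[? ?].
    by split; rewrite /ball /= ltr_norml; apply/andP; split; lra.
  by move=> _; split; rewrite /ball /= ltr_norml; apply/andP; split; lra.
do 3 (apply: bigcupT_measurable_rat => ?).
by rewrite /B; case: asboolP => // _; exact: ball_plane_measurable.
Qed.

Lemma continuous_measurable_plane (A : set (R * R)) (f : R * R -> R) : open A ->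
  (forall z, A z -> {for z, continuous f}) -> measurable_fun (A : set T2) (f : T2 -> T1).
Proof.
move=> oA fc; apply: (measurability _ (RGenOpens.measurableE R)).
move=> _ [_ [a [b ->] <-]]; apply: open_measurable_plane.
rewrite openE => z [Az fz]; apply: filterI.
  by apply: open_nbhs_nbhs; split.
by apply: (fc z Az); apply: open_nbhs_nbhs; split => //; exact: interval_open.
Qed.

Local Open Scope ereal_scope.

Lemma lebesgue_measure_shift (c : R) (A : set T1) : measurable A ->
  pushforward mu (fun x : T1 => (x + c)%R : T1) A = mu A.
Proof.
move=> mA; have mc : measurable_fun [set: T1] (fun x : T1 => (x + c)%R : T1).
  exact: measurable_funD.
apply/esym/(lebesgue_measure_unique (mu := pushforward mu (fun x : T1 => (x + c)%R : T1))) => //.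
move=> _ [[a b]] _ <-.
rewrite -[RHS]/(mu ((fun x : T1 => (x + c)%R : T1) @^-1` `]a, b])).
rewrite (_ : _ @^-1` _ = `](a - c)%R, (b - c)%R]%classic); last first.
  by apply/seteqP; split => x /=; rewrite !in_itv /= ltrBlDr lerBrDr.
rewrite !lebesgue_measure_itv /= !lte_fin ltrD2r; case: ifP => // _.
by rewrite !EFinB -!EFinB; congr (_%:E); ring.
Qed.

Lemma ge0_integral_shift (c : R) (f : T1 -> \bar R) :
  measurable_fun [set: T1] f -> (forall x, 0 <= f x) ->
  \int[mu]_x f (x + c)%R = \int[mu]_x f x.
Proof.
move=> mf f0; have mc : measurable_fun [set: T1] (fun x : T1 => (x + c)%R : T1).
  exact: measurable_funD.
have := @ge0_integral_pushforward _ _ _ _ R _ mc mu setT f measurableT mf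
  (fun x _ => f0 x).
rewrite preimage_setT /= => <-.
by apply: eq_measure_integral => A mA _; exact: lebesgue_measure_shift.
Qed.

Definition shearx (t : R) (z : T2) : T2 := ((z.1 + t * z.2)%R, z.2).
Definition sheary (t : R) (z : T2) : T2 := (z.1, (z.2 + t * z.1)%R).

Lemma measurable_shearx t : measurable_fun [set: T2] (shearx t).
Proof.
apply: measurable_fun_pair; last exact: measurable_snd.
apply: measurable_funD; first exact: measurable_fst.
by apply: measurable_funM; [exact: measurable_cst|exact: measurable_snd].
Qed.

Lemma measurable_sheary t : measurable_fun [set: T2] (sheary t).
Proof.
apply: measurable_fun_pair; first exact: measurable_fst.
apply: measurable_funD; first exact: measurable_snd.
by apply: measurable_funM; [exact: measurable_cst|exact: measurable_fst].
Qed.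

(** On each horizontal line the shear is a translation, so Tonelli reduces the claim to
    [ge0_integral_shift]. *)
Lemma ge0_integral_shearx t (f : T2 -> \bar R) :
  measurable_fun [set: T2] f -> (forall z, 0 <= f z) ->
  \int[area]_z f (shearx t z) = \int[area]_z f z.
Proof.
move=> mf f0; have mft := measurableT_comp mf (measurable_shearx t).
rewrite /area (fubini_tonelli2 (f \o shearx t)) //; last by move=> z; exact: f0.
rewrite (fubini_tonelli2 f) //; apply: eq_integral => y _; rewrite /fubini_G /=.
apply: (@ge0_integral_shift (t * y)%R (fun x => f (x, y))) => //.
exact: measurable_fun_pair1.
Qed.

Lemma ge0_integral_sheary t (f : T2 -> \bar R) :
  measurable_fun [set: T2] f -> (forall z, 0 <= f z) ->
  \int[area]_z f (sheary t z) = \int[area]_z f z.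
Proof.
move=> mf f0; have mft := measurableT_comp mf (measurable_sheary t).
rewrite /area (fubini_tonelli1 (f \o sheary t)) //; last by move=> z; exact: f0.
rewrite (fubini_tonelli1 f) //; apply: eq_integral => x _; rewrite /fubini_F /=.
apply: (@ge0_integral_shift (t * x)%R (fun y => f (x, y))) => //.
exact: measurable_fun_pair2.
Qed.

Definition plane_rot (c s : R) (z : R * R) : R * R := (c * z.1 - s * z.2, s * z.1 + c * z.2)%R.

Lemma measurable_rot c s : measurable_fun [set: T2] (plane_rot c s : T2 -> T2).
Proof.
by apply: measurable_fun_pair; [apply: measurable_funB|apply: measurable_funD];
  apply: measurable_funM; (exact: measurable_cst || exact: measurable_fst
    || exact: measurable_snd).
Qed.

(* A rotation by an angle other than pi is a product of three shears. *)
Lemma ge0_integral_rot c s (f : T2 -> \bar R) : (c ^+ 2 + s ^+ 2 = 1)%R ->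
  measurable_fun [set: T2] f -> (forall z, 0 <= f z) ->
  \int[area]_z f (plane_rot c s z) = \int[area]_z f z.
Proof.
have main (a b : R) (g : T2 -> \bar R) : (a ^+ 2 + b ^+ 2 = 1)%R -> (a != -1)%R ->
    measurable_fun [set: T2] g -> (forall z, 0 <= g z) ->
    \int[area]_z g (plane_rot a b z) = \int[area]_z g z.
  move=> ab a1 mg g0; have a1' : (1 + a != 0)%R by rewrite addrC addr_eq0.
  (* For a = cos theta and b = sin theta this is -tan(theta/2), finite because a is not -1. *)
  pose t := (- (b / (1 + a)))%R.
  have E z : plane_rot a b z = shearx t (sheary b (shearx t z)).
    have bb : (b * b = (1 - a) * (1 + a))%R by move: ab; rewrite !expr2 => ab; nra.
    have bt : (b * t = a - 1)%R.
      by rewrite /t mulrN mulrA bb mulfK // opprB.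
    rewrite /plane_rot /shearx /sheary /=; congr (_, _); last first.
      by rewrite mulrDr mulrA bt; ring.
    have -> : (z.1 + t * z.2 + t * (z.2 + b * (z.1 + t * z.2)) =
      z.1 + (b * t) * z.1 + (2 * t + (b * t) * t) * z.2)%R by ring.
    by rewrite bt /t; field.
  under eq_integral do rewrite E.
  have m1 := measurableT_comp mg (measurable_shearx t).
  have m2 := measurableT_comp m1 (measurable_sheary b).
  rewrite (@ge0_integral_shearx t (fun z => g (shearx t (sheary b z)))) //.
  rewrite (@ge0_integral_sheary b (fun z => g (shearx t z))) //.
  exact: ge0_integral_shearx.
move=> cs mf f0; have [c1|c1] := eqVneq c (-1)%R; last exact: main.
(* The excluded case is the half turn, which is done as two quarter turns. *)
have s0 : (s = 0)%R.
  by move: cs; rewrite c1 sqrrN expr1n => /eqP; rewrite addrC -subr_eq0 addrK sqrf_eq0 => /eqP.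
have E z : plane_rot c s z = plane_rot 0 1 (plane_rot 0 1 z).
  by rewrite /plane_rot c1 s0 /=; congr (_, _); ring.
under eq_integral do rewrite E.
have m01 : measurable_fun [set: T2] (fun z => f (plane_rot 0 1 z)).
  exact: measurableT_comp mf (measurable_rot 0 1).
have o1 : (0 ^+ 2 + 1 ^+ 2 = 1 :> R)%R by rewrite expr0n /= add0r expr1n.
have o2 : (0 != -1 :> R)%R by rewrite eq_sym oppr_eq0 oner_neq0.
by rewrite (main 0%R 1%R (fun z => f (plane_rot 0 1 z))) // main.
Qed.

Local Close Scope ereal_scope.

Lemma cx_rot c s z : cx (plane_rot c s z) = (c +i* s) * cx z.
Proof. by apply/eqP; rewrite eq_complex /= !eqxx /= addrC eqxx. Qed.

Lemma cmod_rot c s z : c ^+ 2 + s ^+ 2 = 1 -> cmod (plane_rot c s z) = cmod z.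
Proof.
move=> cs; rewrite /cmod -!/(cx _) cx_rot Normc.normcM.
by rewrite [normc (_ +i* _)]normc_sqrt /= cs sqrtr1 mul1r.
Qed.

Definition rotation_invariant (A : set (R * R)) :=
  forall c s, c ^+ 2 + s ^+ 2 = 1 -> forall z, A (plane_rot c s z) = A z.

Lemma disk_rotation rho : rotation_invariant (disk rho).
Proof. by move=> c s cs z; rewrite /disk /= cmod_rot. Qed.

Lemma ge0_integral_rot_in (A : set (R * R)) (c s : R) (f : R * R -> \bar R) :
  rotation_invariant A -> measurable (A : set T2) ->
  c ^+ 2 + s ^+ 2 = 1 -> measurable_fun (A : set T2) (f : T2 -> \bar R) ->
  (forall z, (0 <= f z)%E) ->
  (\int[area]_(z in A) f (plane_rot c s z) = \int[area]_(z in A) f z)%E.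
Proof.
move=> Ar mA cs mf f0.
rewrite [LHS]integral_mkcond [RHS]integral_mkcond -[RHS](ge0_integral_rot cs).
- apply: eq_integral => z _; rewrite !patchE.
  have e : (plane_rot c s z \in A) = (z \in A).
    by apply/idP/idP => /set_mem h; apply/mem_set; move: h; rewrite Ar.
  by rewrite e.
- exact/(measurable_restrictT _ mA).
- by move=> z; rewrite patchE; case: ifP.
Qed.

End PlaneMeasure.

Section PlaneIntegrals.
Context {R : realType}.
Notation mu := (@lebesgue_measure R).
Local Notation T1 := (measurableTypeR R).
Local Notation T2 := (measurableTypeR R * measurableTypeR R)%type.

Lemma Rintegral_rot_in (A : set (R * R)) (c s : R) (f : R * R -> R) :
  rotation_invariant A -> measurable (A : set T2) ->
  c ^+ 2 + s ^+ 2 = 1 -> measurable_fun (A : set T2) (f : T2 -> T1) ->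
  \int[area]_(z in A) f (plane_rot c s z) = \int[area]_(z in A) f z.
Proof.
move=> Ar mA cs mf; rewrite /Rintegral; congr fine.
rewrite [LHS]integralE [RHS]integralE; congr (_ - _)%E.
- have mp : measurable_fun (A : set T2) ((fun z => (f z)%:E)^\+)%E.
    by apply: measurable_funepos; exact/measurable_EFinP.
  rewrite -(ge0_integral_rot_in Ar mA cs mp (funepos_ge0 _)).
  by apply: eq_integral => z _; rewrite !funeposE.
- have mn : measurable_fun (A : set T2) ((fun z => (f z)%:E)^\-)%E.
    by apply: measurable_funeneg; exact/measurable_EFinP.
  rewrite -(ge0_integral_rot_in Ar mA cs mn (funeneg_ge0 _)).
  by apply: eq_integral => z _; rewrite !funenegE.
Qed.

Lemma disk_measurable (rho : R) : measurable (disk rho : set T2).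
Proof. by apply: open_measurable_plane; exact: disk_open. Qed.

(** Substitute x = s sin t on [-pi/2, pi/2], where cos t >= 0 removes the root; the integrand 2 s^2
    cos^2 t has the primitive s^2 (t + sin t cos t). *)
Lemma half_disk_integral (s : R) : 0 < s ->
  (\int[mu]_(x in `[(- s)%R, s]) (2 * Num.sqrt (s ^+ 2 - x ^+ 2))%:E = (pi * s ^+ 2)%:E)%E.
Proof.
move=> s0; pose F (t : R) : R := s * sin t; pose G (x : R) : R := 2 * Num.sqrt (s ^+ 2 - x ^+ 2).
have p0 : 0 < pi :> R := pi_gt0 R.
have Fd (t : R) : has_derive t 1 F (s * cos t).
  apply: has_derive_val.
    exact: (has_derive_mul (has_derive_const s t 1) (is_derive_sin t : has_derive t 1 sin (cos t))).
  by rewrite mul0r add0r.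
have F'E : F^`()%classic = fun t => s * cos t.
  by apply/funext => t; rewrite derive1E; have [_ ->] := Fd t.
have cc : continuous (fun t : R => s * cos t).
  by move=> t; apply: cvgMr; exact: continuous_cos.
have Gc : continuous G.
  move=> x; apply: cvgMr; apply: (@continuous_comp _ _ _ (fun x : R => s ^+ 2 - x ^+ 2)).
    by apply: cvgB; [exact: cvg_cst|exact: pow_continuous].
  exact: sqrt_continuous.
have Fc : continuous F by move=> t; exact: has_derive_cont (Fd t).
have := @integration_by_substitution_increasing R F G (- (pi / 2)) (pi / 2).
have e1 : F (- (pi / 2)) = - s by rewrite /F sinN sin_pihalf mulrN1.
have e2 : F (pi / 2) = s by rewrite /F sin_pihalf mulr1.
rewrite e1 e2 F'E => ->; last 1 first.
- exact: continuous_subspaceT.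
- transitivity ((\int[mu]_(t in `[- (pi / 2), pi / 2]) (2 * s ^+ 2 * cos t ^+ 2))%:E).
    rewrite /Rintegral fineK; last first.
      apply: integrable_fin_num => //.
      apply: (@continuous_integrable_cc _ (fun t => 2 * s ^+ 2 * cos t ^+ 2)) => t.
      by apply: cvgMr; rewrite expr2; apply: cvgM; exact: continuous_cos.
    apply: eq_integral => t; rewrite inE /= in_itv /= => tb.
    have ct : 0 <= cos t by exact: cos_ge0_pihalf.
    congr (_%:E); rewrite -[LHS]/(G (F t) * (s * cos t)) /G /F.
    have -> : s ^+ 2 - (s * sin t) ^+ 2 = (s * cos t) ^+ 2.
      by rewrite !exprMn cos2sin2; ring.
    have sc0 : 0 <= s * cos t by apply: mulr_ge0; first exact: ltW.
    by rewrite sqrtr_sqr ger0_norm //; ring.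
  congr (_%:E).
  rewrite (@FTC2 _ (fun t => s ^+ 2 * (t + sin t * cos t)) (fun t => 2 * s ^+ 2 * cos t ^+ 2)).
  + by rewrite sinN cosN sin_pihalf cos_pihalf; field.
  + lra.
  + move=> t; apply: cvgMr; apply: cvgD; first exact: cvg_id.
    by apply: cvgM; [exact: continuous_sin|exact: continuous_cos].
  + by move=> t; apply: cvgMr; rewrite expr2; apply: cvgM; exact: continuous_cos.
  + move=> t _; apply: has_derive_val.
      apply: (has_derive_mul (has_derive_const (s ^+ 2) t 1)).
      apply: (has_derive_add (has_derive_ident t)).
      exact: (has_derive_mul (is_derive_sin t : has_derive t 1 sin (cos t))
        (is_derive_cos t : has_derive t 1 cos (- sin t))).
    by have := cos2sin2 t; rewrite !expr2 => ->; ring.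
- lra.
- move=> x y xi yi xy; rewrite /F ltr_pM2l // ltr_sin //.
- by move=> t _; exact: cc.
- by apply/cvg_ex; exists (s * cos (- (pi / 2))); apply: cvg_at_right_filter; exact: cc.
- by apply/cvg_ex; exists (s * cos (pi / 2)); apply: cvg_at_left_filter; exact: cc.
- split.
  + by move=> t _; have [] := Fd t.
  + by apply: cvg_at_right_filter; exact: Fc.
  + by apply: cvg_at_left_filter; exact: Fc.
Qed.

Lemma ltr_sqrt_sum (x y s : R) : 0 < s ->
  (Num.sqrt (x ^+ 2 + y ^+ 2) < s) = (y ^+ 2 < s ^+ 2 - x ^+ 2).
Proof.
move=> s0; rewrite -{1}(gtr0_norm s0) -sqrtr_sqr ltr_sqrt ?exprn_gt0 //.
by rewrite ltrBrDl.
Qed.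

(** The product measure integrates the lengths of the vertical sections, intervals of half-length
    [w]. The root of a negative number is 0, so the same formula covers the empty sections. *)
Lemma area_disk (s : R) : 0 < s -> area (disk s : set T2) = (pi * s ^+ 2)%:E.
Proof.
move=> s0; rewrite -half_disk_integral // integral_mkcond.
rewrite -[LHS]/(\int[mu]_x (mu (xsection (disk s : set T2) x)))%E.
apply: eq_integral => x _; rewrite patchE.
pose w := Num.sqrt (s ^+ 2 - x ^+ 2).
have -> : xsection (disk s : set T2) x = `]- w, w[%classic.
  apply/seteqP; split => y; rewrite /xsection /= in_itv /= inE /disk /= cmodE /= ltr_sqrt_sum //.
    move=> h; have p : 0 < s ^+ 2 - x ^+ 2 by apply: le_lt_trans h; exact: sqr_ge0.
    by rewrite -ltr_norml -sqrtr_sqr ltr_sqrt.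
  rewrite -ltr_norml -sqrtr_sqr => h.
  have p : 0 < s ^+ 2 - x ^+ 2.
    rewrite ltNge; apply/negP => /ler0_sqrtr e.
    by move: h; rewrite /w e ltNge sqrtr_ge0.
  by move: h; rewrite /w ltr_sqrt.
have w0 : 0 <= w by exact: sqrtr_ge0.
have -> : mu `]- w, w[%classic = (2 * w)%:E.
  rewrite lebesgue_measure_itv /= lte_fin; case: ltP => h.
    by rewrite -EFinB; congr (_%:E); ring.
  suff -> : w = 0 by rewrite mulr0.
  by apply/eqP; rewrite eq_le w0 andbT; lra.
case: ifPn => // ; rewrite notin_setE /= in_itv /= -ler_norml => /negP; rewrite -ltNge => sx.
have -> : w = 0; last by rewrite mulr0.
apply: ler0_sqrtr; rewrite subr_le0 -[x ^+ 2]real_normK ?num_real //.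
by rewrite ler_pXn2r ?nnegrE // ltW.
Qed.

Lemma bounded_disk_integrable (rho M : R) (f : R * R -> R) : 0 < rho ->
  measurable_fun (disk rho : set T2) (f : T2 -> T1) ->
  (forall z, disk rho z -> `|f z| <= M) ->
  area.-integrable (disk rho : set T2) (EFin \o f).
Proof.
move=> rho0 mf fM; apply: measurable_bounded_integrable => //.
- exact: disk_measurable.
- by rewrite [X in (X < _)%E]area_disk // ltry.
- exists M; split; first exact: num_real.
  by move=> N MN z zr; apply: le_trans (ltW MN); exact: fM.
Qed.

Section Radial.
Context (h : R -> R).
Hypothesis hc : continuous h.

Let I (s : R) := \int[area]_(z in disk s) h (cmod z).

Lemma radial_measurable (A : set (R * R)) : open A ->
  measurable_fun (A : set T2) ((fun z => h (cmod z)) : T2 -> T1).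
Proof.
move=> oA; apply: continuous_measurable_plane => // z _.
by apply: continuous_comp; [exact: cmod_continuous|exact: hc].
Qed.

Lemma continuous_itv_bound (a b : R) :
  exists2 M : R, 0 <= M & forall r, a <= r <= b -> `|h r| <= M.
Proof.
have [||M M0 hM] := @continuous_compact_bounded _ _ (`[a, b] : set R) h.
- exact: segment_compact.
- exact: continuous_subspaceT.
- by exists M => // r rr; apply: hM; rewrite /= in_itv.
Qed.

Lemma radial_integrable (rho : R) : 0 < rho ->
  area.-integrable (disk rho : set T2) (EFin \o (fun z : T2 => h (cmod z))).
Proof.
move=> rho0; have [M _ hM] := continuous_itv_bound 0 rho.
apply: (@bounded_disk_integrable rho M) => //.
  by apply: radial_measurable; exact: disk_open.
by move=> z zr; apply: hM; rewrite cmod_ge0 /= ltW.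
Qed.

(** The difference of the two integrals is an integral over an annulus of area pi (b^2 - a^2), where
    |z| stays in [a, b]. *)
Lemma radial_increment (a b l u : R) : 0 < a -> a < b ->
  (forall r, a <= r <= b -> l <= h r <= u) ->
  l * (pi * (b ^+ 2 - a ^+ 2)) <= I b - I a <= u * (pi * (b ^+ 2 - a ^+ 2)).
Proof.
move=> a0 ab hlu; have b0 := lt_trans a0 ab.
pose A : set T2 := disk b `\` disk a.
have mA : measurable A by apply: measurableD; exact: disk_measurable.
have sub : disk a `<=` (disk b : set (R * R)) by move=> z /lt_trans; exact.
have E : disk b = (disk a : set T2) `|` A by rewrite setDUK.
have iA : area.-integrable A (EFin \o (fun z : T2 => h (cmod z))).
  apply: integrableS (radial_integrable b0) => //; first exact: disk_measurable.
  exact: subDsetl.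
have -> : I b - I a = \int[area]_(z in A) h (cmod z).
  rewrite /I E Rintegral_setU //.
  - by rewrite addrAC subrr add0r.
  - exact: disk_measurable.
  - by rewrite -E; exact: radial_integrable.
  - by apply/disj_setPS => z [] za [].
have aA : (area A = (pi * (b ^+ 2 - a ^+ 2))%:E)%E.
  rewrite [LHS]measureD //; try exact: disk_measurable; last first.
    by rewrite [X in (X < _)%E]area_disk // ltry.
  transitivity ((pi * b ^+ 2)%:E - (pi * a ^+ 2)%:E)%E.
    by congr (_ - _)%E; [exact: area_disk|rewrite setIidr //; exact: area_disk].
  by rewrite -EFinB; congr (_%:E); ring.
have cstI (c : R) : area.-integrable A (EFin \o (fun _ : T2 => c)).
  apply: measurable_bounded_integrable => //.
    by rewrite [X in (X < _)%E]aA ltry.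
  by exists `|c|; split => [|N cN z _]; [exact: num_real|exact: ltW].
have Ac (c : R) : \int[area]_(z in A) c = c * (pi * (b ^+ 2 - a ^+ 2)).
  by rewrite Rintegral_cst // aA.
have inA (z : R * R) : A z -> a <= cmod z <= b.
  by move=> [zb /negP]; rewrite -leNgt => az; rewrite az ltW.
rewrite -!Ac; apply/andP; split; apply: le_Rintegral => // z /inA/hlu/andP[] //.
Qed.

Lemma radial_integral_derive (s : R) : 0 < s -> has_derive s 1 I (2 * pi * (s * h s)).
Proof.
move=> s0; have p0 : 0 < pi :> R := pi_gt0 R.
apply: has_derive_bounds => e e0.
(* The increment over [a, b] is h(s) up to [eta], times pi (b - a)(a + b). Replacing a + b by 2s
   costs at most 2 pi k |h s| <= e/2, and the error [eta] costs pi eta (a + b) <= e/2 because a + b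
   <= 4s. These two demands fix [k] and [eta]. *)
pose eta := e / (8 * pi * s).
have eta0 : 0 < eta by rewrite divr_gt0 // !mulr_gt0.
have /cvgrPdist_lt/(_ _ eta0)/nbhs_ballP[d1 /= d10 H1] := @hc s.
pose k := e / (4 * pi * (`|h s| + 1)).
have h1 : 0 < `|h s| + 1 by rewrite ltr_wpDl.
have k0 : 0 < k by rewrite divr_gt0 // !mulr_gt0.
pose d := Num.min d1 (Num.min s k).
have d0 : 0 < d by rewrite !lt_min d10 s0.
have [dd1 ds dk] : [/\ d <= d1, d <= s & d <= k].
  by rewrite /d; split; rewrite !ge_min lexx ?orbT.
exists d => // a b ad ab bd.
have a0 : 0 < a by lra.
have := @radial_increment a b (h s - eta) (h s + eta) a0 ab.
have ek : 4 * pi * (`|h s| + 1) * k = e.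
  by rewrite /k mulrC divfK //; apply: lt0r_neq0; rewrite !mulr_gt0.
have ee : 8 * pi * s * eta = e.
  by rewrite /eta mulrC divfK //; apply: lt0r_neq0; rewrite !mulr_gt0.
move=> /(_ _)/andP[|lo hi].
  move=> r /andP[ar rb]; have : `|h s - h r| < eta.
    by apply: H1; rewrite /ball /= ltr_norml; apply/andP; split; lra.
  by rewrite ltr_norml => /andP[? ?]; apply/andP; split; lra.
have ba : 0 < b - a by lra.
have bound : `|pi * (a + b - 2 * s) * h s| <= e / 2.
  rewrite !normrM (gtr0_norm p0).
  have t1 : `|a + b - 2 * s| <= 2 * k by rewrite ler_norml; apply/andP; split; lra.
  have := normr_ge0 (h s) => hs0.
  apply: le_trans (_ : pi * (2 * k) * `|h s| <= _).
    by rewrite ler_wpM2r // ler_wpM2l // ltW.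
  have := mulr_gt0 p0 k0; nra.
have bound2 : pi * eta * (a + b) <= e / 2.
  have : a + b <= 4 * s by lra.
  have := mulr_gt0 p0 eta0; nra.
move: bound; rewrite ler_norml => /andP[b1 b2].
have fa : b ^+ 2 - a ^+ 2 = (b - a) * (a + b) by ring.
rewrite fa in lo hi.
apply/andP; split.
- apply: le_trans lo; rewrite -subr_ge0.
  rewrite (_ : _ - _ = (b - a) * (pi * (a + b - 2 * s) * h s - pi * eta * (a + b) + e));
    last by ring.
  by apply: mulr_ge0; [exact: ltW|lra].
- apply: le_trans hi _; rewrite -subr_ge0.
  rewrite (_ : _ - _ = (b - a) * (e - pi * (a + b - 2 * s) * h s - pi * eta * (a + b)));
    last by ring.
  by apply: mulr_ge0; [exact: ltW|lra].
Qed.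

(** As functions of the radius, both sides have the same derivative and tend to 0 at 0. The
    comparison runs on ]0, rho + 1[ so that rho is an interior point. *)
Lemma radial_integral (rho : R) : 0 < rho ->
  \int[area]_(z in disk rho) h (cmod z) = 2 * pi * \int[mu]_(r in `[0, rho]) (r * h r).
Proof.
move=> rho0; have p0 : 0 < pi :> R := pi_gt0 R.
pose J (s : R) := \int[mu]_(r in `[0, s]) (r * h r).
have [M M0 hM] := continuous_itv_bound 0 (rho + 1).
have Jd (s : R) : 0 < s < rho + 1 -> has_derive s 1 J (s * h s).
  apply: (@derive_primitive _ (rho + 1) ((rho + 1) * M)) => x /andP[x0 xr].
    by apply: cvgM; [exact: cvg_id|exact: hc].
  rewrite normrM; apply: ler_pM => //; first by rewrite gtr0_norm // ltW.
  by apply: hM; rewrite !ltW.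
have Dd (s : R) : 0 < s < rho + 1 -> has_derive s 1 (fun x => I x - 2 * pi * J x) 0.
  move=> sr; have [s0 _] := andP sr; apply: has_derive_val.
    apply: (has_derive_sub (radial_integral_derive s0)).
    exact: (has_derive_mul (has_derive_const (2 * pi) s 1) (Jd s sr)).
  by rewrite mul0r add0r subrr.
have Il : I x - 2 * pi * J x @[x --> 0^'+] --> 0.
  apply: (@squeeze_right0 _ _ (fun x => (M * pi * (rho + 1) + 2 * pi * ((rho + 1) * M)) * x)
    (rho + 1)).
  - lra.
  - move=> x /andP[x0 xr].
    have Ib : `|I x| <= M * (pi * x ^+ 2).
      apply: le_trans (le_normr_Rintegral (@disk_measurable x) (radial_integrable x0)) _.
      have -> : M * (pi * x ^+ 2) = \int[area]_(z in disk x) M.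
        rewrite Rintegral_cst; last exact: disk_measurable.
        by rewrite area_disk.
      apply: le_Rintegral; first exact: disk_measurable.
      + exact: integrable_norm (radial_integrable x0).
      + apply: (@bounded_disk_integrable x `|M|) => //.
      + by move=> z zx; apply: hM; rewrite cmod_ge0 /= ltW // (lt_trans zx).
    have Jb : `|J x| <= (rho + 1) * M * x.
      have c1 : continuous (fun r : R => r * h r).
        by move=> r; apply: cvgM; [exact: cvg_id|exact: hc].
      apply: le_trans (le_normr_Rintegral _ (continuous_integrable_cc 0 x c1)) _ => //.
      have -> : (rho + 1) * M * x = \int[mu]_(z in `[0%R, x]) ((rho + 1) * M).
        by rewrite Rintegral_cst //= lebesgue_measure_itv /= lte_fin x0 /= oppr0 addr0.
      apply: le_Rintegral => //.
      + exact: integrable_norm (continuous_integrable_cc 0 x c1).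
      + by apply: continuous_integrable_cc => ?; exact: cvg_cst.
      + move=> r; rewrite /= in_itv /= => /andP[r0 rx]; rewrite normrM.
        apply: ler_pM => //; first by rewrite ger0_norm //; lra.
        by apply: hM; rewrite r0 /=; lra.
    apply: le_trans (ler_normB _ _) _; rewrite [leRHS]mulrDl; apply: lerD.
      apply: le_trans Ib _; rewrite -!mulrA ler_wpM2l // ler_wpM2l ?(ltW p0) //.
      by rewrite expr2 ler_wpM2r ?ltW.
    rewrite normrM ger0_norm ?mulr_ge0 ?(ltW p0) //.
    by rewrite -[leRHS]mulrA ler_wpM2l // mulr_ge0 // ltW.
  - rewrite -[X in _ --> X](mulr0 (M * pi * (rho + 1) + 2 * pi * ((rho + 1) * M))).
    by apply: cvgMr; exact: cvg_right0_id.
have rr : 0 < rho < rho + 1 by rewrite rho0 ltrDl ltr01.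
apply/eqP; rewrite -subr_eq0 eq_le; apply/andP; split.
  exact: (derive_le0_lim0 Dd (fun _ _ => lexx _) Il rr).
rewrite -oppr_le0.
apply: (@derive_le0_lim0 _ (rho + 1) (fun x => - (I x - 2 * pi * J x)) (fun=> - 0)) => //.
- by move=> x xr; apply: has_derive_opp; exact: Dd.
- by rewrite -[X in _ --> X]oppr0; exact: cvgN.
Qed.

End Radial.

End PlaneIntegrals.

(** * Integrals of products of powers over the disk *)

Section Orthogonality.
Context {R : realType} (rho : R).
Hypothesis rho0 : 0 < rho.
Notation mu := (@lebesgue_measure R).
Local Notation T1 := (measurableTypeR R).
Local Notation T2 := (measurableTypeR R * measurableTypeR R)%type.
Local Notation disk_integral f := (\int[area]_(z in disk rho) f z).

Lemma continuous_disk_integrable (f : R * R -> R) : continuous f ->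
  area.-integrable (disk rho : set T2) (EFin \o f).
Proof.
move=> fc; have [||M _ fM] := @continuous_compact_bounded _ _
    (`[- rho, rho] `*` `[- rho, rho] : set (R * R)) f.
- by apply: compact_setX; exact: segment_compact.
- exact: continuous_subspaceT.
- apply: (@bounded_disk_integrable _ rho M) => //.
    by apply: continuous_measurable_plane => [|z _]; [exact: disk_open|exact: fc].
  move=> z zr; apply: fM; split; rewrite /= in_itv /= -ler_norml.
    by apply: le_trans (ler_fst_cmod z) (ltW zr).
  by apply: le_trans (ler_snd_cmod z) (ltW zr).
Qed.

Lemma deMoivre (a : R) n : (cos a +i* sin a) ^+ n = cos (n%:R * a) +i* sin (n%:R * a).
Proof.
elim: n => [|n IH]; first by rewrite expr0 mul0r cos0 sin0.
rewrite exprS IH -natr1 mulrDl mul1r addrC cosD sinD.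
by apply/eqP; rewrite eq_complex /= eqxx /= [cos a * sin _ + _]addrC eqxx.
Qed.

Lemma radial_re_continuous (A : R -> R) (c : R[i]) j : continuous A ->
  continuous (fun z => A (cmod z) * Re (c * cx z ^+ j)).
Proof.
move=> Ac z; apply: cvgM; first by apply: continuous_comp; [exact: cmod_continuous|exact: Ac].
by have [] := pow_ccont c j z.
Qed.

Lemma opp_fixed_eq0 (x : R) : -1 * x = x -> x = 0.
Proof. by move=> h; lra. Qed.

(* Rotation by pi / j changes the sign of z ^ j. *)
Lemma disk_integral_harmonic (A : R -> R) (c : R[i]) j : continuous A -> (0 < j)%N ->
  disk_integral (fun z => A (cmod z) * Re (c * cx z ^+ j)) = 0.
Proof.
move=> Ac j0; have fc := @radial_re_continuous A c j Ac.
pose a : R := pi / j%:R.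
have cs : cos a ^+ 2 + sin a ^+ 2 = 1 by exact: cos2Dsin2.
have mf : measurable_fun (disk rho : set T2)
    ((fun z : T2 => A (cmod z) * Re (c * cx z ^+ j)) : T2 -> T1).
  by apply: continuous_measurable_plane => [|z _]; [exact: disk_open|exact: fc].
have wj : (cos a +i* sin a) ^+ j = -1.
  rewrite deMoivre /a [j%:R * _]mulrC divfK ?pnatr_eq0 -?lt0n // cospi sinpi.
  by apply/eqP; rewrite eq_complex /= oppr0 !eqxx.
have := @Rintegral_rot_in R (disk rho) _ _ _ (@disk_rotation R rho)
  (@disk_measurable R rho) cs mf.
move=> e; have : disk_integral (fun z => -1 * (A (cmod z) * Re (c * cx z ^+ j))) =
    disk_integral (fun z => A (cmod z) * Re (c * cx z ^+ j)).
  apply: eq_trans e.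
  apply: eq_Rintegral.
  move=> z _.
  rewrite /=.
  rewrite cmod_rot; last exact: cs.
  have -> : c * cx (plane_rot (cos a) (sin a) z) ^+ j = - (c * cx z ^+ j).
    by rewrite cx_rot exprMn wj; ring.
  by rewrite Re_opp; ring.
rewrite RintegralZl; [|exact: disk_measurable|exact: continuous_disk_integrable].
exact: opp_fixed_eq0.
Qed.

Lemma Re_mul_conj (a b : R[i]) : Re a * Re b = 2^-1 * (Re (a * b) + Re (a * conjc b)) /\
  Im a * Im b = 2^-1 * (Re (a * conjc b) - Re (a * b)).
Proof. by case: a b => [a1 a2] [b1 b2] /=; split; field. Qed.

Lemma cx_conj_pow (z : R * R) j : cx z ^+ j * conjc (cx z) ^+ j = (cmod z ^+ (2 * j))%:C.
Proof.
rewrite -exprMn exprM rmorphXn; congr (_ ^+ j).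
rewrite sqr_cmod; case: z => x y.
by apply/eqP; rewrite eq_complex /=; apply/andP; split; apply/eqP; ring.
Qed.

Section Products.
Context (A : R -> R) (k k' : R[i]).
Hypothesis Ac : continuous A.

Let h n z := k * cx z ^+ n.
Let h' n z := k' * cx z ^+ n.

Let weight (j : nat) (r : R) : R := A r * r ^+ (2 * j).

Let weight_continuous j : continuous (weight j).
Proof. by move=> r; apply: cvgM; [exact: Ac|exact: pow_continuous]. Qed.

(** The smaller power and its conjugate combine to a power of |z|, which joins the radial weight; a
    positive power of z remains and integrates to 0 by [disk_integral_harmonic]. When n < m the
    conjugate is taken, which leaves the real part unchanged. *)
Lemma disk_integral_conj n m : n <> m ->
  disk_integral (fun z => A (cmod z) * Re (h n z * conjc (h' m z))) = 0.
Proof.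
move=> nm; have [lt|lt|//] := ltngtP n m.
- rewrite -(@disk_integral_harmonic (weight n) (conjc k * k') (m - n)) ?subn_gt0 //.
  apply: eq_Rintegral => z _; rewrite /weight -mulrA; congr (_ * _).
  have -> : Re (h n z * conjc (h' m z)) = Re (conjc (h n z) * h' m z).
    by case: (h n z) (h' m z) => [a b] [c d] /=; ring.
  rewrite -Re_scale -cx_conj_pow /h /h' rmorphM rmorphXn /=.
  by rewrite -{1}(subnK (ltnW lt)) exprD; congr Re; ring.
- rewrite -(@disk_integral_harmonic (weight m) (k * conjc k') (n - m)) ?subn_gt0 //.
  apply: eq_Rintegral => z _; rewrite /weight -mulrA; congr (_ * _).
  rewrite -Re_scale -cx_conj_pow /h /h' rmorphM rmorphXn /=.
  by rewrite -{1}(subnK (ltnW lt)) exprD; congr Re; ring.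
Qed.

Lemma disk_integral_conj_diag n :
  disk_integral (fun z => A (cmod z) * Re (h n z * conjc (h' n z))) =
  Re (k * conjc k') * (2 * pi * \int[mu]_(r in `[0, rho]) (A r * r ^+ (2 * n + 1))).
Proof.
have -> : disk_integral (fun z => A (cmod z) * Re (h n z * conjc (h' n z))) =
    disk_integral (fun z => Re (k * conjc k') * weight n (cmod z)).
  apply: eq_Rintegral => z _; rewrite /weight mulrCA; congr (_ * _).
  rewrite [RHS]mulrC -Re_scale -cx_conj_pow /h /h' rmorphM rmorphXn /=; congr Re; ring.
rewrite RintegralZl; [|exact: disk_measurable|]; last first.
  exact: (radial_integrable (@weight_continuous n)).
rewrite radial_integral //; congr (_ * (_ * _)).
by apply: eq_Rintegral => r _; rewrite /weight mulrCA addn1 exprS.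
Qed.

Lemma disk_integral_split (a b : R) n m :
  disk_integral (fun z => A (cmod z) * (a * Re (h n z * h' m z) + b * Re (h n z * conjc (h' m z)))) =
  a * disk_integral (fun z => A (cmod z) * Re (h n z * h' m z)) +
  b * disk_integral (fun z => A (cmod z) * Re (h n z * conjc (h' m z))).
Proof.
have c1 : continuous (fun z => A (cmod z) * Re (h n z * h' m z)).
  move=> z; apply: cvgM; first by apply: continuous_comp; [exact: cmod_continuous|exact: Ac].
  by have [] := ccont_mul (pow_ccont k n z) (pow_ccont k' m z).
have c2 : continuous (fun z => A (cmod z) * Re (h n z * conjc (h' m z))).
  have cj z : ccont_at z (fun p => conjc (h' m p)).
    have [hr hi] := pow_ccont k' m z; split.
      rewrite (_ : (fun p => Re (conjc (h' m p))) = fun p => Re (h' m p)) //.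
      by apply/funext => p; case: (h' m p).
    rewrite (_ : (fun p => Im (conjc (h' m p))) = fun p => - Im (h' m p)).
      exact: cvgN.
    by apply/funext => p; case: (h' m p).
  move=> z; apply: cvgM; first by apply: continuous_comp; [exact: cmod_continuous|exact: Ac].
  by have [] := ccont_mul (pow_ccont k n z) (cj z).
have i1 := continuous_disk_integrable c1; have i2 := continuous_disk_integrable c2.
rewrite -!RintegralZl; try exact: disk_measurable; try done.
rewrite -RintegralD; [|exact: disk_measurable| |]; last 2 first.
- by apply: integrable_scale => //; exact: disk_measurable.
- by apply: integrable_scale => //; exact: disk_measurable.
by apply: eq_Rintegral => z _; ring.
Qed.

(** Products of real or imaginary parts are half sums and half differences of the terms z^n z^m and
    z^n conj(z)^m. The condition 0 < n + m annihilates the former, and the half turns the factor 2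
    pi of [radial_integral] into pi. *)
Lemma disk_integral_products n m : (0 < n + m)%N ->
  let I := (n == m)%:R * (Re (k * conjc k') *
    (pi * \int[mu]_(r in `[0, rho]) (A r * r ^+ (2 * n + 1)))) in
  disk_integral (fun z => A (cmod z) * (Re (h n z) * Re (h' m z))) = I /\
  disk_integral (fun z => A (cmod z) * (Im (h n z) * Im (h' m z))) = I.
Proof.
move=> nm0 I.
have z0 : disk_integral (fun z => A (cmod z) * Re (h n z * h' m z)) = 0.
  rewrite -(disk_integral_harmonic (k * k') Ac nm0); apply: eq_Rintegral => z _.
  by congr (_ * Re _); rewrite /h /h' exprD; ring.
have zc : 2^-1 * disk_integral (fun z => A (cmod z) * Re (h n z * conjc (h' m z))) = I.
  rewrite /I; have [<-|nm] := eqVneq n m.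
    by rewrite disk_integral_conj_diag mul1r -mulrA [2^-1 * _]mulrCA mulKf ?pnatr_eq0.
  by rewrite disk_integral_conj ?mulr0 ?mul0r //; exact/eqP.
split.
- transitivity (disk_integral (fun z =>
    A (cmod z) * (2^-1 * Re (h n z * h' m z) + 2^-1 * Re (h n z * conjc (h' m z))))).
    by apply: eq_Rintegral => z _; rewrite (Re_mul_conj (h n z) _).1 mulrDr.
  by rewrite disk_integral_split z0 mulr0 add0r.
- transitivity (disk_integral (fun z =>
    A (cmod z) * (- 2^-1 * Re (h n z * h' m z) + 2^-1 * Re (h n z * conjc (h' m z))))).
    by apply: eq_Rintegral => z _; rewrite (Re_mul_conj (h n z) _).2; ring.
  by rewrite disk_integral_split z0 mulr0 add0r.
Qed.

End Products.

Lemma conjc_mul_continuous (F G : R -> R[i]) : ccontinuous F -> ccontinuous G ->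
  ccontinuous (fun r => F r * conjc (G r)).
Proof.
move=> [Fr Fi] [Gr Gi]; split.
- rewrite (_ : (fun r => _) = fun r => Re (F r) * Re (G r) + Im (F r) * Im (G r)); last first.
    by apply/funext => r; case: (F r) (G r) => [? ?] [? ?] /=; ring.
  by move=> r; apply: cvgD; apply: cvgM;
    (exact: Fr || exact: Gr || exact: Fi || exact: Gi).
- rewrite (_ : (fun r => _) = fun r => Im (F r) * Re (G r) - Re (F r) * Im (G r)); last first.
    by apply/funext => r; case: (F r) (G r) => [? ?] [? ?] /=; ring.
  by move=> r; apply: cvgB; apply: cvgM;
    (exact: Fr || exact: Gr || exact: Fi || exact: Gi).
Qed.

Section Inner.
Context (F Q F' Q' F0 Q0 F0' Q0' : R -> R[i]).
Hypotheses (Fc : ccontinuous F0) (Qc : ccontinuous Q0)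
  (Fc' : ccontinuous F0') (Qc' : ccontinuous Q0').
Hypotheses (FE : forall r : R, 0 <= r <= rho -> F r = F0 r)
  (QE : forall r : R, 0 <= r <= rho -> Q r = Q0 r)
  (FE' : forall r : R, 0 <= r <= rho -> F' r = F0' r)
  (QE' : forall r : R, 0 <= r <= rho -> Q' r = Q0' r).

Let a r := F0 r * conjc (F0' r).
Let b r := Q0 r * conjc (Q0' r).

Lemma bdot_element (k k' : R[i]) n m z : disk rho z ->
  bdot (element F Q k n z) (element F' Q' k' m z) =
  a (cmod z) * (Re (k * cx z ^+ n) * Re (k' * cx z ^+ m))%:C +
  b (cmod z) * (Im (k * cx z ^+ n) * Im (k' * cx z ^+ m))%:C.
Proof.
move=> zr; have zz : 0 <= cmod z <= rho by rewrite cmod_ge0 ltW.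
rewrite /bdot /element /Sc /Vec /= /radial FE // QE // FE' // QE' //.
have cr (F1 : R[i]) (x y : R) (u : R[i]) :
    (u * x%:C) * (F1 * y%:C)^* = u * conjc F1 * (x * y)%:C.
  by case: F1 u => [p1 p2] [u1 u2]; apply/eqP; rewrite eq_complex /=;
    apply/andP; split; apply/eqP; ring.
by rewrite !cr.
Qed.

Lemma inner_element (k k' : R[i]) n m :
  inner (disk rho) (element F Q k n) (element F' Q' k' m) =
  (disk_integral (fun z => Re (a (cmod z)) * (Re (k * cx z ^+ n) * Re (k' * cx z ^+ m))) +
   disk_integral (fun z => Re (b (cmod z)) * (Im (k * cx z ^+ n) * Im (k' * cx z ^+ m)))) +i*
  (disk_integral (fun z => Im (a (cmod z)) * (Re (k * cx z ^+ n) * Re (k' * cx z ^+ m))) +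
   disk_integral (fun z => Im (b (cmod z)) * (Im (k * cx z ^+ n) * Im (k' * cx z ^+ m)))).
Proof.
have [ar ai] := conjc_mul_continuous Fc Fc'; have [br bi] := conjc_mul_continuous Qc Qc'.
have c (A : R -> R) (p : R[i] -> R) : continuous A ->
   (forall k n z, {for z, continuous (fun z => p (k * cx z ^+ n))}) ->
   area.-integrable (disk rho : set T2)
     (EFin \o (fun z => A (cmod z) * (p (k * cx z ^+ n) * p (k' * cx z ^+ m)))).
  move=> Ac pc; apply: continuous_disk_integrable => z.
  apply: cvgM; first by apply: continuous_comp; [exact: cmod_continuous|exact: Ac].
  by apply: cvgM; exact: pc.
have pr (l : R[i]) j z : {for z, continuous (fun z => Re (l * cx z ^+ j))} by have [] := pow_ccont l j z.
have pim (l : R[i]) j z : {for z, continuous (fun z => Im (l * cx z ^+ j))} by have [] := pow_ccont l j z.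
rewrite /inner /cintegral; congr (_ +i* _).
- rewrite -(RintegralD (@disk_measurable R rho) (c _ _ ar pr) (c _ _ br pim)).
  apply: eq_Rintegral => z; rewrite inE => zr; rewrite bdot_element //.
  by rewrite !ReImE /=; ring.
- rewrite -(RintegralD (@disk_measurable R rho) (c _ _ ai pr) (c _ _ bi pim)).
  apply: eq_Rintegral => z; rewrite inE => zr; rewrite bdot_element //.
  by rewrite !ReImE /=; ring.
Qed.

Lemma inner_element_pos (k k' : R[i]) n m : (0 < n + m)%N ->
  inner (disk rho) (element F Q k n) (element F' Q' k' m) =
  ((n == m)%:R * (Re (k * conjc k') * pi))%:C *
  (cintegral mu `[0, rho] (fun r => a r * (r ^+ (2 * n + 1))%:C) +
   cintegral mu `[0, rho] (fun r => b r * (r ^+ (2 * n + 1))%:C)).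
Proof.
move=> nm; have [ar ai] := conjc_mul_continuous Fc Fc'.
have [br bi] := conjc_mul_continuous Qc Qc'.
rewrite inner_element.
rewrite (disk_integral_products k k' ar nm).1 (disk_integral_products k k' br nm).2.
rewrite (disk_integral_products k k' ai nm).1 (disk_integral_products k k' bi nm).2.
have E1 (H : R -> R[i]) : \int[mu]_(r in `[0, rho]) Re (H r * (r ^+ (2 * n + 1))%:C) =
    \int[mu]_(r in `[0, rho]) (Re (H r) * r ^+ (2 * n + 1)).
  by apply: eq_Rintegral => r _; rewrite mulrC Re_scale mulrC.
have E2 (H : R -> R[i]) : \int[mu]_(r in `[0, rho]) Im (H r * (r ^+ (2 * n + 1))%:C) =
    \int[mu]_(r in `[0, rho]) (Im (H r) * r ^+ (2 * n + 1)).
  by apply: eq_Rintegral => r _; rewrite mulrC Im_scale mulrC.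
rewrite /cintegral !E1 !E2; apply/eqP; rewrite eq_complex !ReImE /=.
by apply/andP; split; apply/eqP; ring.
Qed.

End Inner.

End Orthogonality.

Section Gram.
Context {R : realType} (rho : R).
Hypothesis rho0 : 0 < rho.
Notation mu := (@lebesgue_measure R).
Local Notation T1 := (measurableTypeR R).
Local Notation T2 := (measurableTypeR R * measurableTypeR R)%type.

Lemma inner_ext (A : set (R * R)) (F G F' G' : R * R -> bicomplex R) :
  (forall z, A z -> F z = F' z) -> (forall z, A z -> G z = G' z) ->
  inner A F G = inner A F' G'.
Proof.
move=> FF GG; rewrite /inner /cintegral; congr (_ +i* _);
  by apply: eq_Rintegral => z; rewrite inE => zA; rewrite FF ?GG.
Qed.

(** By continuity h >= h(0)/2 on some [0, d], and the explicit integral of (h(0)/2) r^j over it is a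
    positive lower bound. *)
Lemma Rintegral_power_gt0 (h : R -> R) j : continuous h ->
  (forall r : R, 0 <= r <= rho -> 0 <= h r) -> 0 < h 0 ->
  0 < \int[mu]_(r in `[0, rho]) (h r * r ^+ j).
Proof.
move=> hc h0 hp; have e0 : 0 < h 0 / 2 by rewrite divr_gt0.
have /cvgrPdist_lt/(_ _ e0)/nbhs_ballP[d1 /= d10 H1] := @hc 0.
pose d := Num.min (d1 / 2) rho.
have d0 : 0 < d by rewrite lt_min divr_gt0.
have [dd1 dr] : d < d1 /\ d <= rho.
  split; last by rewrite ge_min lexx orbT.
  by apply: le_lt_trans (_ : d1 / 2 < _); [rewrite ge_min lexx|lra].
have gc : continuous (fun r : R => h r * r ^+ j).
  by move=> r; apply: cvgM; [exact: hc|exact: pow_continuous].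
have pc : continuous (fun r : R => h 0 / 2 * r ^+ j).
  by move=> r; apply: cvgMr; exact: pow_continuous.
have i1 : \int[mu]_(r in `[0, d]) (h 0 / 2 * r ^+ j) = h 0 / 2 * d ^+ j.+1 / j.+1%:R.
  rewrite (@FTC2 _ (fun r => h 0 / 2 / j.+1%:R * r ^+ j.+1) _ 0 d d0 _ pc).
  - by rewrite expr0n /= mulr0 subr0; field.
  - by move=> r; apply: cvgMr; exact: pow_continuous.
  - move=> r _; apply: has_derive_val.
      exact: (has_derive_mul (has_derive_const _ r 1) (has_derive_pow j.+1 r)).
    by rewrite mul0r add0r /=; field.
apply: lt_le_trans (_ : h 0 / 2 * d ^+ j.+1 / j.+1%:R <= _).
  by rewrite divr_gt0 // mulr_gt0 // exprn_gt0.
rewrite -i1; apply: le_trans (_ : _ <= \int[mu]_(r in `[0, d]) (h r * r ^+ j)) _.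
  apply: le_Rintegral => //; try exact: continuous_integrable_cc.
  move=> r; rewrite /= in_itv /= => /andP[r0 rd]; rewrite ler_wpM2r ?exprn_ge0 //.
  have : `|h 0 - h r| < h 0 / 2.
    by apply: H1; rewrite /ball /= sub0r normrN ger0_norm //; exact: le_lt_trans dd1.
  by rewrite ltr_norml => /andP[? ?]; lra.
have sub : `[0, d] `<=` (`[0, rho] : set R).
  by move=> r; rewrite /= !in_itv /= => /andP[-> rd] /=; exact: le_trans dr.
rewrite /Rintegral fine_le //.
- by apply: integrable_fin_num => //; exact: continuous_integrable_cc.
- by apply: integrable_fin_num => //; exact: continuous_integrable_cc.
apply: ge0_subset_integral => //.
- by have /measurable_int := continuous_integrable_cc 0 rho gc.
- move=> r; rewrite /= in_itv /= => /andP[r0 rr]; rewrite lee_fin mulr_ge0 ?exprn_ge0 //.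
  by apply: h0; rewrite r0.
Qed.

Local Notation I2 P j := (\int[mu]_(r in `[0, rho]) (normc (P r) ^+ 2 * r ^+ j)).

Lemma cintegral_norm2 (P : R -> R[i]) j :
  cintegral mu `[0, rho] (fun r => P r * conjc (P r) * (r ^+ j)%:C) =
  (I2 P j)%:C.
Proof.
have e r : P r * conjc (P r) * (r ^+ j)%:C = (normc (P r) ^+ 2 * r ^+ j)%:C.
  rewrite normc_sqr; case: (P r) => x y; apply/eqP; rewrite eq_complex /=.
  by apply/andP; split; apply/eqP; ring.
rewrite /cintegral; congr (_ +i* _).
  by apply: eq_Rintegral => r _; rewrite e.
transitivity (\int[mu]_(r in `[0, rho]) (0 : R)).
  by apply: eq_Rintegral => r _; rewrite e.
by rewrite Rintegral_cst // mul0r.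
Qed.

Lemma unit_of_conj b b' : Re (unit_of b * conjc (unit_of b')) = (b == b')%:R :> R.
Proof. by case: b b' => [] [] /=; ring. Qed.

(** The two factors of an inner product come with separately chosen continuous representatives; for
    the same P they agree on [0, rho], the only place that is integrated. *)
Lemma cintegral_norm2_ext (P P0 P0' : R -> R[i]) j :
  (forall r : R, 0 <= r <= rho -> P r = P0 r) -> (forall r : R, 0 <= r <= rho -> P r = P0' r) ->
  cintegral mu `[0, rho] (fun r => P0 r * conjc (P0' r) * (r ^+ j)%:C) = (I2 P j)%:C.
Proof.
move=> e0 e0'; rewrite -cintegral_norm2 /cintegral.
by congr (_ +i* _); apply: eq_Rintegral => r; rewrite inE /= in_itv /= => rr;
  rewrite -e0 // -e0'.
Qed.

Lemma integral_disk0 (h : R * R -> R) : (forall z, h z = 0) ->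
  \int[area]_(z in disk rho) h z = 0.
Proof.
move=> h0; transitivity (\int[area]_(z in disk rho) (0 : R)).
  by apply: eq_Rintegral => z _.
by rewrite Rintegral_cst ?mul0r //; exact: disk_measurable.
Qed.

Context (F Q F1 Q1 : nat -> R -> R[i]).
Hypotheses (FP : forall n, radial_profile rho (F n) (F1 n))
  (QP : forall n, radial_profile rho (Q n) (Q1 n)).
Let e (i : nat * bool) := element (F i.1) (Q i.1) (unit_of i.2) i.1.

Lemma inner_element_gt0 b b' n m : (0 < n + m)%N ->
  inner (disk rho) (e (n, b)) (e (m, b')) =
  ((n == m)%:R * (b == b')%:R *
    (pi * (I2 (F n) (2 * n + 1) + I2 (Q n) (2 * n + 1))))%:C.
Proof.
move=> nm.
have [[Fn Fnc FnE] _ _ _ _] := FP n; have [[Qn Qnc QnE] _ _ _ _] := QP n.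
have [[Fm Fmc FmE] _ _ _ _] := FP m; have [[Qm Qmc QmE] _ _ _ _] := QP m.
rewrite (inner_element_pos rho0 Fnc Qnc Fmc Qmc FnE QnE FmE QmE _ _ nm) unit_of_conj.
have [E|_] := eqVneq n m; last by rewrite !mul0r.
subst m; rewrite !mul1r.
rewrite (cintegral_norm2_ext _ FnE FmE) (cintegral_norm2_ext _ QnE QmE).
by rewrite -rmorphD -rmorphM /= !mulrA.
Qed.

Lemma norm2_continuous (P : R -> R[i]) : ccontinuous P ->
  continuous (fun r => normc (P r) ^+ 2).
Proof.
move=> [Pr Pi]; rewrite (_ : (fun r => _) = fun r => Re (P r) ^+ 2 + Im (P r) ^+ 2).
  move=> r; apply: cvgD; rewrite expr2; apply: cvgM; (exact: Pr || exact: Pi).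
by apply/funext => r; rewrite normc_sqr.
Qed.

(** Positivity rests on the value 1 of the factors at r = 0. The case n = 0 is apart: z^0 has no
    imaginary part and i z^0 no real part, so a single radial norm survives, with factor 2 pi. *)
Lemma inner_element_self_neq0 i : inner (disk rho) (e i) (e i) != 0.
Proof.
case: i => n b.
have pos P P1 j : radial_profile rho P P1 -> 0 < I2 P j.
  move=> [[P0 Pc PE] P_0 _ _ _]; rewrite (_ : I2 P j = I2 P0 j); last first.
    by apply: eq_Rintegral => r; rewrite inE /= in_itv /= => /PE ->.
  apply: Rintegral_power_gt0; first exact: norm2_continuous.
    by move=> r _; exact: sqr_ge0.
  by rewrite -PE ?lexx ?ltW // P_0 normc_sqr /=; lra.
have [n0|n0] := posnP n; last first.
  rewrite inner_element_gt0; last by rewrite addn_gt0 n0.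
  rewrite !eqxx !mul1r; apply/eqP => /(congr1 Re) /=; apply/eqP; rewrite lt0r_neq0 //.
  by rewrite mulr_gt0 ?pi_gt0 // addr_gt0 //; [exact: pos (FP n)|exact: pos (QP n)].
subst n.
have [[Fn Fc FE] _ _ _ _] := FP 0%N; have [[Qn Qc QE] _ _ _ _] := QP 0%N.
rewrite (inner_element rho0 Fc Qc Fc Qc FE QE FE QE).
apply/eqP => /(congr1 Re) /=; apply/eqP; rewrite lt0r_neq0 //.
have rad P P0 P1 : ccontinuous P0 -> (forall r : R, 0 <= r <= rho -> P r = P0 r) ->
    radial_profile rho P P1 -> 0 < \int[area]_(z in disk rho) (normc (P0 (cmod z)) ^+ 2).
  move=> Pc PE PP; rewrite (radial_integral (norm2_continuous Pc) rho0).
  rewrite mulr_gt0 // ?mulr_gt0 ?pi_gt0 //.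
  rewrite (_ : Rintegral _ _ _ = I2 P 1) ?(pos _ _ _ PP) //.
  by apply: eq_Rintegral => r; rewrite inE /= in_itv /= => /PE ->; rewrite mulrC.
have sq (u : R[i]) : Re (u * conjc u) = normc u ^+ 2.
  by rewrite normc_sqr; case: u => x y /=; ring.
case: b.
- rewrite [X in X + _]integral_disk0; last by move=> z; rewrite expr0 /=; ring.
  rewrite add0r; apply: lt_le_trans (rad _ _ _ Qc QE (QP 0%N)) _.
  rewrite le_eqVlt; apply/orP; left; apply/eqP.
  by apply: eq_Rintegral => z _; rewrite sq expr0 /=; ring.
- rewrite [X in _ + X]integral_disk0; last by move=> z; rewrite expr0 /=; ring.
  rewrite addr0; apply: lt_le_trans (rad _ _ _ Fc FE (FP 0%N)) _.
  rewrite le_eqVlt; apply/orP; left; apply/eqP.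
  by apply: eq_Rintegral => z _; rewrite sq expr0 /=; ring.
Qed.

Lemma inner_element_orthogonal i k : i != k -> inner (disk rho) (e i) (e k) = 0.
Proof.
case: i k => [n b] [m b'] ik; have [|nm] := posnP (n + m)%N.
  (* For n = m = 0 and distinct units one element lies in the Sc component and the other in Vec, so
     the integrand vanishes pointwise. *)
  move=> /eqP; rewrite addn_eq0 => /andP[/eqP n0 /eqP m0]; subst n m.
  have bb : b != b' by apply: contraNneq ik => ->.
  have [[Fn Fc FE] _ _ _ _] := FP 0%N; have [[Qn Qc QE] _ _ _ _] := QP 0%N.
  rewrite (inner_element rho0 Fc Qc Fc Qc FE QE FE QE).
  rewrite !integral_disk0 ?addr0 // => z; move: bb;
    by case: b b' {ik} => [] [] // _; rewrite expr0 /=; ring.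
rewrite inner_element_gt0 //; move: ik; rewrite xpair_eqE negb_and.
by case/orP => /negPf ->; rewrite ?mulr0 !mul0r.
Qed.

End Gram.

(** * Angular modes of a solution *)

Section Circles.
Context {R : realType}.
Notation mu := (@lebesgue_measure R).
Implicit Types (w : R * R -> R) (r a : R).

Lemma integral_derive (h g : R -> R -> R) (a b l u M x : R) : l < x < u ->
  (forall y, l < y < u -> continuous (h y)) ->
  (forall y s, l < y < u -> a <= s <= b -> has_derive y 1 (h^~ s) (g y s)) ->
  (forall y s, l < y < u -> a <= s <= b -> `|g y s| <= M) -> 0 <= M ->
  has_derive x 1 (fun y => \int[mu]_(s in `[a, b]) h y s) (\int[mu]_(s in `[a, b]) g x s).
Proof.
move=> xr hc hd gM M0.
have fI y : `]l, u[%classic y -> mu.-integrable `[a, b] (EFin \o h y).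
  by rewrite /= in_itv /= => yr; apply: continuous_integrable_cc; exact: hc.
have Ix : `]l, u[%classic x by rewrite /= in_itv.
have derf y s : `]l, u[%classic y -> `[a, b]%classic s -> derivable (h ^~ s) y 1.
  by rewrite /= !in_itv /= => yr sr; have [] := hd y s yr sr.
have MI : mu.-integrable `[a, b] (EFin \o (fun _ : R => M)).
  by apply: continuous_integrable_cc => s; exact: cvg_cst.
have pub y s : `]l, u[%classic y -> `[a, b]%classic s -> `|partial1of2 h y s| <= M.
  rewrite /= !in_itv /= => yr sr; have [_ e] := hd y s yr sr.
  by rewrite /partial1of2 derive1E e; exact: gM.
have mB : measurable (`[a, b]%classic : set R) by [].
have A := @derivable_under_integral R _ _ mu h _ mB x l u Ix fI derf
   (fun=> M) (fun=> M0) MI pub.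
have B := @differentiation_under_integral R _ _ mu h _ mB x l u Ix fI derf
   (fun=> M) (fun=> M0) MI pub.
split; first exact: A.
rewrite -derive1E B; apply: eq_Rintegral => s; rewrite inE /= in_itv /= => sr.
by have [_ e] := hd x s xr sr; rewrite /partial1of2 derive1E e.
Qed.

(** The derivative of the integral with respect to the shift y is F(T + y) - F(y), which is 0 by
    periodicity. *)
Lemma periodic_shift (F F' : R -> R) (T t : R) : 0 < T ->
  (forall a, has_derive a 1 F (F' a)) -> continuous F' -> (forall a, F (a + T) = F a) ->
  \int[mu]_(a in `[0, T]) F (a + t) = \int[mu]_(a in `[0, T]) F a.
Proof.
move=> T0 Fd F'c Fp; have Fc : continuous F by move=> a; exact: has_derive_cont (Fd a).
have sc (G : R -> R) (y : R) : continuous G -> continuous (fun a : R => G (a + y)).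
  move=> Gc a; apply: (@continuous_comp _ _ _ (fun a : R => a + y) G); last exact: Gc.
  by apply: cvgD; [exact: cvg_id|exact: cvg_cst].
have sd (a y : R) : has_derive a 1 (fun s => F (s + y)) (F' (a + y)).
  apply: has_derive_val.
    exact: (has_derive_chain (has_derive_add (has_derive_ident a) (has_derive_const y a 1)) (Fd (a + y))).
  by rewrite addr0 mulr1.
have D0 (y : R) : has_derive y 1 (fun y => \int[mu]_(a in `[0, T]) F (a + y)) 0.
  have [||M M0 FM] := @continuous_compact_bounded _ _ (`[y - 1, y + 1 + T] : set R) F'.
  - exact: segment_compact.
  - exact: continuous_subspaceT.
  apply: has_derive_val.
    apply: (@integral_derive (fun y a => F (a + y)) (fun y a => F' (a + y)) 0 T (y - 1) (y + 1) M).
    - by apply/andP; split; lra.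
    - by move=> z _; exact: sc.
    - move=> z s _ _; under eq_fun do rewrite addrC.
      by rewrite addrC; exact: sd.
    - move=> z s /andP[z1 z2] /andP[s0 sT]; apply: FM; rewrite /= in_itv /=.
      by apply/andP; split; lra.
    - exact: M0.
  rewrite (@FTC2 _ (fun a => F (a + y)) (fun a => F' (a + y)) 0 T T0 (sc F y Fc) (sc F' y F'c)).
    by rewrite [T + y]addrC Fp add0r subrr.
  by move=> a _; exact: sd.
have E : \int[mu]_(a in `[0, T]) F a = \int[mu]_(a in `[0, T]) F (a + 0).
  by apply: eq_Rintegral => a _; rewrite addr0.
rewrite E; have [t0|t0] := leP 0 t.
  by apply: (derive_eq0_cst (f := fun y => \int[mu]_(a in `[0, T]) F (a + y)) t0) => y _; exact: D0.
by apply/esym; apply: (derive_eq0_cst (f := fun y => \int[mu]_(a in `[0, T]) F (a + y)) (ltW t0)) => y _; exact: D0.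
Qed.

Definition pol r a : R * R := (r * cos a, r * sin a).

Lemma cmod_pol r a : cmod (pol r a) = `|r|.
Proof.
rewrite cmodE /= !exprMn -mulrDr cos2Dsin2 mulr1 sqrtr_sqr //.
Qed.

Lemma pol_rot r a b : plane_rot (cos a) (sin a) (pol r b) = pol r (b + a).
Proof. by rewrite /plane_rot /pol /= cosD sinD; congr (_, _); ring. Qed.

(** [acos] of z.1/|z| gives the angle in the closed upper half plane, its opposite the angle in the
    lower one. *)
Lemma pol_surj (z : R * R) : exists a, z = pol (cmod z) a.
Proof.
have [z0|z0] := eqVneq (cmod z) 0.
  by exists 0; rewrite /pol z0 !mul0r; apply/eqP; rewrite -cmod_eq0 z0.
have cp : 0 < cmod z by rewrite lt_def z0 cmod_ge0.
have e : (z.1 / cmod z) ^+ 2 + (z.2 / cmod z) ^+ 2 = 1.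
  by rewrite !expr_div_n -mulrDl -sqr_cmod divff // expf_neq0.
have b1 : -1 <= z.1 / cmod z <= 1.
  by rewrite -ler_norml normrM normfV (gtr0_norm cp) ler_pdivrMr // mul1r ler_fst_cmod.
have [s|s] := leP 0 z.2.
  exists (acos (z.1 / cmod z)); rewrite /pol acosK ?in_itv //= sin_acos //.
  have -> : 1 - (z.1 / cmod z) ^+ 2 = (z.2 / cmod z) ^+ 2 by rewrite -e; ring.
  rewrite sqrtr_sqr ger0_norm ?divr_ge0 ?cmod_ge0 // ![cmod z * _]mulrC !divfK //.
  by case: (z).
exists (- acos (z.1 / cmod z)); rewrite /pol cosN sinN acosK ?in_itv //= sin_acos //.
have -> : 1 - (z.1 / cmod z) ^+ 2 = (z.2 / cmod z) ^+ 2 by rewrite -e; ring.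
rewrite sqrtr_sqr normrM normfV (gtr0_norm cp) (ltr0_norm s) mulNr opprK ![cmod z * _]mulrC !divfK //.
by case: (z).
Qed.

Lemma pol_continuous r : continuous (pol r).
Proof.
apply: continuous_pair => a; apply: cvgMr; [exact: continuous_cos|exact: continuous_sin].
Qed.

Definition C1_on (A : set (R * R)) w (wx wy : R * R -> R) := forall z, A z ->
  [/\ {for z, continuous w}, has_derive z dirx w (wx z), has_derive z diry w (wy z),
      {for z, continuous wx} & {for z, continuous wy}].

Section OnDisk.
Context (rho : R) (w wx wy : R * R -> R).
Hypothesis wC1 : C1_on (disk rho) w wx wy.

Lemma pol_disk r a : `|r| < rho -> disk rho (pol r a).
Proof. by rewrite /disk /= cmod_pol. Qed.

Lemma C1_on_chain (a b : R -> R) (a' b' t : R) : disk rho (a t, b t) ->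
  has_derive t 1 a a' -> has_derive t 1 b b' ->
  has_derive t 1 (fun s => w (a s, b s)) (wx (a t, b t) * a' + wy (a t, b t) * b').
Proof.
move=> zr; have [_ _ wyd wxc _] := wC1 zr; apply: C1_chain => //.
by apply: filterS (disk_near zr) => p /wC1[].
Qed.

Lemma pol_derive_r r a : `|r| < rho ->
  has_derive r 1 (fun x => w (pol x a)) (wx (pol r a) * cos a + wy (pol r a) * sin a).
Proof.
move=> rr; apply: (@C1_on_chain (fun x => x * cos a) (fun x => x * sin a)).
- exact: pol_disk.
- apply: has_derive_val; first exact: (has_derive_mul (has_derive_ident r) (has_derive_const (cos a) r 1)).
  by rewrite mul1r mulr0 addr0.
- apply: has_derive_val; first exact: (has_derive_mul (has_derive_ident r) (has_derive_const (sin a) r 1)).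
  by rewrite mul1r mulr0 addr0.
Qed.

Definition angular r a := wx (pol r a) * - (r * sin a) + wy (pol r a) * (r * cos a).

Lemma pol_derive_a r a : `|r| < rho -> has_derive a 1 (fun b => w (pol r b)) (angular r a).
Proof.
move=> rr; apply: (@C1_on_chain (fun x => r * cos x) (fun x => r * sin x)).
- exact: pol_disk.
- apply: has_derive_val.
    exact: (has_derive_mul (has_derive_const r a 1) (is_derive_cos a : has_derive a 1 cos (- sin a))).
  by rewrite mul0r add0r mulrN.
- apply: has_derive_val.
    exact: (has_derive_mul (has_derive_const r a 1) (is_derive_sin a : has_derive a 1 sin (cos a))).
  by rewrite mul0r add0r.
Qed.

Lemma pol_comp_continuous (h : R * R -> R) r : (forall z, disk rho z -> {for z, continuous h}) ->
  `|r| < rho -> continuous (fun a => h (pol r a)).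
Proof.
move=> hc rr a; apply: (continuous_comp (@pol_continuous r a)).
by apply: hc; exact: pol_disk.
Qed.

Lemma w_pol_continuous r : `|r| < rho -> continuous (fun a => w (pol r a)).
Proof. by apply: pol_comp_continuous => z /wC1[]. Qed.

Lemma angular_continuous r : `|r| < rho -> continuous (angular r).
Proof.
move=> rr a; apply: cvgD; apply: cvgM.
- by apply: pol_comp_continuous rr a => z /wC1[].
- by apply: cvgN; apply: cvgMr; exact: continuous_sin.
- by apply: pol_comp_continuous rr a => z /wC1[].
- by apply: cvgMr; exact: continuous_cos.
Qed.

(** A solution may be unbounded towards the boundary circle, so bounds are available only on compact
    smaller disks; every use picks a radius s < rho. *)
Lemma closed_disk_bound (h : R * R -> R) (s : R) : s < rho ->
  (forall z, disk rho z -> {for z, continuous h}) ->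
  exists2 M, 0 <= M & forall z, cmod z <= s -> `|h z| <= M.
Proof.
move=> sr hc.
have [||M M0 HM] := @continuous_compact_bounded _ _ [set z : R * R | cmod z <= s] h; last by exists M.
- apply: (@subclosed_compact _ _ (`[- s, s] `*` `[- s, s])).
  + apply: (@closed_comp _ _ (@cmod R) [set x | x <= s]); last exact: closed_le.
    by move=> z _; exact: cmod_continuous.
  + by apply: compact_setX; exact: segment_compact.
  + move=> z zs; split; rewrite /= in_itv /= -ler_norml; apply: le_trans zs;
      [exact: ler_fst_cmod|exact: ler_snd_cmod].
- apply: continuous_in_subspaceT => z; rewrite inE /= => zs; apply: hc.
  exact: le_lt_trans sr.
Qed.

Lemma pol_integral_derive (p : R -> R) r : continuous p -> 0 < r < rho ->
  has_derive r 1 (fun x => \int[mu]_(a in `[0, 2 * pi]) (w (pol x a) * p a))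
   (\int[mu]_(a in `[0, 2 * pi]) ((wx (pol r a) * cos a + wy (pol r a) * sin a) * p a)).
Proof.
move=> pc /andP[r0 rr].
pose s := (r + rho) / 2; have [rs sr] : r < s /\ s < rho by rewrite /s; split; lra.
have [|X X0 HX] := @closed_disk_bound wx s sr; first by move=> z /wC1[].
have [|Y Y0 HY] := @closed_disk_bound wy s sr; first by move=> z /wC1[].
have [||P P0 HP] := @continuous_compact_bounded _ _ (`[0, 2 * pi] : set R) p.
- exact: segment_compact.
- exact: continuous_subspaceT.
have yr y : 0 < y < s -> `|y| < rho.
  by move=> /andP[y0 ys]; rewrite gtr0_norm //; exact: lt_trans ys sr.
apply: (@integral_derive (fun x a => w (pol x a) * p a)
  (fun x a => (wx (pol x a) * cos a + wy (pol x a) * sin a) * p a) 0 (2 * pi) 0 s ((X + Y) * P)).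
- by rewrite r0.
- by move=> y ys a; apply: cvgM; [apply: w_pol_continuous; exact: yr|exact: pc].
- move=> y a ys _; apply: has_derive_val.
    exact: (has_derive_mul (pol_derive_r a (yr y ys)) (has_derive_const (p a) y 1)).
  by rewrite mulr0 addr0.
- move=> y a ys ar; rewrite normrM; apply: ler_pM => //; last by apply: HP; rewrite /= in_itv.
  have cs : cmod (pol y a) <= s by rewrite cmod_pol; move/andP: ys => [y0 ys]; rewrite gtr0_norm // ltW.
  apply: le_trans (ler_normD _ _) _; apply: lerD; rewrite normrM -[leRHS]mulr1; apply: ler_pM => //.
  + exact: HX.
  + by rewrite ler_norml cos_geN1 cos_le1.
  + exact: HY.
  + by rewrite ler_norml sin_geN1 sin_le1.
- by apply: mulr_ge0 => //; exact: addr_ge0.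
Qed.

Lemma pol_periodic (h : R * R -> R) r a : h (pol r (a + 2 * pi)) = h (pol r a).
Proof. by rewrite /pol [2 * pi]mulr_natl cosD2pi sinD2pi. Qed.

(** The boundary terms cancel since both factors take equal values at the angles 0 and 2 pi. *)
Lemma pol_by_parts (p p' : R -> R) r : `|r| < rho -> (forall a, has_derive a 1 p (p' a)) ->
  continuous p' -> p (2 * pi) = p 0 ->
  \int[mu]_(a in `[0, 2 * pi]) (angular r a * p a) =
  - \int[mu]_(a in `[0, 2 * pi]) (w (pol r a) * p' a).
Proof.
move=> rr pd p'c p2; have pc : continuous p by move=> a; exact: has_derive_cont (pd a).
have c0 : continuous (fun a => w (pol r a) * p a).
  by move=> a; apply: cvgM; [exact: w_pol_continuous|exact: pc].
have c1 : continuous (fun a => angular r a * p a).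
  by move=> a; apply: cvgM; [exact: angular_continuous|exact: pc].
have c2 : continuous (fun a => w (pol r a) * p' a).
  by move=> a; apply: cvgM; [exact: w_pol_continuous|exact: p'c].
have pi2 : 0 < 2 * pi :> R by rewrite mulr_gt0 ?pi_gt0.
have := @FTC2 _ (fun a => w (pol r a) * p a) (fun a => angular r a * p a + w (pol r a) * p' a)
  0 (2 * pi) pi2 c0.
rewrite RintegralD //; try exact: continuous_integrable_cc.
rewrite p2 -[2 * pi]add0r pol_periodic subrr => H.
apply/eqP; rewrite -addr_eq0; apply/eqP; apply: H.
  by move=> a; apply: cvgD; [exact: c1|exact: c2].
by move=> a _; exact: (has_derive_mul (pol_derive_a a rr) (pd a)).
Qed.

End OnDisk.

End Circles.

Section Modes.
Context {R : realType}.
Notation mu := (@lebesgue_measure R).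
Local Notation cint F := (cintegral mu `[0, 2 * pi] F).
Implicit Types (F G : R -> R[i]) (U V : R * R -> R[i]) (p : R -> R).

Lemma pi2_gt0 : 0 < 2 * pi :> R.
Proof. by rewrite mulr_gt0 ?pi_gt0. Qed.

Lemma cint_add F G : ccontinuous F -> ccontinuous G ->
  cint (fun a => F a + G a) = cint F + cint G.
Proof.
move=> [Fr Fi] [Gr Gi]; rewrite /cintegral; apply/eqP; rewrite eq_complex /=.
apply/andP; split; apply/eqP.
- rewrite -(RintegralD _ (continuous_integrable_cc 0 (2 * pi) Fr)
    (continuous_integrable_cc 0 (2 * pi) Gr)) //.
  by apply: eq_Rintegral => a _; rewrite ReImE.
- rewrite -(RintegralD _ (continuous_integrable_cc 0 (2 * pi) Fi)
    (continuous_integrable_cc 0 (2 * pi) Gi)) //.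
  by apply: eq_Rintegral => a _; rewrite ReImE.
Qed.

Lemma cint_scale (c : R[i]) F : ccontinuous F -> cint (fun a => c * F a) = c * cint F.
Proof.
move=> [Fr Fi].
have Ir (k : R) : k * \int[mu]_(a in `[0, 2 * pi]) Re (F a) =
    \int[mu]_(a in `[0, 2 * pi]) (k * Re (F a)).
  by rewrite RintegralZl //; exact: (continuous_integrable_cc 0 (2 * pi) Fr).
have Ii (k : R) : k * \int[mu]_(a in `[0, 2 * pi]) Im (F a) =
    \int[mu]_(a in `[0, 2 * pi]) (k * Im (F a)).
  by rewrite RintegralZl //; exact: (continuous_integrable_cc 0 (2 * pi) Fi).
have Zr (k : R) : mu.-integrable `[0, 2 * pi] (EFin \o (fun a => k * Re (F a))).
  by apply: continuous_integrable_cc => a; apply: cvgMr; exact: Fr.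
have Zi (k : R) : mu.-integrable `[0, 2 * pi] (EFin \o (fun a => k * Im (F a))).
  by apply: continuous_integrable_cc => a; apply: cvgMr; exact: Fi.
rewrite /cintegral; apply/eqP; rewrite eq_complex Re_mul Im_mul [Re (_ +i* _)]/= [Im (_ +i* _)]/=.
apply/andP; split; apply/eqP.
- transitivity (\int[mu]_(a in `[0, 2 * pi]) (Re c * Re (F a) - Im c * Im (F a))).
    by apply: eq_Rintegral => a _; rewrite ReImE.
  by rewrite Ir Ii; apply: RintegralB.
- transitivity (\int[mu]_(a in `[0, 2 * pi]) (Re c * Im (F a) + Im c * Re (F a))).
    by apply: eq_Rintegral => a _; rewrite ReImE.
  by rewrite Ir Ii; apply: RintegralD.
Qed.

Lemma cint_ext F G : (forall a, F a = G a) -> cint F = cint G.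
Proof. by move=> FG; rewrite /cintegral; congr (_ +i* _); apply: eq_Rintegral => a _; rewrite FG. Qed.

(** An unnormalised Fourier coefficient on the circle of radius r, with p a cosine or a sine; the
    weights of the averaging kernel carry the normalisation. *)
Definition mode p U (r : R) : R[i] := cint (fun a => U (pol r a) * (p a)%:C).

Lemma Re_mulr (r : R) (a : R[i]) : Re (a * r%:C) = Re a * r.
Proof. by rewrite mulrC Re_scale mulrC. Qed.

Lemma Im_mulr (r : R) (a : R[i]) : Im (a * r%:C) = Im a * r.
Proof. by rewrite mulrC Im_scale mulrC. Qed.

Definition cC1_on (A : set (R * R)) U (Ux Uy : R * R -> R[i]) :=
  C1_on A (fun z => Re (U z)) (fun z => Re (Ux z)) (fun z => Re (Uy z)) /\
  C1_on A (fun z => Im (U z)) (fun z => Im (Ux z)) (fun z => Im (Uy z)).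

Lemma cmul_ccontinuous F p : ccontinuous F -> continuous p -> ccontinuous (fun a => F a * (p a)%:C).
Proof.
move=> [Fr Fi] pc; split.
- rewrite (_ : (fun a => _) = fun a => Re (F a) * p a); last by apply/funext => a; rewrite Re_mulr.
  by move=> a; apply: cvgM; [exact: Fr|exact: pc].
- rewrite (_ : (fun a => _) = fun a => Im (F a) * p a); last by apply/funext => a; rewrite Im_mulr.
  by move=> a; apply: cvgM; [exact: Fi|exact: pc].
Qed.

Section OnDisk.
Context (rho : R) (U Ux Uy : R * R -> R[i]).
Hypothesis UC1 : cC1_on (disk rho) U Ux Uy.

Lemma mode_continuous_integrand p r : continuous p -> `|r| < rho ->
  ccontinuous (fun a => U (pol r a) * (p a)%:C).
Proof.
move=> pc rr; apply: cmul_ccontinuous => //; split.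
  exact: (w_pol_continuous UC1.1 rr).
exact: (w_pol_continuous UC1.2 rr).
Qed.

Definition cangular r a : R[i] :=
  Ux (pol r a) * (- (r * sin a))%:C + Uy (pol r a) * (r * cos a)%:C.

Lemma cangularE r a :
  Re (cangular r a) = angular (fun z => Re (Ux z)) (fun z => Re (Uy z)) r a /\
  Im (cangular r a) = angular (fun z => Im (Ux z)) (fun z => Im (Uy z)) r a.
Proof. by rewrite /cangular /angular Re_add Im_add !Re_mulr !Im_mulr. Qed.

Lemma cangular_ccontinuous r : `|r| < rho -> ccontinuous (cangular r).
Proof.
move=> rr; split.
- rewrite (_ : (fun a => _) = angular (fun z => Re (Ux z)) (fun z => Re (Uy z)) r).
    exact: (angular_continuous UC1.1 rr).
  by apply/funext => a; rewrite (cangularE r a).1.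
- rewrite (_ : (fun a => _) = angular (fun z => Im (Ux z)) (fun z => Im (Uy z)) r).
    exact: (angular_continuous UC1.2 rr).
  by apply/funext => a; rewrite (cangularE r a).2.
Qed.

Definition cradial r a : R[i] := Ux (pol r a) * (cos a)%:C + Uy (pol r a) * (sin a)%:C.

Lemma mode_derive p r : continuous p -> 0 < r < rho ->
  has_cderive r 1 (mode p U) (cint (fun a => cradial r a * (p a)%:C)).
Proof.
move=> pc rr; split.
- have := pol_integral_derive UC1.1 pc rr.
  have -> : (fun x => Re (mode p U x)) =
      (fun x => \int[mu]_(a in `[0, 2 * pi]) (Re (U (pol x a)) * p a)).
    by apply/funext => x; apply: eq_Rintegral => a _; rewrite Re_mulr.
  move=> d; apply: (has_derive_val d).
  by apply: eq_Rintegral => a _; rewrite Re_mulr Re_add !Re_mulr.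
- have := pol_integral_derive UC1.2 pc rr.
  have -> : (fun x => Im (mode p U x)) =
      (fun x => \int[mu]_(a in `[0, 2 * pi]) (Im (U (pol x a)) * p a)).
    by apply/funext => x; apply: eq_Rintegral => a _; rewrite Im_mulr.
  move=> d; apply: (has_derive_val d).
  by apply: eq_Rintegral => a _; rewrite Im_mulr Im_add !Im_mulr.
Qed.

Lemma mode_by_parts p p' r : `|r| < rho -> (forall a : R, has_derive a 1 p (p' a)) ->
  continuous p' -> p (2 * pi) = p 0 ->
  cint (fun a => cangular r a * (p a)%:C) = - mode p' U r.
Proof.
move=> rr pd p'c p2; apply/eqP; rewrite eq_complex; apply/andP; split; apply/eqP.
- rewrite Re_opp /=; have := pol_by_parts UC1.1 rr pd p'c p2 => H.
  transitivity (\int[mu]_(a in `[0, 2 * pi])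
      (angular (fun z => Re (Ux z)) (fun z => Re (Uy z)) r a * p a)).
    by apply: eq_Rintegral => a _; rewrite Re_mulr (cangularE r a).1.
  by rewrite H; congr (- _); apply: eq_Rintegral => a _; rewrite Re_mulr.
- rewrite Im_opp /=; have := pol_by_parts UC1.2 rr pd p'c p2 => H.
  transitivity (\int[mu]_(a in `[0, 2 * pi])
      (angular (fun z => Im (Ux z)) (fun z => Im (Uy z)) r a * p a)).
    by apply: eq_Rintegral => a _; rewrite Im_mulr (cangularE r a).2.
  by rewrite H; congr (- _); apply: eq_Rintegral => a _; rewrite Im_mulr.
Qed.

Lemma integral_norm_bound (h : R -> R) (M : R) : continuous h -> (forall a, `|h a| <= M) ->
  `|\int[mu]_(a in `[0, 2 * pi]) h a| <= M * (2 * pi).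
Proof.
move=> hc hM.
have hi := continuous_integrable_cc 0 (2 * pi) hc.
apply: le_trans (le_normr_Rintegral _ hi) _ => //.
have -> : M * (2 * pi) = \int[mu]_(a in `[0%R, 2 * pi]) M.
  by rewrite Rintegral_cst //= lebesgue_measure_itv /= lte_fin pi2_gt0 /= oppr0 addr0.
apply: le_Rintegral => //.
- exact: integrable_norm hi.
- by apply: continuous_integrable_cc => a; exact: cvg_cst.
Qed.

Lemma mode_bounded p s : continuous p -> (forall a, `|p a| <= 1) -> 0 < s < rho ->
  exists K : R, forall r : R, 0 < r < s -> normc (mode p U r) <= K.
Proof.
move=> pc p1 /andP[s0 sr].
have [|X X0 HX] := @closed_disk_bound _ rho (fun z => Re (U z)) s sr.
  by move=> z /UC1.1[].
have [|Y Y0 HY] := @closed_disk_bound _ rho (fun z => Im (U z)) s sr.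
  by move=> z /UC1.2[].
exists (X * (2 * pi) + Y * (2 * pi)) => r /andP[r0 rs].
have rr : `|r| < rho by rewrite gtr0_norm //; exact: lt_trans rs sr.
have cr a : cmod (pol r a) <= s by rewrite cmod_pol gtr0_norm // ltW.
have [c1 c2] := mode_continuous_integrand pc rr.
apply: le_trans (ler_normc_ReIm _) _; apply: lerD.
- apply: integral_norm_bound => // a.
  by rewrite Re_mulr normrM -[leRHS]mulr1; apply: ler_pM => //; exact: HX.
- apply: integral_norm_bound => // a.
  by rewrite Im_mulr normrM -[leRHS]mulr1; apply: ler_pM => //; exact: HY.
Qed.

End OnDisk.

Section System.
Context (rho : R) (g : R -> R[i]) (U Ux Uy V Vx Vy : R * R -> R[i]).
Hypotheses (UC1 : cC1_on (disk rho) U Ux Uy) (VC1 : cC1_on (disk rho) V Vx Vy).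
Hypothesis vekua : forall z, 0 < cmod z < rho ->
  Ux z - Vy z = g (cmod z) * ((z.1 / cmod z)%:C * U z + (z.2 / cmod z)%:C * V z) /\
  Uy z + Vx z = g (cmod z) * ((z.2 / cmod z)%:C * U z - (z.1 / cmod z)%:C * V z).

(** Combining the two components with weights cos a and sin a gives r U_r = r g U + V_a and r V_r =
    - r g V - U_a: f is radial, so its gradient enters only through g. *)
Lemma polar_vekua r a : 0 < r < rho ->
  r%:C * cradial Ux Uy r a = r%:C * g r * U (pol r a) + cangular Vx Vy r a /\
  r%:C * cradial Vx Vy r a = - (r%:C * g r * V (pol r a)) - cangular Ux Uy r a.
Proof.
move=> /andP[r0 rr]; have cr : cmod (pol r a) = r by rewrite cmod_pol gtr0_norm.
have [|] := @vekua (pol r a); first by rewrite cr r0.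
rewrite cr /= ![r * _ / r]mulrAC divff ?gt_eqF // !mul1r /cradial /cangular.
have cs : (cos a)%:C * (cos a)%:C + (sin a)%:C * (sin a)%:C = 1 :> R[i].
  by rewrite -!rmorphM -rmorphD /= -!expr2 cos2Dsin2.
move: (U _) (Ux _) (Uy _) (V _) (Vx _) (Vy _) (g r) => u ux uy v vx vy G E1 E2.
rewrite rmorphN !rmorphM /=; split.
- have -> : r%:C * G * u = r%:C * (G * (((cos a)%:C * (cos a)%:C + (sin a)%:C * (sin a)%:C) * u)).
    by rewrite cs mul1r mulrA.
  have -> : r%:C * (ux * (cos a)%:C + uy * (sin a)%:C) =
    r%:C * ((cos a)%:C * (ux - vy) + (sin a)%:C * (uy + vx)) +
    (vx * - (r%:C * (sin a)%:C) + vy * (r%:C * (cos a)%:C)) by ring.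
  by rewrite E1 E2; ring.
- have -> : r%:C * G * v = r%:C * (G * (((cos a)%:C * (cos a)%:C + (sin a)%:C * (sin a)%:C) * v)).
    by rewrite cs mul1r mulrA.
  have -> : r%:C * (vx * (cos a)%:C + vy * (sin a)%:C) =
    r%:C * ((cos a)%:C * (uy + vx) - (sin a)%:C * (ux - vy)) -
    (ux * - (r%:C * (sin a)%:C) + uy * (r%:C * (cos a)%:C)) by ring.
  by rewrite E1 E2; ring.
Qed.

(** The polar equations are integrated against p over a circle, and integration by parts moves the
    angular derivatives to p, which produces the signs. *)
Lemma mode_system p p' r : 0 < r < rho -> (forall a : R, has_derive a 1 p (p' a)) ->
  continuous p' -> p (2 * pi) = p 0 ->
  r%:C * cint (fun a => cradial Ux Uy r a * (p a)%:C) =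
    r%:C * g r * mode p U r - mode p' V r /\
  r%:C * cint (fun a => cradial Vx Vy r a * (p a)%:C) =
    - (r%:C * g r * mode p V r) + mode p' U r.
Proof.
move=> rr pd p'c p2; have [r0 rlt] := andP rr.
have ar : `|r| < rho by rewrite gtr0_norm.
have pc : continuous p by move=> a; exact: has_derive_cont (pd a).
have Uc := mode_continuous_integrand UC1 pc ar.
have Vc := mode_continuous_integrand VC1 pc ar.
have Ua := cmul_ccontinuous (cangular_ccontinuous UC1 ar) pc.
have Va := cmul_ccontinuous (cangular_ccontinuous VC1 ar) pc.
have rad W Wx Wy : cC1_on (disk rho) W Wx Wy -> ccontinuous (fun a => cradial Wx Wy r a * (p a)%:C).
  move=> WC; have H (h : R * R -> R[i]) (q : R -> R) :
      (forall z, disk rho z -> {for z, continuous (fun z => Re (h z))}) ->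
      (forall z, disk rho z -> {for z, continuous (fun z => Im (h z))}) ->
      continuous q -> ccontinuous (fun a => h (pol r a) * (q a)%:C).
    move=> h1 h2 qc; apply: cmul_ccontinuous => //; split.
      exact: (pol_comp_continuous h1 ar).
    exact: (pol_comp_continuous h2 ar).
  apply: cmul_ccontinuous => //.
  have [] := (H Wx cos, H Wy sin).
  move=> H1 H2; have [|||a1 a2] := H1; try exact: continuous_cos.
  - by move=> z /WC.1[].
  - by move=> z /WC.2[].
  have [|||b1 b2] := H2; try exact: continuous_sin.
  - by move=> z /WC.1[].
  - by move=> z /WC.2[].
  split.
  - rewrite (_ : (fun a => _) = fun a => Re (Wx (pol r a) * (cos a)%:C) + Re (Wy (pol r a) * (sin a)%:C)).
      by move=> a; apply: cvgD; [exact: a1|exact: b1].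
    by apply/funext => a; rewrite Re_add.
  - rewrite (_ : (fun a => _) = fun a => Im (Wx (pol r a) * (cos a)%:C) + Im (Wy (pol r a) * (sin a)%:C)).
      by move=> a; apply: cvgD; [exact: a2|exact: b2].
    by apply/funext => a; rewrite Im_add.
have sc (c : R[i]) F : ccontinuous F -> ccontinuous (fun a => c * F a).
  move=> [Fr Fi]; split.
  - rewrite (_ : (fun a => _) = fun a => Re c * Re (F a) - Im c * Im (F a)).
      by move=> a; apply: cvgB; apply: cvgMr; [exact: Fr|exact: Fi].
    by apply/funext => a; rewrite Re_mul.
  - rewrite (_ : (fun a => _) = fun a => Re c * Im (F a) + Im c * Re (F a)).
      by move=> a; apply: cvgD; apply: cvgMr; [exact: Fi|exact: Fr].
    by apply/funext => a; rewrite Im_mul.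
split.
- rewrite -(mode_by_parts VC1 ar pd p'c p2) -!cint_scale //; last exact: rad UC1.
  rewrite -cint_add //; last exact: sc.
  by apply: cint_ext => a; rewrite mulrA (polar_vekua a rr).1; ring.
- have e : mode p' U r = - cint (fun a => cangular Ux Uy r a * (p a)%:C).
    by rewrite (mode_by_parts UC1 ar pd p'c p2) opprK.
  rewrite e -opprD -!cint_scale //; last exact: rad VC1.
  rewrite -cint_add //; last exact: sc.
  rewrite -[- _]mulN1r -cint_scale.
    by apply: cint_ext => a; rewrite mulrA (polar_vekua a rr).2; ring.
  have [s1 s2] := sc (r%:C * g r) _ Vc; have [t1 t2] := Ua.
  split.
  - rewrite (_ : (fun a => _) = fun a => Re (r%:C * g r * (V (pol r a) * (p a)%:C)) +
        Re (cangular Ux Uy r a * (p a)%:C)).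
      by move=> a; apply: cvgD; [exact: s1|exact: t1].
    by apply/funext => a; rewrite Re_add.
  - rewrite (_ : (fun a => _) = fun a => Im (r%:C * g r * (V (pol r a) * (p a)%:C)) +
        Im (cangular Ux Uy r a * (p a)%:C)).
      by move=> a; apply: cvgD; [exact: s2|exact: t2].
    by apply/funext => a; rewrite Im_add.
Qed.

End System.

End Modes.

(** * Solutions of the mode system that stay bounded at the origin *)

Section BoundedSolutions.
Context {R : realType} (rho M : R) (g : R -> R[i]).
Hypotheses (rho0 : 0 < rho) (gM : forall r : R, 0 < r < rho -> normc (g r) <= M).

(* u and v are the coefficients of cos (n t) and sin (n t) in Sc W and Vec W. *)
Definition mode_solution (n : nat) (u v u1 v1 : R -> R[i]) := forall r : R, 0 < r < rho ->
  [/\ has_cderive r 1 u (u1 r), has_cderive r 1 v (v1 r),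
      r%:C * u1 r = r%:C * g r * u r + n%:R * v r &
      r%:C * v1 r = - (r%:C * g r * v r) + n%:R * u r].

Definition bounded0 (u : R -> R[i]) :=
  exists s K : R, 0 < s /\ forall r : R, 0 < r < s -> normc (u r) <= K.

Let rC (r : R) : 0 < r < rho -> r%:C != 0 :> R[i].
Proof. by move=> /andP[r0 _]; rewrite (inj_eq (@complexI R)) gt_eqF. Qed.

Lemma mode_solution_unique n u v u1 v1 (r0 : R) : mode_solution n u v u1 v1 ->
  0 < r0 < rho -> u r0 = 0 -> v r0 = 0 ->
  forall r : R, 0 < r < rho -> u r = 0 /\ v r = 0.
Proof.
move=> S /andP[r00 r0r] ur0 vr0 r /andP[rp rr].
pose a := Num.min r r0; pose b := Num.max r r0.
have a0 : 0 < a by rewrite lt_min rp.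
have br : b < rho by rewrite gt_max rr.
have sub x : a <= x <= b -> 0 < x < rho.
  by move=> /andP[ax xb]; rewrite (lt_le_trans a0 ax) (le_lt_trans xb br).
apply: (@system_unique _ n%:R a b r0 M g u v u1 v1 a0 _ _ _ _ _ _ ur0 vr0).
- by move=> x /sub/gM.
- by move=> x /sub/S[].
- by move=> x /sub/S[].
- by move=> x /sub/S[_ _ -> _]; rewrite rmorph_nat.
- by move=> x /sub/S[_ _ _ ->]; rewrite rmorph_nat.
- by rewrite ge_min le_max !lexx ?orbT.
- by rewrite ge_min le_max !lexx ?orbT.
Qed.

Lemma mode_solution_lin n u v u1 v1 u' v' u1' v1' (c : R[i]) :
  mode_solution n u v u1 v1 -> mode_solution n u' v' u1' v1' ->
  mode_solution n (fun r => u r - c * u' r) (fun r => v r - c * v' r)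
    (fun r => u1 r - c * u1' r) (fun r => v1 r - c * v1' r).
Proof.
move=> S S' r rr; have [d1 d2 e1 e2] := S r rr; have [d1' d2' e1' e2'] := S' r rr.
have cd (w : R -> R[i]) (w1 : R[i]) : has_cderive r 1 w w1 -> has_cderive r 1 (fun x => c * w x) (c * w1).
  move=> d; apply: has_cderive_eq; first exact: (has_cderive_mul (has_cderive_const c r 1) d).
  by rewrite mul0r add0r.
split.
- exact: (has_cderive_sub d1 (cd _ _ d1')).
- exact: (has_cderive_sub d2 (cd _ _ d2')).
- by rewrite mulrBr mulrCA e1 e1'; ring.
- by rewrite mulrBr mulrCA e2 e2'; ring.
Qed.

Context (F F1 Q Q1 : R -> R[i]) (n : nat).
Hypotheses (FP : radial_profile rho F F1) (QP : radial_profile rho Q Q1)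
  (S1 : forall r : R, 0 < r < rho ->
     r%:C * F1 r + n%:R * F r - r%:C * g r * F r = n%:R * Q r)
  (S2 : forall r : R, 0 < r < rho ->
     r%:C * Q1 r + n%:R * Q r + r%:C * g r * Q r = n%:R * F r).

Let A r : R[i] := F r * (r ^+ n)%:C.
Let B r : R[i] := Q r * (r ^+ n)%:C.
Let A1 r : R[i] := F1 r * (r ^+ n)%:C + F r * (n%:R * r ^+ n.-1)%:C.
Let B1 r : R[i] := Q1 r * (r ^+ n)%:C + Q r * (n%:R * r ^+ n.-1)%:C.

Lemma profile_mode_solution : mode_solution n A B A1 B1.
Proof.
move=> r rr; have [_ _ Fd _ _] := FP; have [_ _ Qd _ _] := QP.
have pd : has_cderive r 1 (fun x : R => (x ^+ n)%:C) (n%:R * r ^+ n.-1)%:C.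
  exact: (has_cderive_real (has_derive_pow n r)).
have rn : r%:C * (n%:R * r ^+ n.-1)%:C = n%:R * (r ^+ n)%:C :> R[i].
  rewrite -rmorphM /= -(rmorph_nat (real_complex R) n) -rmorphM /=.
  by case: (n) => [|m] /=; rewrite ?mul0r ?mulr0 // exprS mulrCA.
split.
- exact: (has_cderive_mul (Fd r rr) pd).
- exact: (has_cderive_mul (Qd r rr) pd).
- rewrite /A1 mulrDr [r%:C * (F r * _)]mulrCA rn /A /B.
  have -> : n%:R * (Q r * (r ^+ n)%:C) = n%:R * Q r * (r ^+ n)%:C by ring.
  by rewrite -S1 //; ring.
- rewrite /B1 mulrDr [r%:C * (Q r * _)]mulrCA rn /A /B.
  have -> : n%:R * (F r * (r ^+ n)%:C) = n%:R * F r * (r ^+ n)%:C by ring.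
  by rewrite -S2 //; ring.
Qed.

Lemma profile_neq0_near (P P1 : R -> R[i]) : radial_profile rho P P1 ->
  exists r0 : R, 0 < r0 < rho /\ P r0 != 0.
Proof.
move=> [[P0 [P0r _] PE] P01 _ _ _].
have p0 : Re (P0 0) = 1 by rewrite -PE ?lexx ?ltW // P01.
have /cvgrPdist_lt/(_ _ ltr01)/nbhs_ballP[d /= d0 H] := P0r 0.
pose r0 := Num.min (d / 2) (rho / 2).
have [r00 r0d r0r] : [/\ 0 < r0, r0 < d & r0 < rho].
  split; first by rewrite lt_min !divr_gt0.
  - by apply: le_lt_trans (_ : d / 2 < _); [rewrite ge_min lexx|lra].
  - by apply: le_lt_trans (_ : rho / 2 < _); [rewrite ge_min lexx orbT|rewrite ltr_pdivrMr // ltr_pMr // ltr1n].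
exists r0; rewrite r00 r0r; split=> //; rewrite PE; last by rewrite !ltW.
apply/eqP => z; suff : (1 : R) < 1 by rewrite ltxx.
have := H r0; rewrite p0 z /= subr0 normr1; apply.
by rewrite /ball /= sub0r normrN gtr0_norm.
Qed.

Lemma profile_bounded (P P1 : R -> R[i]) : radial_profile rho P P1 ->
  exists2 K : R, 0 <= K & forall r : R, 0 < r < rho -> normc (P r) <= K.
Proof.
move=> [[P0 [P0r P0i] PE] _ _ _ _].
have [X X0 HX] := continuous_itv_bound P0r 0 rho.
have [Y Y0 HY] := continuous_itv_bound P0i 0 rho.
exists (X + Y) => [|r /andP[r0 rr]]; first exact: addr_ge0.
have rr' : 0 <= r <= rho by rewrite !ltW.
rewrite PE //; apply: le_trans (ler_normc_ReIm _) _.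
by apply: lerD; [exact: HX|exact: HY].
Qed.

(** The matrix of the system has trace zero, so u B - v A is constant. It tends to 0 at 0 because A
    and B are O(r^n) with n > 0 while u and v stay bounded; this is where boundedness excludes the
    second, singular solution. *)
Lemma wronskian0 (u v u1 v1 : R -> R[i]) : (0 < n)%N -> mode_solution n u v u1 v1 ->
  bounded0 u -> bounded0 v -> forall r : R, 0 < r < rho -> u r * B r = v r * A r.
Proof.
move=> n0 S [s [K [s0 uK]]] [s' [K' [s'0 vK]]].
have P := profile_mode_solution.
pose W r := u r * B r - v r * A r.
have Wd (r : R) : 0 < r < rho -> has_cderive r 1 W 0.
  move=> rr; have [d1 d2 e1 e2] := S r rr; have [d1' d2' e1' e2'] := P r rr.
  apply: has_cderive_eq; first exact: (has_cderive_sub (has_cderive_mul d1 d2') (has_cderive_mul d2 d1')).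
  apply: (mulfI (rC rr)); rewrite mulr0.
  have -> : r%:C * (u1 r * B r + u r * B1 r - (v1 r * A r + v r * A1 r)) =
    (r%:C * u1 r) * B r + u r * (r%:C * B1 r) - ((r%:C * v1 r) * A r + v r * (r%:C * A1 r)) by ring.
  by rewrite e1 e2 e1' e2'; ring.
have [KF KF0 FK] := profile_bounded FP; have [KQ KQ0 QK] := profile_bounded QP.
have W0 : lim0 W.
  pose d := Num.min 1 (Num.min rho (Num.min s s')).
  have d0 : 0 < d by rewrite !lt_min ltr01 rho0 s0.
  have [d1 dr ds ds'] : [/\ d <= 1, d <= rho, d <= s & d <= s'].
    by rewrite /d; split; rewrite !ge_min lexx ?orbT.
  apply: (@lim0_Or _ _ d (`|K| * KQ + `|K'| * KF)) => // r /andP[r0 rd].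
  have rn : r ^+ n <= r.
    rewrite -[leRHS]expr1; apply: ler_wiXn2l => //; first exact: ltW.
    by apply: le_trans (ltW rd) _.
  have rr : 0 < r < rho by rewrite r0; exact: lt_le_trans dr.
  have rn0 : 0 <= r ^+ n by rewrite exprn_ge0 // ltW.
  apply: le_trans (ler_normcD _ _) _; rewrite normcN !Normc.normcM mulrDl.
  rewrite !normcR (ger0_norm rn0); apply: lerD; rewrite -!mulrA; apply: ler_pM; rewrite ?normc_ge0 //.
  - by rewrite mulr_ge0 ?normc_ge0.
  - by apply: le_trans (ler_norm K); apply: uK; rewrite r0; exact: lt_le_trans ds.
  - by apply: ler_pM; rewrite ?normc_ge0 //; exact: QK.
  - by rewrite mulr_ge0 ?normc_ge0.
  - by apply: le_trans (ler_norm K'); apply: vK; rewrite r0; exact: lt_le_trans ds'.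
  - by apply: ler_pM; rewrite ?normc_ge0 //; exact: FK.
have z (h : R -> R) : (forall r : R, 0 < r < rho -> has_derive r 1 h 0) ->
    h r @[r --> 0^'+] --> 0 -> forall r : R, 0 < r < rho -> h r = 0.
  move=> hd h0 r rr; apply/eqP; rewrite eq_le; apply/andP; split.
    exact: (derive_le0_lim0 hd (fun _ _ => lexx _) h0 rr).
  rewrite -oppr_le0; apply: (@derive_le0_lim0 _ rho (fun x => - h x) (fun=> - 0)) rr.
  - by move=> x xr; apply: has_derive_opp; exact: hd.
  - by move=> x _; rewrite oppr0.
  - by rewrite -[X in _ --> X]oppr0; exact: cvgN.
move=> r rr; apply/eqP; rewrite -subr_eq0; apply/eqP/eqP; rewrite -/(W r) eq_complex /=.
apply/andP; split; apply/eqP.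
- apply: (z (fun r => Re (W r)) _ (lim0_Re W0)) rr => x xr; exact: (Wd x xr).1.
- apply: (z (fun r => Im (W r)) _ (lim0_Im W0)) rr => x xr; exact: (Wd x xr).2.
Qed.

(** The constant matches the first components at a radius where F does not vanish. The zero
    Wronskian then matches the second components there, and uniqueness from that radius does the
    rest. *)
Lemma bounded_mode_solution (u v u1 v1 : R -> R[i]) : (0 < n)%N ->
  mode_solution n u v u1 v1 -> bounded0 u -> bounded0 v ->
  exists c, forall r : R, 0 < r < rho ->
    u r = c * (F r * (r ^+ n)%:C) /\ v r = c * (Q r * (r ^+ n)%:C).
Proof.
move=> n0 S ub vb; have W := wronskian0 n0 S ub vb.
have [r0 [r0r Fr0]] := profile_neq0_near FP.
have Ar0 : A r0 != 0.
  rewrite /A mulf_neq0 // (inj_eq (@complexI R)) expf_neq0 //.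
  by case/andP: r0r => [r00 _]; rewrite gt_eqF.
exists (u r0 / A r0) => r rr.
have [||] := mode_solution_unique (mode_solution_lin (u r0 / A r0) S profile_mode_solution) r0r _ _ rr.
- by rewrite divfK // subrr.
- by rewrite mulrAC W // mulfK // subrr.
by move=> /subr0_eq -> /subr0_eq ->.
Qed.

(** For n = 0 the system decouples: (u, 0) and (0, v) are solutions by themselves and are compared
    with (F, 0) and (0, Q), each with its own constant. *)
Lemma bounded_mode_solution0 (u v u1 v1 : R -> R[i]) : n = 0%N ->
  mode_solution n u v u1 v1 ->
  exists c d, forall r : R, 0 < r < rho -> u r = c * F r /\ v r = d * Q r.
Proof.
move=> n0 S; have P := profile_mode_solution.
have AE r : A r = F r by rewrite /A n0 expr0 mulr1.
have BE r : B r = Q r by rewrite /B n0 expr0 mulr1.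
have [r0 [r0r Fr0]] := profile_neq0_near FP.
have [r0' [r0r' Qr0]] := profile_neq0_near QP.
exists (u r0 / F r0), (v r0' / Q r0') => r rr.
have Z : forall r, 0 < r < rho -> has_cderive r 1 (fun=> 0) (0 : R[i]).
  by move=> x _; exact: has_cderive_const.
have left w z w1 z1 : mode_solution n w z w1 z1 -> mode_solution n w (fun=> 0) w1 (fun=> 0).
  move=> T x xr; have [d1 _ e1 _] := T x xr; split.
  - exact: d1.
  - exact: Z.
  - by rewrite e1 n0 !mul0r.
  - by rewrite n0 mul0r !mulr0 oppr0 addr0.
have right w z w1 z1 : mode_solution n w z w1 z1 -> mode_solution n (fun=> 0) z (fun=> 0) z1.
  move=> T x xr; have [_ d2 _ e2] := T x xr; split.
  - exact: Z.
  - exact: d2.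
  - by rewrite n0 mul0r !mulr0 addr0.
  - by rewrite e2 n0 !mul0r.
split.
- have [||] := mode_solution_unique
    (mode_solution_lin (u r0 / F r0) (left _ _ _ _ S) (left _ _ _ _ P)) r0r _ _ rr.
  + by rewrite AE divfK // subrr.
  + by rewrite mulr0 subr0.
  by rewrite AE => /subr0_eq.
- have [||] := mode_solution_unique
    (mode_solution_lin (v r0' / Q r0') (right _ _ _ _ S) (right _ _ _ _ P)) r0r' _ _ rr.
  + by rewrite mulr0 subr0.
  + by rewrite BE divfK // subrr.
  by rewrite BE => _ /subr0_eq.
Qed.

End BoundedSolutions.

(** * Averages over rotations *)

Section Kernel.
Context {R : realType}.
Notation mu := (@lebesgue_measure R).
Local Notation int h := (\int[mu]_(a in `[0, 2 * pi]) h a).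
Implicit Types (w : R * R -> R) (a t : R) (N n : nat).

Let cpow N a : R := (1 + cos a) ^+ N.
Let mass N := int (cpow N).

Lemma cos_int_period : cos (2 * pi) = 1 :> R /\ sin (2 * pi) = 0 :> R.
Proof. by rewrite !mulr_natl -[pi *+ 2]add0r cosD2pi sinD2pi cos0 sin0. Qed.

Lemma one_cos_derive a : has_derive a 1 (fun x => 1 + cos x) (- sin a).
Proof.
apply: has_derive_val.
  exact: (has_derive_add (has_derive_const 1 a 1) (is_derive_cos a : has_derive a 1 cos (- sin a))).
by rewrite add0r.
Qed.

Let cpow_derive N a : has_derive a 1 (cpow N) (N%:R * (1 + cos a) ^+ N.-1 * - sin a).
Proof. exact: (has_derive_chain (one_cos_derive a) (has_derive_pow N (1 + cos a))). Qed.

Let cpow_continuous N : continuous (cpow N).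
Proof. by move=> a; exact: has_derive_cont (cpow_derive N a). Qed.

Let cpow_ge0 N a : 0 <= cpow N a.
Proof. by rewrite exprn_ge0 // -lerBlDl sub0r cos_geN1. Qed.

Lemma int_lin (h k : R -> R) (x y : R) : continuous h -> continuous k ->
  int (fun a => x * h a + y * k a) = x * int h + y * int k.
Proof.
move=> hc kc.
have hi := continuous_integrable_cc 0 (2 * pi) hc.
have ki := continuous_integrable_cc 0 (2 * pi) kc.
rewrite -!RintegralZl //; apply: RintegralD => //; exact: integrable_scale.
Qed.

(* Integrate the derivative of [sin a * (1 + cos a) ^+ N]. *)
Lemma mass_rec N : N.+1%:R * mass N.+1 = (2 * N + 1)%:R * mass N.
Proof.
have sc : continuous (fun a : R => sin a * cpow N a).
  by move=> a; apply: cvgM; [exact: continuous_sin|exact: cpow_continuous].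
have dc : continuous (fun a : R => N.+1%:R * cpow N.+1 a + - (2 * N + 1)%:R * cpow N a).
  by move=> a; apply: cvgD; apply: cvgMr; exact: cpow_continuous.
have := FTC2 (pi2_gt0 : 0 < 2 * pi :> R) sc dc.
rewrite int_lin; try exact: cpow_continuous.
rewrite cos_int_period.2 sin0 !mul0r subr0 mulNr => /(_ _)/subr0_eq; apply.
move=> a _; apply: has_derive_val.
  exact: (has_derive_mul (is_derive_sin a : has_derive a 1 sin (cos a)) (cpow_derive N a)).
rewrite /cpow; have s2 : sin a * sin a = (1 - cos a) * (1 + cos a).
  by have := cos2Dsin2 a; rewrite !expr2 => e; rewrite -[LHS](addKr (cos a * cos a)) e; ring.
case: N {sc dc} => [|N] /=; first by rewrite !expr0 expr1; ring.
have -> : sin a * (N.+1%:R * (1 + cos a) ^+ N * - sin a) =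
  - (N.+1%:R * (1 + cos a) ^+ N * (sin a * sin a)) by ring.
by rewrite s2 !exprS; ring.
Qed.

Lemma mass_gt0 N : 0 < mass N.
Proof.
elim: N => [|N IH].
  have -> : mass 0 = int (fun=> 1) by apply: eq_Rintegral => a _; rewrite /cpow expr0.
  by rewrite Rintegral_cst //= lebesgue_measure_itv /= lte_fin pi2_gt0 /= oppr0 addr0 mul1r pi2_gt0.
have : 0 < N.+1%:R * mass N.+1 by rewrite mass_rec mulr_gt0 // ltr0n addn1.
by rewrite pmulr_rgt0.
Qed.

Definition kern N a : R := (mass N)^-1 * cpow N a.

Lemma kern_continuous N : continuous (kern N).
Proof. by move=> a; apply: cvgMr; exact: cpow_continuous. Qed.

Lemma kern_ge0 N a : 0 <= kern N a.
Proof. by rewrite mulr_ge0 // invr_ge0 ltW // mass_gt0. Qed.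

Lemma kern_mass N : int (kern N) = 1.
Proof.
transitivity (int (fun a => (mass N)^-1 * cpow N a + 0 * cpow N a)).
  by apply: eq_Rintegral => a _; rewrite mul0r addr0.
rewrite int_lin; try exact: cpow_continuous.
by rewrite mul0r addr0 mulVf // gt_eqF // mass_gt0.
Qed.

(** As 1 - cos a = 2 - (1 + cos a), the moment is 2 minus the ratio of consecutive masses, that is 2
    - (2N + 1)/(N + 1). *)
Lemma kern_moment N : int (fun a => kern N a * (1 - cos a)) = N.+1%:R^-1.
Proof.
transitivity (int (fun a => (mass N)^-1 * 2 * cpow N a + - (mass N)^-1 * cpow N.+1 a)).
  by apply: eq_Rintegral => a _; rewrite /kern /cpow exprS; ring.
rewrite int_lin; try exact: cpow_continuous.
rewrite -!/(mass _); have e := mass_rec N; have := mass_gt0 N; have n0 : N.+1%:R != 0 :> R by rewrite pnatr_eq0.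
have -> : mass N.+1 = (2 * N + 1)%:R * mass N / N.+1%:R by rewrite -e mulrAC divff // mul1r.
move=> /lt0r_neq0 m0; rewrite natrD natrM.
have -> : N.+1%:R = N%:R + 1 :> R by rewrite -natr1.
by move: n0; rewrite -natr1 => n0; field; rewrite n0 m0.
Qed.

Lemma kern_derive N a : has_derive a 1 (kern N)
  ((mass N)^-1 * (N%:R * (1 + cos a) ^+ N.-1 * - sin a)).
Proof.
apply: has_derive_val; first exact: (has_derive_mul (has_derive_const (mass N)^-1 a 1) (cpow_derive N a)).
by rewrite mul0r add0r.
Qed.

Lemma cpow_trig N : exists k : nat -> R, forall a,
  cpow N a = \sum_(n < N.+1) k n * cos (n%:R * a).
Proof.
elim: N => [|N [k kE]].
  by exists (fun=> 1) => a; rewrite big_ord1 /cpow expr0 mul0r cos0 mulr1.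
have prod n a : cos a * cos (n%:R * a) = 2^-1 * cos (n.+1%:R * a) + 2^-1 * cos ((n%:R - 1) * a).
  have -> : n.+1%:R * a = n%:R * a + a by rewrite -natr1; ring.
  have -> : (n%:R - 1) * a = n%:R * a - a by ring.
  by rewrite cosD cosB; field.
(* Row n lists the cosine coefficients of (1 + cos a) cos (n a). For n = 0 the product formula
   yields cos (-a) = cos a, hence the index 1 in place of n - 1. *)
pose f (n m : nat) : R := (m == n)%:R + 2^-1 * (m == n.+1)%:R +
   2^-1 * (m == (if n is 0 then 1 else n.-1))%:R.
have pick a (j : nat) : (j < N.+2)%N ->
    \sum_(m < N.+2) (m == j :> nat)%:R * cos (m%:R * a) = cos (j%:R * a).
  move=> jN; rewrite (bigD1 (Ordinal jN)) //= eqxx mul1r big1 ?addr0 // => i ij.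
  by case: eqP => [e|]; rewrite ?mul0r //; case/eqP: ij; apply: val_inj.
exists (fun m => \sum_(n < N.+1) k n * f n m) => a.
rewrite /cpow exprS -/(cpow N a) kE mulr_sumr.
under [RHS]eq_bigr do rewrite mulr_suml.
rewrite exchange_big /=; apply: eq_bigr => n _.
under eq_bigr do rewrite -mulrA.
rewrite -mulr_sumr mulrCA; congr (_ * _).
have -> : \sum_(m < N.+2) f n m * cos (m%:R * a) =
    \sum_(m < N.+2) (m == n :> nat)%:R * cos (m%:R * a) +
    2^-1 * \sum_(m < N.+2) (m == n.+1 :> nat)%:R * cos (m%:R * a) +
    2^-1 * \sum_(m < N.+2) (m == (if (n : nat) is 0 then 1 else n.-1)%N :> nat)%:R * cos (m%:R * a).
  rewrite !mulr_sumr -!big_split /=; apply: eq_bigr => m _; rewrite /f; ring.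
have nN := ltn_ord n; have nN2 : (n < N.+2)%N by rewrite ltnW.
have pN : ((if (n : nat) is 0 then 1 else n.-1) < N.+2)%N.
  by case: (n : nat) nN2 => [|j] //= jN; rewrite ltnW.
rewrite (pick _ _ nN2) (pick _ n.+1) ?ltnS // (pick _ _ pN).
rewrite mulrDl mul1r prod addrA; congr (_ + _ * _).
case: (n : nat) => [|j] /=; first by rewrite sub0r mulN1r cosN mul1r.
by rewrite -natr1 addrK.
Qed.

Lemma kern_trig N : exists k : nat -> R, forall a,
  kern N a = \sum_(n < N.+1) k n * cos (n%:R * a).
Proof.
have [k kE] := cpow_trig N; exists (fun n => (mass N)^-1 * k n) => a.
by rewrite /kern kE mulr_sumr; apply: eq_bigr => n _; rewrite mulrA.
Qed.

Definition avg N w (z : R * R) : R := int (fun a => kern N a * w (plane_rot (cos a) (sin a) z)).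

Lemma int_sum (m : nat) (h : nat -> R -> R) : (forall n, continuous (h n)) ->
  int (fun a => \sum_(n < m) h n a) = \sum_(n < m) int (h n).
Proof.
move=> hc; elim: m => [|m IH].
  rewrite big_ord0 -[RHS](mul0r (fine (mu `[0%R, 2 * pi]%classic))) -Rintegral_cst //.
  by apply: eq_Rintegral => a _; rewrite big_ord0.
have sc : continuous (fun a => \sum_(n < m) h n a).
  elim: m {IH} => [|m IH] a.
    rewrite (_ : (fun a => _) = fun=> 0); first exact: cvg_cst.
    by apply/funext => b; rewrite big_ord0.
  rewrite (_ : (fun a => _) = fun a => \sum_(n < m) h n a + h m a).
    by apply: cvgD; [exact: IH|exact: hc].
  by apply/funext => b; rewrite big_ord_recr.
rewrite big_ord_recr /= -IH.
have := int_lin 1 1 sc (hc m); rewrite !mul1r => <-.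
by apply: eq_Rintegral => a _; rewrite big_ord_recr /= !mul1r.
Qed.

Lemma cos_nat_continuous n : continuous (fun a : R => cos (n%:R * a)).
Proof.
move=> a; apply: (@continuous_comp _ _ _ (fun x : R => n%:R * x) cos); last exact: continuous_cos.
by apply: cvgMr; exact: cvg_id.
Qed.

Lemma sin_nat_continuous n : continuous (fun a : R => sin (n%:R * a)).
Proof.
move=> a; apply: (@continuous_comp _ _ _ (fun x : R => n%:R * x) sin); last exact: continuous_sin.
by apply: cvgMr; exact: cvg_id.
Qed.

(** Shifting the angle by t moves the point into the kernel, and the addition formula separates t
    from the integration variable. The weights [k] are chosen before [w], so the four real
    components of a Bicomplex function share them. *)
Lemma avg_modes N : exists k : nat -> R, forall (rho : R) w wx wy,
  C1_on (disk rho) w wx wy -> forall r t, `|r| < rho ->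
  avg N w (pol r t) = \sum_(n < N.+1) k n *
    (cos (n%:R * t) * int (fun a => w (pol r a) * cos (n%:R * a)) +
     sin (n%:R * t) * int (fun a => w (pol r a) * sin (n%:R * a))).
Proof.
have [k kE] := kern_trig N; exists k => rho w wx wy wC r t rr.
pose K a := kern N (a - t).
pose K' a := (mass N)^-1 * (N%:R * (1 + cos (a - t)) ^+ N.-1 * - sin (a - t)).
have sh : continuous (fun a : R => a - t).
  by move=> a; apply: cvgB; [exact: cvg_id|exact: cvg_cst].
have Kd a : has_derive a 1 K (K' a).
  apply: has_derive_val.
    exact: (has_derive_chain (has_derive_sub (has_derive_ident a) (has_derive_const t a 1)) (kern_derive N (a - t))).
  by rewrite subr0 mulr1.
have K'c : continuous K'.
  have c1 : continuous (fun a : R => (mass N)^-1 * (N%:R * (1 + cos a) ^+ N.-1 * - sin a)).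
    move=> a; apply: cvgMr; apply: cvgM; last by apply: cvgN; exact: continuous_sin.
    apply: cvgMr; exact: (@cpow_continuous N.-1 a).
  by move=> a; exact: (continuous_comp (sh a) (c1 (a - t))).
have wd a := pol_derive_a wC a rr.
have wc := w_pol_continuous wC rr.
have ac := angular_continuous wC rr.
have Kc : continuous K by move=> a; exact: has_derive_cont (Kd a).
transitivity (int (fun a => K (a + t) * w (pol r (a + t)))).
  by apply: eq_Rintegral => a _; rewrite pol_rot /K addrK [t + a]addrC.
rewrite (@periodic_shift _ (fun a => K a * w (pol r a))
  (fun a => K' a * w (pol r a) + K a * angular wx wy r a) (2 * pi) t pi2_gt0); first last.
- move=> a; rewrite pol_periodic /K /kern /cpow; congr (_ * (1 + _) ^+ _ * _).
  by rewrite addrAC mulr_natl cosD2pi.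
- move=> a; apply: cvgD; apply: cvgM; [exact: K'c|exact: wc|exact: Kc|exact: ac].
- by move=> a; exact: (has_derive_mul (Kd a) (wd a)).
have cc n : continuous (fun a => w (pol r a) * cos (n%:R * a)).
  by move=> a; apply: cvgM; [exact: wc|exact: cos_nat_continuous].
have cs n : continuous (fun a => w (pol r a) * sin (n%:R * a)).
  by move=> a; apply: cvgM; [exact: wc|exact: sin_nat_continuous].
transitivity (int (fun a => \sum_(n < N.+1)
    (k n * cos (n%:R * t) * (w (pol r a) * cos (n%:R * a)) +
     k n * sin (n%:R * t) * (w (pol r a) * sin (n%:R * a))))).
  apply: eq_Rintegral => a _; rewrite /K kE mulr_suml; apply: eq_bigr => n _.
  by rewrite mulrBr cosB; ring.
rewrite (@int_sum N.+1 (fun n a => k n * cos (n%:R * t) * (w (pol r a) * cos (n%:R * a)) +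
     k n * sin (n%:R * t) * (w (pol r a) * sin (n%:R * a)))).
  apply: eq_bigr => n _; rewrite (int_lin _ _ (cc n) (cs n)).
  by move: (Rintegral _ _ _) (Rintegral _ _ _) => x y; ring.
by move=> n a; apply: cvgD; apply: cvgMr; [exact: cc|exact: cs].
Qed.

End Kernel.

Section SigmaFiniteArea.
Context {R : realType}.
Local Notation T1 := (measurableTypeR R).
Local Notation T2 := (measurableTypeR R * measurableTypeR R)%type.

Lemma area_sigma_finite : sigma_finite [set: T2] (@area R).
Proof.
exists (fun i => disk i.+1%:R); last first.
  move=> i; split; first exact: disk_measurable.
  by rewrite [X in (X < _)%E]area_disk ?ltry // ltr0n.
apply/seteqP; split => // z _; exists (Num.truncn (cmod z)) => //.
by rewrite /disk /=; exact: truncnS_gt.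
Qed.

(* On [mu \x mu] itself the library only infers sigma-finiteness from that of
   finite measures, hence the alias. *)
Definition plane_area : set T2 -> \bar R := (@lebesgue_measure R \x @lebesgue_measure R)%E.

HB.instance Definition _ := Measure.copy plane_area (@area R).

HB.instance Definition _ :=
  Measure_isSigmaFinite.Build _ T2 R plane_area area_sigma_finite.

End SigmaFiniteArea.

(** * Convergence of the averages in the mean square *)

Section Averages.
Context {R : realType} (rho : R) (w wx wy : R * R -> R).
Notation mu := (@lebesgue_measure R).
Local Notation T1 := (measurableTypeR R).
Local Notation T2 := (measurableTypeR R * measurableTypeR R)%type.
Hypotheses (rho0 : 0 < rho) (wC1 : C1_on (disk rho) w wx wy)
  (wL2 : area.-integrable (disk rho : set T2) (EFin \o (fun z => w z ^+ 2))).

(** Extension by zero gives a function measurable on the whole plane, so that Tonelli and rotation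
    invariance apply without a domain. *)
Let w0 : R * R -> R := w \_ (disk rho).

Let w0E z : disk rho z -> w0 z = w z.
Proof. by move=> zr; rewrite /w0 patchE mem_set. Qed.

Let w0_out z : ~ disk rho z -> w0 z = 0.
Proof. by move=> zr; rewrite /w0 patchE memNset. Qed.

Lemma restrict_disk_measurable : measurable_fun [set: T2] (w0 : T2 -> T1).
Proof.
apply/(measurable_restrictT _ (@disk_measurable R rho)).
by apply: continuous_measurable_plane => [|z /wC1[]]; first exact: disk_open.
Qed.
Let mw0 := restrict_disk_measurable.

Let mrot (c s : R) : measurable_fun [set: T2] ((fun z => w0 (plane_rot c s z)) : T2 -> T1).
Proof. exact: (measurableT_comp mw0 (@measurable_rot R c s)). Qed.

Let E z : \bar R := (w0 z ^+ 2)%:E.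

Let mE : measurable_fun [set: T2] E.
Proof. by apply/measurable_EFinP; exact: measurable_funX mw0. Qed.

Let E0 z : (0 <= E z)%E.
Proof. by rewrite lee_fin sqr_ge0. Qed.

Let tot_fin : (\int[area]_z E z < +oo)%E.
Proof.
have /integrableP[_] := wL2; apply: le_lt_trans.
rewrite [leRHS]integral_mkcond; apply: ge0_le_integral => //.
- apply: (proj1 (measurable_restrictT _ (@disk_measurable R rho))).
  by apply: measurableT_comp => //; case/integrableP: wL2.
- move=> z _; rewrite patchE; case: ifPn => [|/negP]; rewrite inE => zr.
    by rewrite /= ger0_norm ?sqr_ge0 // /E w0E.
  by rewrite /E w0_out // expr0n.
Qed.

(** The disks of radius rho (1 - 1/(i + 2)) increase to the open disk, and their integrals converge
    to the finite total by monotone convergence; the shift by 2 keeps every radius positive. *)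
Lemma tail_small (eta : R) : 0 < eta -> exists2 s, 0 < s < rho &
  (\int[area]_(z in ~` (disk s : set T2)) E z <= eta%:E)%E.
Proof.
move=> eta0; pose rs (i : nat) : R := rho * (1 - i.+2%:R^-1).
have rs_in i : 0 < rs i < rho.
  have h : 0 < (i.+2%:R : R)^-1 < 1 by rewrite invr_gt0 ltr0n /= invf_lt1 ?ltr0n // ltr1n.
  by move/andP: h => [h1 h2]; rewrite /rs mulr_gt0 ?subr_gt0 //= gtr_pMr // ltrBlDr ltrDl.
pose F i : set T2 := disk (rs i).
have mF i : measurable (F i) by exact: disk_measurable.
have Fm : {homo F : n m / (n <= m)%N >-> (n <= m)%O}.
  move=> n m nm; apply/subsetPset => z /= zn; rewrite /F /disk /=.
  apply: lt_le_trans zn _; rewrite /rs ler_pM2l // lerD2l lerN2 lef_pV2 ?posrE ?ltr0n //.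
  by rewrite ler_nat.
have FU : \bigcup_i F i = (disk rho : set T2).
  apply/seteqP; split => z.
    by move=> [i _] zi; apply: lt_trans zi _; case/andP: (rs_in i).
  rewrite /disk /= => zr; pose k := Num.truncn (rho / (rho - cmod z)).
  exists k => //; rewrite /F /disk /= /rs.
  have rz : 0 < rho - cmod z by rewrite subr_gt0.
  have : rho / (rho - cmod z) < k.+1%:R by exact: truncnS_gt.
  rewrite ltr_pdivrMr // => kk.
  have k2 : 0 < k.+2%:R :> R by rewrite ltr0n.
  have kk2 : rho < k.+2%:R * (rho - cmod z).
    by apply: lt_le_trans kk _; rewrite ler_pM2r // ler_nat.
  rewrite mulrBr mulr1 ltrBrDr -ltrBrDl ltr_pdivrMr //.
  by rewrite mulrC.
have cv := @ge0_nondecreasing_set_cvg_integral _ _ _ F E (@area R) Fm mF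
  (fun i => measurable_funTS mE) (fun i z _ => E0 z).
have IE : (\int[area]_(z in \bigcup_i F i) E z = \int[area]_z E z)%E.
  rewrite FU integral_mkcond; apply: eq_integral => z _; rewrite patchE.
  by case: ifPn => // /negP; rewrite inE => zr; rewrite /E w0_out // expr0n.
have tot_num : (\int[area]_z E z)%E \is a fin_num.
  by rewrite ge0_fin_numE //; exact: integral_ge0.
rewrite IE -(fineK tot_num) in cv.
have /fine_cvgP[_ /cvgrPdist_lt/(_ _ eta0)[k _ /(_ k (leqnn k))]] := cv.
rewrite /= => H; exists (rs k); first exact: rs_in.
have split : (\int[area]_z E z = \int[area]_(z in F k) E z + \int[area]_(z in ~` F k) E z)%E.
  rewrite -ge0_integral_setU ?setUv //; first exact: measurableC.
  by apply/disj_setPS => z [].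
have fF : (\int[area]_(z in F k) E z)%E \is a fin_num.
  rewrite ge0_fin_numE ?integral_ge0 //; apply: le_lt_trans tot_fin.
  by apply: ge0_subset_integral.
have fC : (\int[area]_(z in ~` F k) E z)%E \is a fin_num.
  rewrite ge0_fin_numE ?integral_ge0 //; apply: le_lt_trans tot_fin.
  by apply: ge0_subset_integral => //; exact: measurableC.
rewrite -(fineK fC) lee_fin; move: H; rewrite split fineD // addrAC subrr add0r.
by move=> /ltW; apply: le_trans; exact: ler_norm.
Qed.

Let rot (a : R) (z : R * R) := plane_rot (cos a) (sin a) z.

(** The mean value theorem runs along the chord from z to its rotated image: the disk is convex, so
    the gradient bounds hold on the chord, whose squared length is 2 |z|^2 (1 - cos a). *)
Lemma chord_bound (s : R) : 0 < s < rho -> exists2 C : R, 0 <= C &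
  forall z a, cmod z < s -> (w (rot a z) - w z) ^+ 2 <= C * (1 - cos a).
Proof.
move=> /andP[s0 sr].
have [|X X0 HX] := @closed_disk_bound _ rho wx s sr; first by move=> z /wC1[].
have [|Y Y0 HY] := @closed_disk_bound _ rho wy s sr; first by move=> z /wC1[].
exists ((X + Y) ^+ 2 * (2 * s ^+ 2)) => [|z a zs].
  by rewrite mulr_ge0 ?sqr_ge0 // mulr_ge0 // sqr_ge0.
pose p := rot a z; pose d : R * R := (p.1 - z.1, p.2 - z.2).
have ps : cmod p < s by rewrite cmod_rot // cos2Dsin2.
pose path (t : R) : R * R := (z.1 + t * d.1, z.2 + t * d.2).
have path_in (t : R) : 0 <= t <= 1 -> cmod (path t) <= s.
  move=> /andP[t0 t1].
  have e : cx (path t) = (1 - t)%:C * cx z + t%:C * cx p.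
    apply/eqP; rewrite eq_complex Re_add Im_add !Re_scale !Im_scale /=.
    by apply/andP; split; apply/eqP; ring.
  rewrite -[cmod _]/(normc (cx (path t))) e.
  apply: le_trans (ler_normcD _ _) _; rewrite !Normc.normcM !normcR.
  rewrite ger0_norm ?subr_ge0 // ger0_norm //.
  have -> : s = (1 - t) * s + t * s by ring.
  by apply: lerD; apply: ler_wpM2l; rewrite ?subr_ge0 //; exact: ltW.
have pd (t : R) : 0 <= t <= 1 -> has_derive t 1 (fun x => w (path x))
    (wx (path t) * d.1 + wy (path t) * d.2).
  move=> tt; apply: (@C1_on_chain _ rho w wx wy wC1 (fun x => z.1 + x * d.1) (fun x => z.2 + x * d.2)).
  - by apply: le_lt_trans sr; exact: path_in.
  - apply: has_derive_val.
      exact: (has_derive_add (has_derive_const z.1 t 1)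
        (has_derive_mul (has_derive_ident t) (has_derive_const d.1 t 1))).
    by rewrite mul1r mulr0 addr0 add0r.
  - apply: has_derive_val.
      exact: (has_derive_add (has_derive_const z.2 t 1)
        (has_derive_mul (has_derive_ident t) (has_derive_const d.2 t 1))).
    by rewrite mul1r mulr0 addr0 add0r.
have [||c] := @MVT _ (fun x => w (path x)) (fun t => wx (path t) * d.1 + wy (path t) * d.2) 0 1 ltr01.
- by move=> x; rewrite in_itv /= => /andP[x0 x1]; apply: pd; rewrite !ltW.
- exact: (derive_cc_cont pd).
rewrite in_itv /= => /andP[c0 c1].
have -> : path 1 = p.
  by rewrite [p]surjective_pairing /path /d /=; congr (_, _); ring.
have -> : path 0 = z by rewrite /path !mul0r !addr0 -surjective_pairing.
rewrite subr0 mulr1 => ->.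
have cin : cmod (path c) <= s by apply: path_in; rewrite !ltW.
have B : `|wx (path c) * d.1 + wy (path c) * d.2| <= (X + Y) * cmod d.
  apply: le_trans (ler_normD _ _) _; rewrite mulrDl !normrM.
  apply: lerD; apply: ler_pM => //; [exact: HX|exact: ler_fst_cmod|exact: HY|exact: ler_snd_cmod].
have dd : cmod d ^+ 2 = 2 * cmod z ^+ 2 * (1 - cos a).
  have cs := cos2Dsin2 a; rewrite !sqr_cmod /d /p /rot /plane_rot /=.
  transitivity ((z.1 ^+ 2 + z.2 ^+ 2) * ((cos a - 1) ^+ 2 + sin a ^+ 2)); first by ring.
  have -> : sin a ^+ 2 = 1 - cos a ^+ 2 :> R by rewrite -cs; ring.
  by ring.
rewrite -[_ ^+ 2]ger0_norm ?sqr_ge0 // normrX.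
apply: le_trans (_ : ((X + Y) * cmod d) ^+ 2 <= _).
  by rewrite ler_pXn2r // nnegrE // mulr_ge0 ?cmod_ge0 // addr_ge0.
rewrite exprMn dd -[leRHS]mulrA; apply: ler_wpM2l; first exact: sqr_ge0.
apply: ler_wpM2r; first by rewrite subr_ge0 cos_le1.
apply: ler_wpM2l => //; by rewrite ler_pXn2r ?nnegrE ?cmod_ge0 // ltW.
Qed.

Let mdiff a : measurable_fun [set: T2] ((fun z => ((w0 (rot a z) - w0 z) ^+ 2)%:E) : T2 -> \bar R).
Proof.
apply/measurable_EFinP; apply: measurable_funX; apply: measurable_funB => //.
exact: mrot.
Qed.

Lemma rotation_modulus (eta : R) : 0 < eta -> exists2 C : R, 0 <= C & forall a,
  (\int[area]_z ((w0 (rot a z) - w0 z) ^+ 2)%:E <= (eta + C * (1 - cos a))%:E)%E.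
Proof.
(* On the complement (x - y)^2 <= 2 x^2 + 2 y^2, and both terms have the same integral by rotation
   invariance, so a tail of eta/4 contributes at most eta. *)
move=> eta0; have e4 : 0 < eta / 4 by rewrite divr_gt0.
have [s sr tail] := tail_small e4; have [C C0 HC] := chord_bound sr.
have [s0 slt] := andP sr.
exists (C * (pi * s ^+ 2)) => [|a]; first by rewrite !mulr_ge0 ?sqr_ge0 // ltW // pi_gt0.
have cs : cos a ^+ 2 + sin a ^+ 2 = 1 :> R := cos2Dsin2 a.
pose D : set T2 := disk s.
have mD : measurable D := @disk_measurable R s.
have mDc : measurable (~` D) := measurableC mD.
have Dc_rot : rotation_invariant (~` D : set (R * R)).
  by move=> c' s' cs' z; rewrite /D /setC /disk /= cmod_rot.
rewrite -(setUv D) ge0_integral_setU //; last 3 first.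
- by rewrite setUv; exact: mdiff.
- by move=> z _; rewrite lee_fin sqr_ge0.
- by apply/disj_setPS => z [].
rewrite addrC EFinD; apply: leeD.
- apply: (@le_trans _ _ (\int[area]_(z in ~` D) ((2%:E * E (rot a z)) + 2%:E * E z))%E).
    apply: ge0_le_integral => //.
    + by move=> z _; rewrite lee_fin sqr_ge0.
    + exact: measurable_funTS (mdiff a).
    + apply: emeasurable_funD; apply: measurable_funeM; apply: measurable_funTS => //.
      exact: (measurableT_comp mE (@measurable_rot R (cos a) (sin a))).
    + move=> z _; rewrite -!EFinM -EFinD lee_fin /E.
      have := sqr_ge0 (w0 (rot a z) + w0 z); move: (w0 (rot a z)) (w0 z) => x y; nra.
  rewrite ge0_integralD //; last 4 first.
  + by move=> z _; rewrite mule_ge0 // lee_fin.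
  + apply: measurable_funeM; apply: measurable_funTS.
    exact: (measurableT_comp mE (@measurable_rot R (cos a) (sin a))).
  + by move=> z _; rewrite mule_ge0 // lee_fin.
  + by apply: measurable_funeM; apply: measurable_funTS.
  rewrite !ge0_integralZl //; try by rewrite lee_fin.
  + rewrite (@ge0_integral_rot_in R (~` D) (cos a) (sin a) E Dc_rot mDc cs) //.
      have -> : eta%:E = (2%:E * (eta / 4)%:E + 2%:E * (eta / 4)%:E)%E.
        by rewrite -!EFinM -EFinD; congr (_%:E); field.
      by apply: leeD; apply: lee_wpmul2l => //; rewrite lee_fin.
    exact: measurable_funTS.
  + exact: measurable_funTS.
  + apply: measurable_funTS.
    exact: (measurableT_comp mE (@measurable_rot R (cos a) (sin a))).
- apply: (@le_trans _ _ (\int[area]_(z in D) (C * (1 - cos a))%:E)%E).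
    apply: ge0_le_integral => //.
    + by move=> z _; rewrite lee_fin sqr_ge0.
    + exact: measurable_funTS (mdiff a).
    + move=> z zs; have zr : disk rho z by exact: lt_trans slt.
      rewrite lee_fin !w0E //; first exact: HC.
      by rewrite /disk /= cmod_rot.
  rewrite integral_cst // [X in (_ * X)%E]area_disk // -EFinM lee_fin.
  by rewrite mulrAC.
Qed.

Let I := `[0 : R, 2 * pi]%classic.

Lemma rot_continuous z : continuous (fun a => rot a z).
Proof.
apply: continuous_pair => a; [apply: cvgB|apply: cvgD];
  apply: cvgM; (exact: cvg_cst || exact: continuous_cos || exact: continuous_sin).
Qed.

Lemma rot_comp_continuous z : disk rho z -> continuous (fun a => w (rot a z)).
Proof.
move=> zr a; apply: (continuous_comp (@rot_continuous z a)).
have rz : disk rho (rot a z) by rewrite /disk /= cmod_rot // cos2Dsin2.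
by have [] := wC1 rz.
Qed.

(** Jensen's inequality for a probability density: with m the mean of h, the integral of kern (h -
    m)^2 is nonnegative and, the mass being 1, equals the mean of h^2 minus m^2. *)
Lemma avg_jensen N z : disk rho z ->
  (avg N w z - w z) ^+ 2 <= \int[mu]_(a in I) (kern N a * (w (rot a z) - w z) ^+ 2).
Proof.
move=> zr; have wc := rot_comp_continuous zr; have kc := @kern_continuous R N.
pose h a := w (rot a z) - w z.
have hc : continuous h by move=> a; apply: cvgB; [exact: wc|exact: cvg_cst].
have khc : continuous (fun a => kern N a * h a).
  by move=> a; apply: cvgM; [exact: kc|exact: hc].
have kh2c : continuous (fun a => kern N a * h a ^+ 2).
  by move=> a; apply: cvgM; [exact: kc|rewrite expr2; apply: cvgM; exact: hc].
have kwc : continuous (fun a => kern N a * w (rot a z)).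
  by move=> a; apply: cvgM; [exact: kc|exact: wc].
have -> : avg N w z - w z = \int[mu]_(a in I) (kern N a * h a).
  transitivity (\int[mu]_(a in I) (1 * (kern N a * w (rot a z)) + - w z * kern N a)).
    by rewrite (int_lin _ _ kwc kc) kern_mass mulr1 mul1r.
  by apply: eq_Rintegral => a _; rewrite /h; ring.
set m := Rintegral _ _ _.
have pos : 0 <= \int[mu]_(a in I) (kern N a * (h a - m) ^+ 2).
  apply: Rintegral_ge0 => a _; first by rewrite mulr_ge0 ?sqr_ge0 ?kern_ge0.
have c2 : continuous (fun a => - 2 * m * (kern N a * h a) + m ^+ 2 * kern N a).
  by move=> a; apply: cvgD; apply: cvgMr; [exact: khc|exact: kc].
have : \int[mu]_(a in I) (kern N a * (h a - m) ^+ 2) =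
    \int[mu]_(a in I) (kern N a * h a ^+ 2) - m ^+ 2.
  transitivity (\int[mu]_(a in I) (1 * (kern N a * h a ^+ 2) +
      1 * (- 2 * m * (kern N a * h a) + m ^+ 2 * kern N a))).
    by apply: eq_Rintegral => a _; ring.
  rewrite (int_lin _ _ kh2c c2) (int_lin _ _ khc kc) kern_mass !mul1r -/m.
  by move: (Rintegral _ _ _) => x; ring.
move=> e; rewrite e subr_ge0 in pos.
exact: pos.
Qed.

Let H N (p : T2 * T1) : \bar R :=
  (kern N p.2 * (w0 (rot p.2 p.1) - w0 p.1) ^+ 2 * \1_I p.2)%:E.

Let mH N : measurable_fun [set: T2 * T1] (H N).
Proof.
have m2 (k : R -> R) : continuous k ->
    measurable_fun [set: T2 * T1] ((fun p => k p.2) : T2 * T1 -> T1).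
  by move=> /continuous_measurable_fun mk; apply: (measurableT_comp mk); exact: measurable_snd.
have m11 : measurable_fun [set: T2 * T1] ((fun p => p.1.1) : T2 * T1 -> T1).
  by apply: (measurableT_comp measurable_fst); exact: measurable_fst.
have m12 : measurable_fun [set: T2 * T1] ((fun p => p.1.2) : T2 * T1 -> T1).
  by apply: (measurableT_comp measurable_snd); exact: measurable_fst.
have mr : measurable_fun [set: T2 * T1] ((fun p => rot p.2 p.1) : T2 * T1 -> T2).
  apply: measurable_fun_pair; [apply: measurable_funB|apply: measurable_funD];
    apply: measurable_funM => //; apply: m2; (exact: continuous_cos || exact: continuous_sin).
apply/measurable_EFinP; apply: measurable_funM.
  apply: measurable_funM; first by apply: m2; exact: kern_continuous.
  apply: measurable_funX; apply: measurable_funB; first exact: (measurableT_comp mw0 mr).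
  by apply: (measurableT_comp mw0); exact: measurable_fst.
have mi : measurable_fun [set: T1] (\1_I : T1 -> R).
  by apply/measurable_indicP; exact: measurable_itv.
exact: (measurableT_comp mi measurable_snd).
Qed.

Let H0 N p : (0 <= H N p)%E.
Proof. by rewrite lee_fin; apply: mulr_ge0 => //; apply: mulr_ge0; [exact: kern_ge0|exact: sqr_ge0]. Qed.

Let slice (h : R -> R) :
  (\int[mu]_a (h a * \1_I a)%:E = \int[mu]_(a in I) (h a)%:E)%E.
Proof.
rewrite [RHS]integral_mkcond; apply: eq_integral => a _; rewrite patchE indicE.
by case: ifP => _; rewrite ?mulr1 ?mulr0.
Qed.

(** Jensen pointwise, then Tonelli and the rotation estimate give eta/2 + C/(N + 1). Measurability
    of the average is asked on [A] only, since it will be read off its expression as a sum of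
    elements away from the origin. *)
Lemma avg_L2 (eta : R) : 0 < eta -> exists N0 : nat, forall N, (N0 <= N)%N ->
  forall A : set T2, measurable A -> A `<=` disk rho ->
  measurable_fun A (avg N w : T2 -> T1) ->
  (\int[area]_(z in A) ((avg N w z - w z) ^+ 2)%:E <= eta%:E)%E.
Proof.
move=> eta0; have e2 : 0 < eta / 2 by rewrite divr_gt0.
have [C C0 HC] := rotation_modulus e2.
(* Beyond this index C/(N + 1) <= eta/2. *)
exists (Num.truncn (2 * C / eta)) => N NN A mA Adisk mavg.
have CN : C / N.+1%:R <= eta / 2.
  have : 2 * C / eta < N.+1%:R.
    by apply: lt_le_trans (truncnS_gt _) _; rewrite ler_nat ltnS.
  rewrite ltr_pdivrMr // ler_pdivrMr ?ltr0n // => /ltW; move: (N.+1%:R) => x; lra.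
have mF := measurable_fun_fubini_tonelli_F (m2 := mu) (H N) (mH N) (H0 N).
have mw : measurable_fun A (w : T2 -> T1).
  apply: (measurable_funS (@disk_measurable R rho) Adisk).
  by apply: continuous_measurable_plane => [|z /wC1[]]; first exact: disk_open.
apply: (@le_trans _ _ (\int[area]_(z in A) \int[mu]_a H N (z, a))%E).
  apply: ge0_le_integral => //.
  - by move=> z _; rewrite lee_fin sqr_ge0.
  - by apply/measurable_EFinP; apply: measurable_funX; exact: measurable_funB.
  - exact: measurable_funTS mF.
  - move=> z /Adisk zr; rewrite /H /= slice.
    have zrot a : disk rho (rot a z) by rewrite /disk /= cmod_rot // cos2Dsin2.
    have c : continuous (fun a => kern N a * (w (rot a z) - w z) ^+ 2).
      have hc : continuous (fun a => w (rot a z) - w z).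
        by move=> a; apply: cvgB; [exact: rot_comp_continuous|exact: cvg_cst].
      by move=> a; apply: cvgM; [exact: kern_continuous|rewrite expr2; apply: cvgM; exact: hc].
    have -> : (\int[mu]_(a in I) (kern N a * (w0 (rot a z) - w0 z) ^+ 2)%:E =
        (\int[mu]_(a in I) (kern N a * (w (rot a z) - w z) ^+ 2))%:E)%E.
      rewrite /Rintegral fineK; last first.
        by apply: integrable_fin_num; [exact: measurable_itv|exact: (continuous_integrable_cc 0 (2 * pi) c)].
      by apply: eq_integral => a _; rewrite !w0E.
    by rewrite lee_fin; exact: avg_jensen.
apply: (@le_trans _ _ (\int[area]_z \int[mu]_a H N (z, a))%E).
  apply: ge0_subset_integral => //.
  by move=> z _; apply: integral_ge0 => a _.
rewrite [leLHS](fubini_tonelli (m1 := @plane_area R) (H N)) //.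
apply: (@le_trans _ _ (\int[mu]_(a in I) (kern N a * (eta / 2 + C * (1 - cos a)))%:E)%E).
  rewrite -slice; apply: ge0_le_integral => //.
  - by move=> a _; apply: integral_ge0.
  - exact: (measurable_fun_fubini_tonelli_G (m1 := @plane_area R) (H N)).
  - apply/measurable_EFinP; apply: measurable_funM; last first.
      by apply/measurable_indicP; exact: measurable_itv.
    apply: continuous_measurable_fun => a; apply: cvgM; first exact: kern_continuous.
    apply: cvgD; first exact: cvg_cst.
    by apply: cvgMr; apply: cvgB; [exact: cvg_cst|exact: continuous_cos].
  - move=> a _; rewrite /H /=.
    under eq_integral do rewrite mulrAC EFinM.
    rewrite ge0_integralZl //; last by rewrite lee_fin mulr_ge0 ?kern_ge0 // indicE.
      rewrite [X in (_ <= X%:E)%E]mulrAC [leRHS]EFinM; apply: lee_wpmul2l; last exact: HC.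
      by rewrite lee_fin mulr_ge0 ?kern_ge0 // indicE.
    by move=> z _; rewrite lee_fin sqr_ge0.
have kc := @kern_continuous R N.
have kmc : continuous (fun a : R => kern N a * (1 - cos a)).
  by move=> a; apply: cvgM; [exact: kc|apply: cvgB; [exact: cvg_cst|exact: continuous_cos]].
have -> : (\int[mu]_(a in I) (kern N a * (eta / 2 + C * (1 - cos a)))%:E =
    (\int[mu]_(a in I) (eta / 2 * kern N a + C * (kern N a * (1 - cos a))))%:E)%E.
  rewrite /Rintegral fineK.
    by apply: eq_integral => a _; congr (_%:E); ring.
  have sc : continuous (fun a : R => eta / 2 * kern N a + C * (kern N a * (1 - cos a))).
    by move=> a; apply: cvgD; apply: cvgMr; [exact: kc|exact: kmc].
  by apply: integrable_fin_num; [exact: measurable_itv|exact: (continuous_integrable_cc 0 (2 * pi) sc)].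
rewrite (int_lin _ _ kc kmc) kern_mass kern_moment lee_fin mulr1.
by move: CN; move: (C / N.+1%:R) => x; lra.
Qed.

End Averages.

(** * Completeness *)

Section SquareIntegrable.
Context {R : realType} (A : set (R * R)).
Local Notation T1 := (measurableTypeR R).
Local Notation T2 := (measurableTypeR R * measurableTypeR R)%type.
Hypothesis mA : measurable (A : set T2).
Implicit Types w : R * R -> R.

Lemma L2_integrable_sqr w : L2 A w ->
  area.-integrable (A : set T2) (EFin \o (fun z => w z ^+ 2)).
Proof.
move=> /Lfun2_integrable_sqr wi; apply/(integrable_mkcond _ mA).
apply: eq_integrable wi => // z _ /=; rewrite !patchE.
by case: ifP => //; rewrite expr0n.
Qed.

Lemma integrable_sqr_L2 w : measurable_fun (A : set T2) (w : T2 -> T1) ->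
  area.-integrable (A : set T2) (EFin \o (fun z => w z ^+ 2)) -> L2 A w.
Proof.
move=> mw wi; rewrite /L2 inE; apply/andP; split; rewrite inE /=.
  exact/(measurable_restrictT _ mA).
rewrite /finite_norm unlock; apply: poweR_lty.
have /integrableP[_] := wi; apply: le_lt_trans.
rewrite [leRHS]integral_mkcond; rewrite le_eqVlt; apply/orP; left; apply/eqP.
apply: eq_integral => z _.
rewrite /= !patchE; case: ifP => _ /=.
  by rewrite powR_mulrn // normrX.
by rewrite normr0 powR0.
Qed.

End SquareIntegrable.

Section Regularity.
Context {R : realType}.

(** An open set is its own interior, so the continuous extensions of the derivatives coincide with
    them near every point. *)
Lemma realCk_C1 (A : set (R * R)) (u : R * R -> R) : open A ->
  realCk [:: dirx; diry] 1 A u -> C1_on A u ('D_dirx u) ('D_diry u).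
Proof.
move=> oA [uc [_ H]] z Az.
have inA (v : R * R -> R) : {within A, continuous v} -> {for z, continuous v}.
  by rewrite continuous_open_subspace // => vc; apply: vc; rewrite inE.
have iA : (A° : set (R * R)) = A by apply/interior_id.
have D v : v \in [:: dirx; diry : R * R] ->
    has_derive z v u ('D_v u z) /\ {for z, continuous ('D_v u)}.
  move=> /H[d [[k kc kE] _]]; split; first by split => //; apply: d; rewrite iA.
  have := inA k kc; rewrite /prop_for /continuous_at kE ?iA //.
  apply: cvg_trans; apply: near_eq_cvg.
  by apply: filterS (open_nbhs_nbhs (conj oA Az)) => p Ap; rewrite /= kE ?iA.
have [|d1 c1] := D dirx; first by rewrite !inE eqxx.
have [|d2 c2] := D diry; first by rewrite !inE eqxx orbT.
by split; [exact: inA|exact: d1|exact: d2|exact: c1|exact: c2].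
Qed.

Lemma Ck2_cC1 (A : set (R * R)) (U : R * R -> R[i]) : open A -> Ck2 1 A U ->
  cC1_on A U (cpartial dirx U) (cpartial diry U).
Proof. by move=> oA [r i]; split; exact: realCk_C1. Qed.

End Regularity.

Section Coefficients.
Context {R : realType} (rho M : R) (g : R -> R[i]) (U Ux Uy V Vx Vy : R * R -> R[i]).
Hypotheses (rho0 : 0 < rho) (gM : forall r : R, 0 < r < rho -> normc (g r) <= M).
Hypotheses (UC1 : cC1_on (disk rho) U Ux Uy) (VC1 : cC1_on (disk rho) V Vx Vy).
Hypothesis vekua : forall z, 0 < cmod z < rho ->
  Ux z - Vy z = g (cmod z) * ((z.1 / cmod z)%:C * U z + (z.2 / cmod z)%:C * V z) /\
  Uy z + Vx z = g (cmod z) * ((z.2 / cmod z)%:C * U z - (z.1 / cmod z)%:C * V z).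
Context (n : nat) (F F1 Q Q1 : R -> R[i]).
Hypotheses (FP : radial_profile rho F F1) (QP : radial_profile rho Q Q1)
  (S1 : forall r : R, 0 < r < rho ->
     r%:C * F1 r + n%:R * F r - r%:C * g r * F r = n%:R * Q r)
  (S2 : forall r : R, 0 < r < rho ->
     r%:C * Q1 r + n%:R * Q r + r%:C * g r * Q r = n%:R * F r).

Let cosn (a : R) := cos (n%:R * a).
Let sinn (a : R) := sin (n%:R * a).
Let cosn' (a : R) := - n%:R * sinn a.
Let sinn' (a : R) := n%:R * cosn a.

Lemma cosn_derive (a : R) : has_derive a 1 cosn (cosn' a).
Proof.
apply: has_derive_val.
  exact: (has_derive_chain (has_derive_linear n%:R a)
    (is_derive_cos (n%:R * a) : has_derive (n%:R * a) 1 cos (- sin (n%:R * a)))).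
by rewrite /cosn' /sinn; ring.
Qed.

Lemma sinn_derive (a : R) : has_derive a 1 sinn (sinn' a).
Proof.
apply: has_derive_val.
  exact: (has_derive_chain (has_derive_linear n%:R a)
    (is_derive_sin (n%:R * a) : has_derive (n%:R * a) 1 sin (cos (n%:R * a)))).
by rewrite /sinn' /cosn mulrC.
Qed.

Lemma period_cosn : cosn (2 * pi) = cosn 0 /\ sinn (2 * pi) = sinn 0.
Proof.
rewrite /cosn /sinn mulr0.
elim: n => [|m [c s]]; first by rewrite !mul0r.
rewrite -natr1 mulrDl mul1r cosD sinD c s cos_int_period.1 cos_int_period.2 cos0 sin0.
by split; ring.
Qed.

Lemma mode_scale (W Wx Wy : R * R -> R[i]) (c : R) p r : cC1_on (disk rho) W Wx Wy ->
  continuous p -> 0 < r < rho -> mode (fun a => c * p a) W r = c%:C * mode p W r.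
Proof.
move=> WC pc /andP[r0 rr]; rewrite /mode -cint_scale.
  by apply: cint_ext => a; rewrite rmorphM /= mulrCA.
by apply: (mode_continuous_integrand WC pc); rewrite gtr0_norm.
Qed.

Let cc : continuous cosn := @cos_nat_continuous R n.
Let sc : continuous sinn := @sin_nat_continuous R n.

Lemma bounded0_mode (W Wx Wy : R * R -> R[i]) p : cC1_on (disk rho) W Wx Wy ->
  continuous p -> (forall a, `|p a| <= 1) -> bounded0 (mode p W).
Proof.
move=> WC pc p1; have [|K HK] := mode_bounded WC pc p1 (s := rho / 2).
  by rewrite divr_gt0 //= ltr_pdivrMr // ltr_pMr // ltr1n.
by exists (rho / 2), K; split => //; rewrite divr_gt0.
Qed.

(** The system couples the cosine mode of U with the sine mode of V, and the sine mode of U with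
    minus the cosine mode of V. Both pairs are bounded at 0, which yields one constant each. For n =
    0 only the cosine modes remain, and they decouple. *)
Lemma mode_coefficients : exists c d : R[i], forall r : R, 0 < r < rho ->
  [/\ mode cosn U r = c * (F r * (r ^+ n)%:C),
      (0 < n)%N -> mode sinn V r = c * (Q r * (r ^+ n)%:C),
      (0 < n)%N -> mode sinn U r = - d * (F r * (r ^+ n)%:C) &
      mode cosn V r = d * (Q r * (r ^+ n)%:C)].
Proof.
have cc' : continuous cosn' by move=> a; apply: cvgMr; exact: sc.
have sc' : continuous sinn' by move=> a; apply: cvgMr; exact: cc.
have b1 : forall a, `|cosn a| <= 1 by move=> a; rewrite ler_norml cos_geN1 cos_le1.
have b2 : forall a, `|sinn a| <= 1 by move=> a; rewrite ler_norml sin_geN1 sin_le1.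
have [pc ps] := period_cosn.
have e1 W Wx Wy r : cC1_on (disk rho) W Wx Wy -> 0 < r < rho ->
    mode cosn' W r = - (n%:R * mode sinn W r).
  move=> WC rr; rewrite (mode_scale _ WC sc rr) rmorphN rmorph_nat mulNr //.
have e2 W Wx Wy r : cC1_on (disk rho) W Wx Wy -> 0 < r < rho ->
    mode sinn' W r = n%:R * mode cosn W r.
  by move=> WC rr; rewrite (mode_scale _ WC cc rr) rmorph_nat.
have sysc r (rr : 0 < r < rho) := mode_system UC1 VC1 vekua rr cosn_derive cc' pc.
have syss r (rr : 0 < r < rho) := mode_system UC1 VC1 vekua rr sinn_derive sc' ps.
have [n0|n0] := posnP n.
  have S : mode_solution rho g n (mode cosn U) (mode cosn V)
      (fun r => cintegral (@lebesgue_measure R) `[0, 2 * pi] (fun a => cradial Ux Uy r a * (cosn a)%:C))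
      (fun r => cintegral (@lebesgue_measure R) `[0, 2 * pi] (fun a => cradial Vx Vy r a * (cosn a)%:C)).
    move=> r rr; have [s1 s2] := sysc r rr; split.
    - exact: (mode_derive UC1 cc rr).
    - exact: (mode_derive VC1 cc rr).
    - by rewrite s1 (e1 V _ _ _ VC1 rr) n0 !mul0r oppr0 subr0 addr0.
    - by rewrite s2 (e1 U _ _ _ UC1 rr) n0 !mul0r oppr0.
  have [c [d H]] := bounded_mode_solution0 rho0 gM FP QP S1 S2 n0 S.
  exists c, d => r rr; have [h1 h2] := H r rr.
  have r0 : (r ^+ n)%:C = 1 :> R[i] by rewrite n0 expr0.
  by split; rewrite ?r0 ?mulr1 // n0.
have Sc : mode_solution rho g n (mode cosn U) (mode sinn V)
      (fun r => cintegral (@lebesgue_measure R) `[0, 2 * pi] (fun a => cradial Ux Uy r a * (cosn a)%:C))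
      (fun r => cintegral (@lebesgue_measure R) `[0, 2 * pi] (fun a => cradial Vx Vy r a * (sinn a)%:C)).
  move=> r rr; have [s1 _] := sysc r rr; have [_ s2] := syss r rr; split.
  - exact: (mode_derive UC1 cc rr).
  - exact: (mode_derive VC1 sc rr).
  - by rewrite s1 (e1 V _ _ _ VC1 rr) opprK.
  - by rewrite s2 (e2 U _ _ _ UC1 rr).
have Ss : mode_solution rho g n (mode sinn U) (fun r => - mode cosn V r)
      (fun r => cintegral (@lebesgue_measure R) `[0, 2 * pi] (fun a => cradial Ux Uy r a * (sinn a)%:C))
      (fun r => - cintegral (@lebesgue_measure R) `[0, 2 * pi] (fun a => cradial Vx Vy r a * (cosn a)%:C)).
  move=> r rr; have [_ s2] := sysc r rr; have [s1 _] := syss r rr; split.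
  - exact: (mode_derive UC1 sc rr).
  - exact: (has_cderive_opp (mode_derive VC1 cc rr)).
  - by rewrite s1 (e2 V _ _ _ VC1 rr) mulrN.
  - by rewrite mulrN s2 (e1 U _ _ _ UC1 rr) mulrN opprD !opprK.
have bN (u : R -> R[i]) : bounded0 u -> bounded0 (fun r => - u r).
  by move=> [s [K [s0 H]]]; exists s, K; split => // r rs; rewrite normcN; exact: H.
have [c Hc] := bounded_mode_solution rho0 gM FP QP S1 S2 n0 Sc
  (bounded0_mode UC1 cc b1) (bounded0_mode VC1 sc b2).
have [d Hd] := bounded_mode_solution rho0 gM FP QP S1 S2 n0 Ss
  (bounded0_mode UC1 sc b2) (bN _ (bounded0_mode VC1 cc b1)).
exists c, (- d) => r rr; have [h1 h2] := Hc r rr; have [h3 h4] := Hd r rr.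
split => //; first by rewrite opprK.
by rewrite -[LHS]opprK h4 mulNr.
Qed.

Lemma element_pol (b : bool) (r a : R) : 0 < r ->
  element F Q (unit_of b) n (pol r a) =
  mkB (F r * (r ^+ n * (if b then - sinn a else cosn a))%:C)
      (Q r * (r ^+ n * (if b then cosn a else sinn a))%:C).
Proof.
move=> r0; have cr : cmod (pol r a) = r by rewrite cmod_pol gtr0_norm.
have e : cx (pol r a) ^+ n = (r ^+ n)%:C * (cosn a +i* sinn a).
  have -> : cx (pol r a) = r%:C * (cos a +i* sin a).
    by apply/eqP; rewrite eq_complex Re_scale Im_scale /= !eqxx.
  by rewrite exprMn rmorphXn deMoivre.
rewrite /element /radial cr e [unit_of b * _]mulrCA Re_scale Im_scale; congr mkB;
  by case: b; rewrite /unit_of ?mul1r // !ReImE /=; congr (_ * (_ * _)%:C); ring.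
Qed.

Lemma modes_element : exists c d : R[i], forall r a : R, 0 < r < rho ->
  mkB ((cosn a)%:C * mode cosn U r + (sinn a)%:C * mode sinn U r)
      ((cosn a)%:C * mode cosn V r + (sinn a)%:C * mode sinn V r) =
  c *: element F Q (unit_of false) n (pol r a) + d *: element F Q (unit_of true) n (pol r a).
Proof.
have [c [d H]] := mode_coefficients; exists c, d => r a rr.
have [h1 h2 h3 h4] := H r rr; have [r0 _] := andP rr.
rewrite !element_pol // !bicomplexZ /mkB /Sc /Vec /=.
rewrite -[RHS]/(Complex _ _ : bicomplex R); congr (Complex _ _).
(* For n = 0 no formula is given for the sine mode, but its factor sin (n a) is 0. *)
- rewrite h1; case: (posnP n) => [n0|/h3 ->].
    have -> : sinn a = 0 by rewrite /sinn n0 mul0r sin0.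
    rewrite !rmorphM rmorphN /=; ring.
  by rewrite !rmorphM rmorphN /=; ring.
- rewrite h4; case: (posnP n) => [n0|/h2 ->].
    have -> : sinn a = 0 by rewrite /sinn n0 mul0r sin0.
    rewrite !rmorphM /=; ring.
  by rewrite !rmorphM /=; ring.
Qed.

End Coefficients.

Section BicomplexMeasurability.
Context {R : realType} (A : set (R * R)).
Local Notation T1 := (measurableTypeR R).
Local Notation T2 := (measurableTypeR R * measurableTypeR R)%type.

Definition bmeasurable (G : R * R -> bicomplex R) :=
  [/\ measurable_fun (A : set T2) ((fun z => Re (Sc (G z))) : T2 -> T1),
      measurable_fun (A : set T2) ((fun z => Im (Sc (G z))) : T2 -> T1),
      measurable_fun (A : set T2) ((fun z => Re (Vec (G z))) : T2 -> T1) &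
      measurable_fun (A : set T2) ((fun z => Im (Vec (G z))) : T2 -> T1)].

Lemma bmeasurable_lin (c : R[i]) G H : bmeasurable G -> bmeasurable H ->
  bmeasurable (fun z => c *: G z + H z).
Proof.
move=> [g1 g2 g3 g4] [h1 h2 h3 h4].
have e z : c *: G z + H z = mkB (c * Sc (G z) + Sc (H z)) (c * Vec (G z) + Vec (H z)).
  by rewrite bicomplexZ; case: (H z).
have lin (x y : R) (u v h : T2 -> T1) : measurable_fun (A : set T2) u ->
    measurable_fun (A : set T2) v -> measurable_fun (A : set T2) h ->
    measurable_fun (A : set T2) ((fun z => x * u z + y * v z + h z) : T2 -> T1).
  move=> mu mv mh; apply: measurable_funD => //; apply: measurable_funD;
    by apply: measurable_funM => //; exact: measurable_cst.
split.
- rewrite (_ : (fun z => _) = fun z => Re c * Re (Sc (G z)) + - Im c * Im (Sc (G z)) + Re (Sc (H z))).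
    exact: lin g1 g2 h1.
  by apply/funext => z; rewrite e /Sc /= !ReImE mulNr.
- rewrite (_ : (fun z => _) = fun z => Re c * Im (Sc (G z)) + Im c * Re (Sc (G z)) + Im (Sc (H z))).
    exact: lin g2 g1 h2.
  by apply/funext => z; rewrite e /Sc /= !ReImE.
- rewrite (_ : (fun z => _) = fun z => Re c * Re (Vec (G z)) + - Im c * Im (Vec (G z)) + Re (Vec (H z))).
    exact: lin g3 g4 h3.
  by apply/funext => z; rewrite e /Vec /= !ReImE mulNr.
- rewrite (_ : (fun z => _) = fun z => Re c * Im (Vec (G z)) + Im c * Re (Vec (G z)) + Im (Vec (H z))).
    exact: lin g4 g3 h4.
  by apply/funext => z; rewrite e /Vec /= !ReImE.
Qed.

Lemma bmeasurable_sum (I : Type) (s : seq I) (c : I -> R[i]) (e : I -> R * R -> bicomplex R) :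
  (forall i, bmeasurable (e i)) -> bmeasurable (fun z => \sum_(i <- s) c i *: e i z).
Proof.
move=> me; elim: s => [|i s IH].
  rewrite (_ : (fun z => _) = fun=> 0); first by split; exact: measurable_cst.
  by apply/funext => z; rewrite big_nil.
rewrite (_ : (fun z => _) = fun z => c i *: e i z + \sum_(j <- s) c j *: e j z).
  exact: bmeasurable_lin.
by apply/funext => z; rewrite big_cons.
Qed.

End BicomplexMeasurability.

Section PuncturedDisk.
Context {R : realType} (rho : R).
Local Notation T1 := (measurableTypeR R).
Local Notation T2 := (measurableTypeR R * measurableTypeR R)%type.

(** The mode formulas are available for r > 0 only; the origin is a null set, so integrals do not
    notice its removal. *)
Definition punctured : set (R * R) := [set z | 0 < cmod z < rho].

Lemma punctured_measurable : measurable (punctured : set T2).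
Proof.
have -> : punctured = disk rho `&` [set z | 0 < cmod z].
  by apply/seteqP; split => z; rewrite /punctured /disk /=; [move=> /andP[]|move=> [-> ->]].
apply: measurableI; first exact: disk_measurable.
apply: open_measurable_plane; apply: (@open_comp _ _ (@cmod R) [set x | 0 < x]).
  by move=> z _; exact: cmod_continuous.
exact: open_gt.
Qed.

Lemma origin_measurable : measurable ([set (0, 0)] : set T2).
Proof.
rewrite -[X in measurable X]setCK; apply: measurableC.
rewrite (_ : ~` _ = [set z : R * R | 0 < cmod z]).
  apply: open_measurable_plane; apply: (@open_comp _ _ (@cmod R) [set x | 0 < x]).
    by move=> z _; exact: cmod_continuous.
  exact: open_gt.
apply/seteqP; split => z /=; rewrite lt_def cmod_ge0 andbT cmod_eq0.
  by move=> h; apply/eqP.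
by move=> /eqP.
Qed.

(** The origin lies in a disk of radius sqrt(e/pi), whose area is e, for every e > 0. *)
Lemma area_origin : area ([set (0, 0)] : set T2) = 0.
Proof.
apply/eqP; rewrite eq_le measure_ge0 andbT; apply/lee_addgt0Pr => e e0.
have p0 : 0 < pi :> R := pi_gt0 R.
pose s := Num.sqrt (e / pi); have s0 : 0 < s by rewrite sqrtr_gt0 divr_gt0.
apply: (@le_trans _ _ (area (disk s : set T2))).
  apply: le_measure; rewrite ?inE; [exact: origin_measurable|exact: disk_measurable|].
  by move=> z ->; rewrite /disk /= cmod0.
rewrite [leLHS]area_disk // add0e lee_fin sqr_sqrtr ?divr_ge0 ?(ltW e0) ?(ltW p0) //.
by rewrite mulrC divfK // gt_eqF.
Qed.

Lemma integral_punctured (h : T2 -> \bar R) : 0 < rho -> measurable_fun (punctured : set T2) h ->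
  (forall z, 0 <= h z)%E ->
  (\int[area]_(z in disk rho) h z = \int[area]_(z in punctured) h z)%E.
Proof.
move=> rho0 mh h0.
have E : disk rho = (punctured : set T2) `|` [set (0, 0)].
  apply/seteqP; split => z; rewrite /punctured /disk /=.
    move=> zr; have [->|z0] := eqVneq z (0, 0); first by right.
    by left; rewrite zr andbT lt_def cmod_eq0 z0 cmod_ge0.
  by move=> [/andP[]|->] //; rewrite cmod0.
have m1 : measurable_fun ([set (0, 0)] : set T2) h by exact: measurable_fun_set1.
rewrite E ge0_integral_setU //.
- rewrite [X in (_ + X)%E]null_set_integral ?adde0 //.
  + exact: origin_measurable.
  + exact: area_origin.
- exact: punctured_measurable.
- exact: origin_measurable.
- by apply/measurable_funU => //; [exact: punctured_measurable|exact: origin_measurable].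
- by apply/disj_setPS => z [] /=; rewrite /punctured /= => /andP[z0 _] e; move: z0; rewrite e cmod0 ltxx.
Qed.

End PuncturedDisk.

(** * Density of the elements in the Bergman space *)

Section Density.
Context {R : realType} (rho M : R) (f g f1 : R -> R[i]) (F F1 Q Q1 : nat -> R -> R[i]).
Local Notation T1 := (measurableTypeR R).
Local Notation T2 := (measurableTypeR R * measurableTypeR R)%type.
Hypotheses (rho0 : 0 < rho) (gM : forall r : R, 0 < r < rho -> normc (g r) <= M)
  (FP : forall n, radial_profile rho (F n) (F1 n))
  (QP : forall n, radial_profile rho (Q n) (Q1 n))
  (fd : forall z, disk rho z -> has_cderive z dirx (radial f) (radial_dx f1 z) /\
                               has_cderive z diry (radial f) (radial_dy f1 z))
  (f_neq0 : forall r : R, 0 <= r < rho -> f r != 0)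
  (f1E : forall r : R, 0 < r < rho -> f1 r = g r * f r)
  (S1 : forall n (r : R), 0 < r < rho ->
     r%:C * F1 n r + n%:R * F n r - r%:C * g r * F n r = n%:R * Q n r)
  (S2 : forall n (r : R), 0 < r < rho ->
     r%:C * Q1 n r + n%:R * Q n r + r%:C * g r * Q n r = n%:R * F n r).

Let e (i : nat * bool) := element (F i.1) (Q i.1) (unit_of i.2) i.1.

Lemma element_regular i : BCk 1 (disk rho) (e i).
Proof. exact: element_C1 rho0 (FP i.1) (QP i.1) _. Qed.

Lemma C1_measurable (u : R * R -> R) ux uy : C1_on (disk rho) u ux uy ->
  measurable_fun (disk rho : set T2) (u : T2 -> T1).
Proof.
move=> uC; apply: continuous_measurable_plane; first exact: disk_open.
by move=> z /uC[].
Qed.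

Lemma BCk_bmeasurable G : BCk 1 (disk rho) G -> bmeasurable (disk rho) G.
Proof.
move=> [/(Ck2_cC1 (@disk_open R rho))[u1 u2] /(Ck2_cC1 (@disk_open R rho))[v1 v2]].
by split; [exact: C1_measurable u1|exact: C1_measurable u2|exact: C1_measurable v1
  |exact: C1_measurable v2].
Qed.

Definition cavg N (U : R * R -> R[i]) z : R[i] :=
  avg N (fun z => Re (U z)) z +i* avg N (fun z => Im (U z)) z.

Lemma cavg_modes N : exists k : nat -> R, forall U Ux Uy, cC1_on (disk rho) U Ux Uy ->
  forall r t : R, `|r| < rho -> cavg N U (pol r t) = \sum_(n < N.+1) (k n)%:C *
    ((cos (n%:R * t))%:C * mode (fun a => cos (n%:R * a)) U r +
     (sin (n%:R * t))%:C * mode (fun a => sin (n%:R * a)) U r).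
Proof.
have [k H] := avg_modes (R := R) N; exists k => U Ux Uy [u1 u2] r t rr.
have Rsum (h : nat -> R[i]) m : Re (\sum_(n < m) h n) = \sum_(n < m) Re (h n).
  by elim: m => [|m IH]; rewrite ?big_ord0 // !big_ord_recr /= Re_add IH.
have Isum (h : nat -> R[i]) m : Im (\sum_(n < m) h n) = \sum_(n < m) Im (h n).
  by elim: m => [|m IH]; rewrite ?big_ord0 // !big_ord_recr /= Im_add IH.
apply/eqP; rewrite eq_complex; apply/andP; split; apply/eqP.
- rewrite /cavg [LHS]/= (H _ _ _ _ u1 r t rr).
  rewrite (Rsum (fun n => (k n)%:C *
    ((cos (n%:R * t))%:C * mode (fun a => cos (n%:R * a)) U r +
     (sin (n%:R * t))%:C * mode (fun a => sin (n%:R * a)) U r))).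
  apply: eq_bigr => n _; rewrite Re_scale Re_add !Re_scale.
  by congr (_ * (_ * _ + _ * _)); apply: eq_Rintegral => a _; rewrite Re_mulr.
- rewrite /cavg [LHS]/= (H _ _ _ _ u2 r t rr).
  rewrite (Isum (fun n => (k n)%:C *
    ((cos (n%:R * t))%:C * mode (fun a => cos (n%:R * a)) U r +
     (sin (n%:R * t))%:C * mode (fun a => sin (n%:R * a)) U r))).
  apply: eq_bigr => n _; rewrite Im_scale Im_add !Im_scale.
  by congr (_ * (_ * _ + _ * _)); apply: eq_Rintegral => a _; rewrite Im_mulr.
Qed.

Section Approximation.
Context (W : R * R -> bicomplex R).
Hypotheses (WC : BCk 1 (disk rho) W)
  (Wv : forall z, disk rho z ->
    dbar W z = ((radial f z)^-1 *: dbar (fun w => mkB (radial f w) 0) z) * bconj (W z)).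

Let U z := Sc (W z).
Let V z := Vec (W z).
Let UC1 := Ck2_cC1 (@disk_open R rho) WC.1.
Let VC1 := Ck2_cC1 (@disk_open R rho) WC.2.

Lemma vekua_polar z : 0 < cmod z < rho ->
  cpartial dirx U z - cpartial diry V z =
    g (cmod z) * ((z.1 / cmod z)%:C * U z + (z.2 / cmod z)%:C * V z) /\
  cpartial diry U z + cpartial dirx V z =
    g (cmod z) * ((z.2 / cmod z)%:C * U z - (z.1 / cmod z)%:C * V z).
Proof.
move=> zz; have [z0 zr] := andP zz.
have d (u : R * R -> R[i]) (ux uy : R * R -> R[i]) : cC1_on (disk rho) u ux uy ->
    has_cderive z dirx u (ux z) /\ has_cderive z diry u (uy z).
  by move=> [/(_ z zr)[_ a1 a2 _ _] /(_ z zr)[_ b1 b2 _ _]].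
have [Ux Uy] := d U _ _ UC1; have [Vx Vy] := d V _ _ VC1.
have [fx fy] := fd zr.
have [E1 E2] := proj1 (vekuaP (W := W) Ux Uy Vx Vy fx fy) (Wv zr).
have fz : f (cmod z) != 0 by apply: f_neq0; rewrite cmod_ge0.
rewrite E1 E2 /radial_dx /radial_dy /radial f1E // /U /V.
move: (f _) fz (g _) (Sc _) (Vec _) (_ %:C) (_ %:C) => a a0 b u v x y.
by split; field.
Qed.

(** The kernel has frequencies up to N only, and by [modes_element] each frequency n contributes a
    combination of the two elements of index n. Its two constants do not depend on the point, so one
    finite family serves the whole punctured disk. *)
Lemma avg_span N : exists (s : seq (nat * bool)) (c : nat * bool -> R[i]),
  forall z, 0 < cmod z < rho ->
  \sum_(i <- s) c i *: e i z = mkB (cavg N U z) (cavg N V z).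
Proof.
have [k kE] := cavg_modes N.
have H n : exists cd : R[i] * R[i], forall r a : R, 0 < r < rho ->
    mkB ((cos (n%:R * a))%:C * mode (fun a => cos (n%:R * a)) U r +
         (sin (n%:R * a))%:C * mode (fun a => sin (n%:R * a)) U r)
        ((cos (n%:R * a))%:C * mode (fun a => cos (n%:R * a)) V r +
         (sin (n%:R * a))%:C * mode (fun a => sin (n%:R * a)) V r) =
    cd.1 *: e (n, false) (pol r a) + cd.2 *: e (n, true) (pol r a).
  have [c [d h]] := modes_element rho0 gM UC1 VC1 vekua_polar (FP n) (QP n)
    (@S1 n) (@S2 n).
  by exists (c, d).
have [cd Hcd] := choice H.
pose I := [seq (n, false) | n <- index_iota 0 N.+1] ++ [seq (n, true) | n <- index_iota 0 N.+1].
exists I, (fun i => (k i.1)%:C * (if i.2 then (cd i.1).2 else (cd i.1).1)) => z zz.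
have [z0 zr] := andP zz; have [t zE] := pol_surj z; set r := cmod z in zE zz z0 zr *.
have rr : `|r| < rho by rewrite gtr0_norm.
rewrite zE (kE _ _ _ UC1 r t rr) (kE _ _ _ VC1 r t rr).
rewrite /I big_cat !big_map !big_mkord /=.
elim: (N.+1) => [|m IH]; first by rewrite !big_ord0 /= addr0.
by rewrite !big_ord_recr /= addrACA IH -!scalerA -scalerDr -Hcd // bicomplexZ.
Qed.

End Approximation.

Lemma Re_bdot_self (D : bicomplex R) : Re (bdot D D) =
  Re (Sc D) ^+ 2 + Im (Sc D) ^+ 2 + (Re (Vec D) ^+ 2 + Im (Vec D) ^+ 2).
Proof. by case: D => [[a b] [c d]]; rewrite /bdot /Sc /Vec /=; ring. Qed.

Lemma elements_dense W : bergman (disk rho) f W -> forall eps : R, 0 < eps ->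
  exists (s : seq (nat * bool)) (c : nat * bool -> R[i]),
    let D z := W z - \sum_(i <- s) c i *: e i z in Re (inner (disk rho) D D) < eps.
Proof.
move=> [WC [L1 L2 L3 L4] Wv] eps eps0.
have [uR uI] := Ck2_cC1 (@disk_open R rho) WC.1.
have [vR vI] := Ck2_cC1 (@disk_open R rho) WC.2.
have mD := @disk_measurable R rho.
(* Four real components at eps/8 each add up to eps/2, which leaves the strict inequality. *)
have e8 : 0 < eps / 8 by rewrite divr_gt0.
have [N1 H1] := avg_L2 rho0 uR (L2_integrable_sqr mD L1) e8.
have [N2 H2] := avg_L2 rho0 uI (L2_integrable_sqr mD L2) e8.
have [N3 H3] := avg_L2 rho0 vR (L2_integrable_sqr mD L3) e8.
have [N4 H4] := avg_L2 rho0 vI (L2_integrable_sqr mD L4) e8.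
pose N := (N1 + N2 + N3 + N4)%N.
have [l1 l2 l3 l4] : [/\ N1 <= N, N2 <= N, N3 <= N & N4 <= N]%N.
  rewrite /N; split; last exact: leq_addl.
  - by rewrite -!addnA leq_addr.
  - by rewrite -addnA (leq_trans (leq_addl N1 N2)) ?leq_addr.
  - by rewrite (leq_trans (leq_addl (N1 + N2) N3)) ?leq_addr.
have [s [c sE]] := avg_span WC Wv N.
exists s, c => D.
pose A := punctured rho.
have mA : measurable (A : set T2) := @punctured_measurable R rho.
have Ad : A `<=` disk rho by move=> z /andP[].
have bS : bmeasurable A (fun z => \sum_(i <- s) c i *: e i z).
  apply: bmeasurable_sum => i; have [m1 m2 m3 m4] := BCk_bmeasurable (element_regular i).
  by split; apply: measurable_funS mD Ad _.
have [m1 m2 m3 m4] := bS.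
pose q u z : R := (avg N u z - u z) ^+ 2.
have qm (u : R * R -> R) : measurable_fun (A : set T2) (avg N u : T2 -> T1) ->
    measurable_fun (disk rho : set T2) (u : T2 -> T1) ->
    measurable_fun (A : set T2) ((fun z => (q u z)%:E) : T2 -> \bar R).
  move=> ma mu; apply/measurable_EFinP; apply: measurable_funX; apply: measurable_funB => //.
  exact: measurable_funS mD Ad mu.
have avm (u h : R * R -> R) : (forall z, A z -> h z = avg N u z) ->
    measurable_fun (A : set T2) (h : T2 -> T1) ->
    measurable_fun (A : set T2) (avg N u : T2 -> T1).
  by move=> hE; apply: eq_measurable_fun => z; rewrite inE => /hE.
have a1 := avm (fun z => Re (Sc (W z))) _ (fun z zA => congr1 (fun B => Re (Sc B)) (sE z zA)) m1.
have a2 := avm (fun z => Im (Sc (W z))) _ (fun z zA => congr1 (fun B => Im (Sc B)) (sE z zA)) m2.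
have a3 := avm (fun z => Re (Vec (W z))) _ (fun z zA => congr1 (fun B => Re (Vec B)) (sE z zA)) m3.
have a4 := avm (fun z => Im (Vec (W z))) _ (fun z zA => congr1 (fun B => Im (Vec B)) (sE z zA)) m4.
have {}H1 := H1 N l1 A mA Ad a1; have {}H2 := H2 N l2 A mA Ad a2.
have {}H3 := H3 N l3 A mA Ad a3; have {}H4 := H4 N l4 A mA Ad a4.
have q1 := qm _ a1 (C1_measurable uR); have q2 := qm _ a2 (C1_measurable uI).
have q3 := qm _ a3 (C1_measurable vR); have q4 := qm _ a4 (C1_measurable vI).
pose B z : R := q (fun z => Re (Sc (W z))) z + q (fun z => Im (Sc (W z))) z +
  (q (fun z => Re (Vec (W z))) z + q (fun z => Im (Vec (W z))) z).
have DB z : A z -> Re (bdot (D z) (D z)) = B z.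
  move=> zA; have -> : D z = W z - mkB (cavg N (fun z => Sc (W z)) z) (cavg N (fun z => Vec (W z)) z).
    by rewrite /D sE.
  rewrite Re_bdot_self /B /q /cavg; case: (W z) => [[x1 x2] [x3 x4]].
  by rewrite /Sc /Vec /mkB /=; ring.
have mB : measurable_fun (A : set T2) ((fun z => (B z)%:E) : T2 -> \bar R).
  by rewrite /B; apply/measurable_EFinP; apply: measurable_funD; apply: measurable_funD;
    apply/measurable_EFinP.
have q0 u z : (0 <= (q u z)%:E)%E by rewrite lee_fin sqr_ge0.
have IB : (\int[area]_(z in A) (B z)%:E <= (eps / 2)%:E)%E.
  have -> : (\int[area]_(z in A) (B z)%:E =
    \int[area]_(z in A) (q (fun z => Re (Sc (W z))) z)%:E +
    \int[area]_(z in A) (q (fun z => Im (Sc (W z))) z)%:E +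
    (\int[area]_(z in A) (q (fun z => Re (Vec (W z))) z)%:E +
     \int[area]_(z in A) (q (fun z => Im (Vec (W z))) z)%:E))%E.
    rewrite -!ge0_integralD //.
    - by move=> z _; apply: adde_ge0.
    - exact: emeasurable_funD.
    - by move=> z _; apply: adde_ge0.
    - exact: emeasurable_funD.
  have -> : (eps / 2)%:E = ((eps / 8)%:E + (eps / 8)%:E + ((eps / 8)%:E + (eps / 8)%:E))%E.
    by rewrite -!EFinD; congr (_%:E); field.
  by apply: leeD; apply: leeD.
have E : (\int[area]_(z in disk rho) (Re (bdot (D z) (D z)))%:E = \int[area]_(z in A) (B z)%:E)%E.
  rewrite (@integral_punctured R rho (fun z => (Re (bdot (D z) (D z)))%:E) rho0).
  - by apply: eq_integral => z; rewrite inE => zA; rewrite DB.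
  - by apply: eq_measurable_fun mB => z; rewrite inE => zA; rewrite DB.
  - by move=> z; rewrite Re_bdot_self lee_fin !addr_ge0 ?sqr_ge0.
have -> : Re (inner (disk rho) D D) = fine (\int[area]_(z in A) (B z)%:E)%E.
  by rewrite -E.
have I0 : (0 <= \int[area]_(z in A) (B z)%:E)%E.
  by apply: integral_ge0 => z _; rewrite lee_fin /B !addr_ge0 ?sqr_ge0.
apply: (@le_lt_trans _ _ (eps / 2)); last by rewrite ltr_pdivrMr // ltr_pMr // ltr1n.
by rewrite -lee_fin fineK // ge0_fin_numE //; apply: le_lt_trans IB _; exact: ltry.
Qed.

End Density.

(** * From the kernels to profiles, norms and membership *)

Section FormalPowers.
Context {R : realType} (rho : R) (q f : R -> R[i]) (Gf Ginv : R * R -> R[i])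
  (yf yinv : nat -> R -> R[i]).
Hypotheses (rho0 : 0 < rho) (q_C1 : Ck1 1 `[0, rho] q) (f_C2 : Ck1 2 `[0, rho] f)
  (f_neq0 : forall r : R, 0 <= r <= rho -> f r != 0)
  (f_eq : radial_schrodinger rho q f) (f_0 : f 0 = 1)
  (Gf_kernel : transmutation_kernel rho q Gf)
  (Ginv_kernel : transmutation_kernel rho (darboux q f) Ginv)
  (yf_sol : forall n, regular_solution rho q n (yf n))
  (yinv_sol : forall n, regular_solution rho (darboux q f) n (yinv n)).
Local Notation T1 := (measurableTypeR R).
Local Notation T2 := (measurableTypeR R * measurableTypeR R)%type.
Local Notation g := (logder f).
Local Notation F := (kphi Gf).
Local Notation Q := (kphi Ginv).

Lemma kphi_profile M n p G :
  (forall x : R, 0 < x < rho -> {for x, continuous (fun r : R => Re (p r))} /\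
     {for x, continuous (fun r : R => Im (p r))}) ->
  (forall x : R, 0 < x < rho -> normc (p x) <= M) -> transmutation_kernel rho p G ->
  exists H : (R -> R[i]) * (R -> R[i]),
    regular_radial rho n p (kphi G n) H.1 H.2 /\ radial_profile rho (kphi G n) H.1.
Proof.
move=> pc pM GK.
have [K0 K1 [H1 [H2 reg]]] := kphi_solution n rho0 (fun x xr => (pc x xr).1)
  (fun x xr => (pc x xr).2) pM GK.
exists (H1, H2); split => //; have [d1 d2 _ bd] := reg; split => // r rr.
exact: cderive_ccont (d2 r rr).
Qed.

Lemma profile_lim0 P P1 : radial_profile rho P P1 -> lim0 (fun r => P r - 1).
Proof.
move=> [[P0 [P0r P0i] PE] P01 _ _ _].
have at0 (u u0 : R -> R) : continuous u0 -> (forall r : R, 0 <= r <= rho -> u r = u0 r) ->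
    u r @[r --> 0^'+] --> u 0.
  move=> u0c uE; have /cvg_at_right_filter := u0c 0; rewrite -uE ?lexx ?ltW //.
  apply: cvg_trans; apply: near_eq_cvg; near=> x; rewrite uE //; apply/andP; split; near: x.
    by apply: filterS (nbhs_right_gt 0) => x /ltW.
  by apply: filterS (nbhs_right_lt rho0) => x /ltW.
rewrite -P01; apply: lim0_sub_cst.
- by apply: at0 P0r _ => r /PE ->.
- by apply: at0 P0i _ => r /PE ->.
Unshelve. all: by end_near. Qed.

(** The kernels of f and 1/f are unrelated by definition; uniqueness of regular solutions ties their
    moments together through [darboux_pair] and identifies them with the factors phi. *)
Lemma kernel_profiles : exists F1 Q1 : nat -> R -> R[i],
  [/\ forall n, radial_profile rho (F n) (F1 n) /\ radial_profile rho (Q n) (Q1 n),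
      forall r : R, 0 < r < rho -> F 0%N r = f r,
      forall n (r : R), 0 < r < rho ->
        r%:C * F1 n r + n%:R * F n r - r%:C * g r * F n r = n%:R * Q n r /\
        r%:C * Q1 n r + n%:R * Q n r + r%:C * g r * Q n r = n%:R * F n r &
      forall n (r : R), 0 < r < rho ->
        F n r = phi_of n (yf n) r /\ Q n r = phi_of n (yinv n) r].
Proof.
have [Mq qM] := q_bounded rho0 q_C1.
have [Md dM] := darboux_bounded rho0 q_C1 f_C2 f_neq0.
have [H1 H1P] := choice (fun n => kphi_profile n (q_continuous rho0 q_C1) qM Gf_kernel).
have [H2 H2P] := choice (fun n => kphi_profile n
  (darboux_continuous rho0 q_C1 f_C2 f_neq0 f_eq) dM Ginv_kernel).
have pair n (r : R) : 0 < r < rho ->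
  [/\ n = 0%N -> F n r = f r,
      r%:C * (H1 n).1 r + n%:R * F n r - r%:C * g r * F n r = n%:R * Q n r &
      r%:C * (H2 n).1 r + n%:R * Q n r + r%:C * g r * Q n r = n%:R * F n r].
  have [reg1 prof1] := H1P n; have [reg2 prof2] := H2P n.
  have [K _ FK] := profile_bounded prof1.
  exact: (darboux_pair rho0 q_C1 f_C2 f_neq0 f_eq f_0 reg1 (profile_lim0 prof1) FK reg2
    (profile_lim0 prof2)).
exists (fun n => (H1 n).1), (fun n => (H2 n).1); split.
- by move=> n; split; [exact: (H1P n).2|exact: (H2P n).2].
- by move=> r rr; have [-> //] := pair 0%N r rr.
- by move=> n r rr; have [_ s1 s2] := pair n r rr.
- move=> n r rr; split.
    exact: (regular_solution_phi rho0 qM (H1P n).1 (profile_lim0 (H1P n).2) (yf_sol n)).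
  exact: (regular_solution_phi rho0 dM (H2P n).1 (profile_lim0 (H2P n).2) (yinv_sol n)).
Qed.

Lemma weighted_norm2_profile n (P P1 y : R -> R[i]) : radial_profile rho P P1 ->
  (forall r : R, 0 < r < rho -> P r = phi_of n y r) ->
  \int[@lebesgue_measure R]_(r in `[0, rho]) (normc (P r) ^+ 2 * r ^+ (2 * n + 1)) =
  weighted_norm2 rho n (phi_of n y).
Proof.
move=> [[P0 P0c PE] _ _ _ _] PY.
have c : continuous (fun r : R => normc (P0 r) ^+ 2 * r ^+ (2 * n + 1)).
  by move=> r; apply: cvgM; [exact: (norm2_continuous P0c)|exact: pow_continuous].
transitivity (\int[@lebesgue_measure R]_(r in `[0, rho]) (normc (P0 r) ^+ 2 * r ^+ (2 * n + 1))).
  by apply: eq_Rintegral => r; rewrite inE /= in_itv /= => /PE ->.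
rewrite -(Rintegral_oo_cc rho0 (continuous_integrable_cc 0 rho c)).
apply: eq_Rintegral => r; rewrite inE /= in_itv /= => /[dup] rr /PY <-.
by rewrite PE //; case/andP: rr => r0 r1; rewrite !ltW.
Qed.

Lemma element_BL2 (P P1 S S1 : R -> R[i]) k n : radial_profile rho P P1 ->
  radial_profile rho S S1 -> BL2 (disk rho) (element P S k n).
Proof.
move=> [[P0 P0c PE] _ _ _ _] [[S0 S0c SE] _ _ _ _].
have mD := @disk_measurable R rho.
have L (u h : R * R -> R) : continuous h -> (forall z, disk rho z -> u z = h z) ->
    L2 (disk rho) u.
  move=> hc uE; apply: integrable_sqr_L2 => //.
    apply: (eq_measurable_fun (h : T2 -> T1)) => [z|]; first by rewrite inE => /uE.
    by apply: continuous_measurable_plane => [|z _]; [exact: disk_open|exact: hc].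
  have hi : area.-integrable (disk rho : set T2) (EFin \o (fun z => h z ^+ 2)).
    apply: (continuous_disk_integrable rho0 (f := fun z => h z ^+ 2)) => z.
    by apply: cvgM; exact: hc.
  by apply: eq_integrable hi => // z; rewrite inE /= => /uE ->.
have comp (p : R -> R) (h : R * R -> R) : continuous p -> continuous h ->
    continuous (fun z => p (cmod z) * h z).
  move=> pc hc z; apply: cvgM; last exact: hc.
  by apply: continuous_comp; [exact: cmod_continuous|exact: pc].
have kr : continuous (fun z => Re (k * cx z ^+ n)) by move=> z; have [] := pow_ccont k n z.
have ki : continuous (fun z => Im (k * cx z ^+ n)) by move=> z; have [] := pow_ccont k n z.
have zin z : disk rho z -> 0 <= cmod z <= rho by move=> zr; rewrite cmod_ge0 ltW.
split.
- by apply: (L _ _ (comp _ _ P0c.1 kr)) => z /zin zz; rewrite /element /Sc /= /radial PE // Re_mulr.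
- by apply: (L _ _ (comp _ _ P0c.2 kr)) => z /zin zz; rewrite /element /Sc /= /radial PE // Im_mulr.
- by apply: (L _ _ (comp _ _ S0c.1 ki)) => z /zin zz; rewrite /element /Vec /= /radial SE // Re_mulr.
- by apply: (L _ _ (comp _ _ S0c.2 ki)) => z /zin zz; rewrite /element /Vec /= /radial SE // Im_mulr.
Qed.

Lemma cC1_at (A : set (R * R)) U Ux Uy z : cC1_on A U Ux Uy -> A z ->
  ccont_at z U /\ (has_cderive z dirx U (Ux z) /\ ccont_at z Ux) /\
  (has_cderive z diry U (Uy z) /\ ccont_at z Uy).
Proof. by move=> [ur ui] /[dup] /ur[a1 a2 a3 a4 a5] /ui[b1 b2 b3 b4 b5]. Qed.

(** The disk is open, so functions that agree on it have the same derivatives there. This passes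
    membership from an [element] to the formal power, their equality being established on the disk
    only. *)
Lemma bergman_ext (W W' : R * R -> bicomplex R) : (forall z, disk rho z -> W z = W' z) ->
  bergman (disk rho) f W -> bergman (disk rho) f W'.
Proof.
move=> WW [[u v] [l1 l2 l3 l4] Wv].
have oD := @disk_open R rho; have uC := Ck2_cC1 oD u; have vC := Ck2_cC1 oD v.
have near_eq (p : bicomplex R -> R[i]) z : disk rho z -> \forall s \near z, p (W s) = p (W' s).
  by move=> zr; apply: filterS (disk_near zr) => s /WW ->.
have ext (p : bicomplex R -> R[i]) Ux Uy : cC1_on (disk rho) (fun z => p (W z)) Ux Uy ->
    forall z, disk rho z -> ccont_at z (fun z => p (W' z)) /\
      (has_cderive z dirx (fun z => p (W' z)) (Ux z) /\ ccont_at z Ux) /\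
      (has_cderive z diry (fun z => p (W' z)) (Uy z) /\ ccont_at z Uy).
  move=> C z zr; have [c0 [[dx cx] [dy cy]]] := cC1_at C zr; have ne := near_eq p z zr.
  split; first exact: ccont_near ne c0.
  by split; split => //; [exact: has_cderive_near ne dx|exact: has_cderive_near ne dy].
have u' := ext Sc _ _ uC; have v' := ext Vec _ _ vC.
split.
- by split; [exact: C1_Ck2 oD u'|exact: C1_Ck2 oD v'].
- have L (p : bicomplex R -> R) : L2 (disk rho) (fun z => p (W z)) -> L2 (disk rho) (fun z => p (W' z)).
    rewrite /L2 (_ : (fun z => p (W z)) \_ (disk rho) = (fun z => p (W' z)) \_ (disk rho)) //.
    by apply/funext => z; rewrite !patchE; case: ifPn => //; rewrite inE => /WW ->.
  by split; [exact: (L (fun B => Re (Sc B)))|exact: (L (fun B => Im (Sc B)))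
    |exact: (L (fun B => Re (Vec B)))|exact: (L (fun B => Im (Vec B)))].
- move=> z zr; rewrite -(WW z zr) -(Wv z zr).
  have [_ [[ux _] [uy _]]] := cC1_at uC zr; have [_ [[vx _] [vy _]]] := cC1_at vC zr.
  have [_ [[ux' _] [uy' _]]] := u' z zr; have [_ [[vx' _] [vy' _]]] := v' z zr.
  by rewrite (dbarE ux uy vx vy) (dbarE ux' uy' vx' vy').
Qed.

End FormalPowers.

Theorem theorem47 (R : realType) (rho : R) (q f : R -> R[i])
    (Gf Ginv : R * R -> R[i]) (yf yinv : nat -> R -> R[i])
    (rho_gt0 : 0 < rho)
    (q_C1 : Ck1 1 `[0, rho] q)
    (f_C2 : Ck1 2 `[0, rho] f)
    (f_neq0 : forall r : R, 0 <= r <= rho -> f r != 0)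
    (f_eq : radial_schrodinger rho q f)
    (f_0 : f 0 = 1)
    (f_lim : Normc.normc (r%:C * cderive f r) @[r --> 0^'+] --> (0 : R))
    (f_radial_C2 : Ck2 2 (closure (disk rho)) (radial f))
    (Gf_kernel : transmutation_kernel rho q Gf)
    (Ginv_kernel : transmutation_kernel rho (darboux q f) Ginv)
    (yf_sol : forall n, regular_solution rho q n (yf n))
    (yinv_sol : forall n, regular_solution rho (darboux q f) n (yinv n)) :
  let Omega := disk rho in
  let Z := formal_power Gf Ginv in
  let phi_f n := phi_of n (yf n) in
  let phi_inv n := phi_of n (yinv n) in
  [/\ forall n m, (0 < n)%N -> (0 < m)%N ->
        inner Omega (Z n 1) (Z m jB) = 0,
      forall Lam : bicomplex R, Lam = 1 \/ Lam = jB ->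
      forall n m, (0 < n)%N -> (0 < m)%N ->
        inner Omega (Z n Lam) (Z m Lam) =
        (pi * (weighted_norm2 rho n (phi_f n)
               + weighted_norm2 rho n (phi_inv n)))%:C * (n == m)%:R,
      forall Lam : bicomplex R, Lam = 1 \/ Lam = jB ->
      forall m, (0 < m)%N ->
        inner Omega (Z 0%N 1) (Z m Lam) = 0 /\
        inner Omega (Z 0%N jB) (Z m Lam) = 0 &
      orthogonal_basis Omega (bergman Omega f)
        (fun i : nat * bool => Z i.1 (if i.2 then jB else 1))].
Proof.
move=> Omega Z phi_f phi_inv.
have [F1 [Q1 [prof F0E S phiE]]] := kernel_profiles rho_gt0 q_C1 f_C2 f_neq0 f_eq f_0
  Gf_kernel Ginv_kernel yf_sol yinv_sol.
pose e (i : nat * bool) := element (kphi Gf i.1) (kphi Ginv i.1) (unit_of i.2) i.1.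
have FP n : radial_profile rho (kphi Gf n) (F1 n) := (prof n).1.
have QP n : radial_profile rho (kphi Ginv n) (Q1 n) := (prof n).2.
have ZE n b z : Omega z -> Z n (if b then jB else 1) z = e (n, b) z.
  by move=> zr; rewrite /Z (formal_power_element rho_gt0 n b Gf_kernel Ginv_kernel zr).
have innerE n b m b' : inner Omega (Z n (if b then jB else 1)) (Z m (if b' then jB else 1)) =
    inner Omega (e (n, b)) (e (m, b')).
  by apply: inner_ext => z zr; exact: ZE.
have lamE Lam : Lam = 1 \/ Lam = jB -> exists b : bool, Lam = if b then jB else 1 :> bicomplex R.
  by case=> ->; [exists false|exists true].
have orth i k : i != k -> inner Omega (e i) (e k) = 0.
  exact: (inner_element_orthogonal rho_gt0 FP QP).
have rr0 (r : R) : 0 < r < rho -> f r != 0.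
  by move=> /andP[r0 rr]; apply: f_neq0; rewrite !ltW.
(* For n = 0 the first-order system reads r F' = r g F, and F = f. *)
have f1E (r : R) : 0 < r < rho -> F1 0%N r = logder f r * f r.
  move=> rr; have [s1 _] := S 0%N r rr; have [r0 _] := andP rr.
  have rC : r%:C != 0 :> R[i] by rewrite (inj_eq (@complexI R)) gt_eqF.
  apply: (mulfI rC); move: s1; rewrite !mul0r addr0 F0E // => /subr0_eq ->.
  by rewrite -[LHS]mulrA.
have F00 (r : R) : 0 <= r < rho -> kphi Gf 0 r = f r.
  move=> /andP[]; rewrite le_eqVlt => /predU1P[<- _|r0 rr]; last by apply: F0E; rewrite r0.
  by have [_ -> _ _ _] := FP 0%N.
(* The gradient of f, at the origin as well, is inherited from [kphi Gf 0], which equals f on [0,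
   rho[; at r = 0 both have the value 1. *)
have fd z : disk rho z -> has_cderive z dirx (radial f) (radial_dx (F1 0%N) z) /\
    has_cderive z diry (radial f) (radial_dy (F1 0%N) z).
  move=> zr; have [dx dy] := radial_derive rho_gt0 (FP 0%N) zr.
  have ne : \forall s \near z, radial (kphi Gf 0) s = radial f s.
    by apply: filterS (disk_near zr) => s sr; rewrite /radial F00 // cmod_ge0.
  by split; [exact: has_cderive_near ne dx|exact: has_cderive_near ne dy].
have f_neq r : 0 <= r < rho -> f r != 0.
  by move=> /andP[r0 rr]; apply: f_neq0; rewrite r0 ltW.
have S1 n r rr := (S n r rr).1; have S2 n r rr := (S n r rr).2.
have ebergman i : bergman Omega f (e i).
  split.
  - exact: (element_regular rho_gt0 FP QP).
  - exact: (element_BL2 rho_gt0 _ _ (FP i.1) (QP i.1)).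
  - move=> z zr; exact: (element_vekua rho_gt0 (FP i.1) (QP i.1) fd f_neq f1E (S1 i.1) (S2 i.1)).
split.
- by move=> n m n0 m0; rewrite (innerE n false m true) orth // xpair_eqE andbF.
- move=> Lam /lamE[b ->] n m n0 m0; rewrite innerE.
  rewrite (inner_element_gt0 rho_gt0 FP QP); last by rewrite addn_gt0 n0.
  rewrite (weighted_norm2_profile rho_gt0 (FP n) (fun r rr => (phiE n r rr).1)).
  rewrite (weighted_norm2_profile rho_gt0 (QP n) (fun r rr => (phiE n r rr).2)).
  by rewrite eqxx mulr1 mulrC rmorphM rmorph_nat.
- move=> Lam /lamE[b ->] m m0.
  have ne c : (0%N, c) != (m, b) by rewrite xpair_eqE eq_sym (gtn_eqF m0).
  by rewrite (innerE 0%N false) (innerE 0%N true) !orth.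
- split.
  + by move=> [n b]; apply: bergman_ext (ebergman (n, b)) => z /ZE ->.
  + by move=> [n b]; rewrite innerE; exact: (inner_element_self_neq0 rho_gt0 FP QP).
  + by move=> [n b] [m b'] ik; rewrite innerE orth.
  + move=> W HW eps eps0; have [M gM] := logder_bounded rho_gt0 f_C2 f_neq0.
    have [s [c H]] := elements_dense rho_gt0 gM FP QP fd f_neq f1E S1 S2 HW eps0.
    exists s, c => D; rewrite (_ : inner _ D D = inner Omega
      (fun z => W z - \sum_(i <- s) c i *: e i z) (fun z => W z - \sum_(i <- s) c i *: e i z)) //.
    by apply: inner_ext => z zr; congr (_ - _); apply: eq_bigr => -[n b] _; rewrite ZE.
Qed.
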